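(* Let $a,b>0$ be constants with $a+b<\tfrac12$. There exists $\varepsilon_0>0$ such that for every fixed $0<\varepsilon<\varepsilon_0$ the following holds. Consider data $n,\boldsymbol{s},\boldsymbol{t},H$ with $n\to\infty$, where $x_j=y_j=x$ for all $j$, such that uniformly $s_j-s$, $t_j-s$, $x$ are $O(n^{1/2+\varepsilon})$; $X=O(n^{1+2\varepsilon})$; and $\frac{(1-2\lambda)^2}{3A}\le a\log n$. Let $G$ be uniformly random in $\mathcal{D}(\boldsymbol{s},\boldsymbol{t})$. Then (i) the expected number of digraphs $H'\in\mathcal{I}(H)$ with every arc of $H'$ an arc of $G$ is \[p^X|\mathcal{I}(H)|\exp\Bigl(-\frac{(1-\lambda)x(x-2)}{2\lambda}-\frac{(R+C)x}{2\lambda^2n^2}+O(n^{-b})\Bigr);\] (ii) the expected number of digraphs $H'\in\mathcal{I}(H)$ that are arc-disjoint from $G$ is \[(1-p)^X|\mathcal{I}(H)|\exp\Bigl(-\frac{\lambda x(x-2)}{2(1-\lambda)}-\frac{(R+C)x}{2(1-\lambda)^2n^2}+O(n^{-b})\Bigr).\]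
   Context: A simple digraph has no loops and no multiple arcs. $\boldsymbol{s}=(s_1,\dots,s_n)$, $\boldsymbol{t}=(t_1,\dots,t_n)$ are vectors of positive integers with equal sums; $\mathcal{D}(\boldsymbol{s},\boldsymbol{t})$ is the set of simple digraphs on $\{w_1,\dots,w_n\}$ with out-degree $s_j$ and in-degree $t_j$ at $w_j$. $H$ is a fixed simple digraph on the same vertices with out-degrees $x_j$, in-degrees $y_j$, and $X$ arcs. $\mathcal{I}(H)$ is the set of digraphs on $\{w_1,\dots,w_n\}$ isomorphic to $H$ (so $|\mathcal{I}(H)|=n!/\operatorname{aut}(H)$). $s=n^{-1}\sum_js_j$, $\lambda=s/n$, $A=\tfrac12\lambda(1-\lambda)$, $p=s/(n-1)$, $R=\sum_j(s_j-s)^2$, $C=\sum_j(t_j-s)^2$. Asymptotic notation refers to $n\to\infty$. *)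

(* Defs.v *)
From mathcomp Require Import all_boot fingroup perm.
From Stdlib Require Import Reals.

Set Implicit Arguments.
Unset Strict Implicit.
Unset Printing Implicit Defensive.

Section Digraphs.
Variable n : nat.

(* A digraph on the vertex set {w_1,...,w_n} = 'I_n is a set of arcs (u,v).
   Being a set, it has no multiple arcs; "simple" additionally means loopless. *)
Definition digraph := {set 'I_n * 'I_n}.

Definition simple_digraph (D : digraph) : bool := [forall v : 'I_n, (v, v) \notin D].

Definition outdeg (D : digraph) (v : 'I_n) : nat := #|[set w : 'I_n | (v, w) \in D]|.
Definition indeg (D : digraph) (v : 'I_n) : nat := #|[set u : 'I_n | (u, v) \in D]|.

Definition Dst (s t : 'I_n -> nat) : {set digraph} :=
  [set D : digraph | simple_digraph D &&
     [forall v : 'I_n, (outdeg D v == s v) && (indeg D v == t v)]].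

Definition relabel (sigma : {perm 'I_n}) (D : digraph) : digraph :=
  [set (sigma e.1, sigma e.2) | e in D].

Definition iso_copies (H : digraph) : {set digraph} :=
  [set H' : digraph | [exists sigma : {perm 'I_n}, H' == relabel sigma H]].

Definition n_contained (H G : digraph) : nat :=
  #|[set H' in iso_copies H | H' \subset G]|.

Definition n_disjoint (H G : digraph) : nat :=
  #|[set H' in iso_copies H | [disjoint H' & G]]|.

Local Open Scope R_scope.

(* expectation of f(G) for G uniform in D(s,t) (meaningful when D(s,t) <> empty) *)
Definition expect_unif (s t : 'I_n -> nat) (f : digraph -> nat) : R :=
  (INR (\sum_(G in Dst s t) f G)%N / INR #|Dst s t|).

Definition savg (s : 'I_n -> nat) : R := (INR (\sum_(j < n) s j)%N / INR n).
Definition lam (s : 'I_n -> nat) : R := (savg s / INR n).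
Definition Acoef (s : 'I_n -> nat) : R := (lam s * (1 - lam s) / 2).
Definition pdens (s : 'I_n -> nat) : R := (savg s / (INR n - 1)).
Definition Rdev (s : 'I_n -> nat) : R :=
  \big[Rplus/0]_(j < n) ((INR (s j) - savg s) ^ 2).
Definition Cdev (s t : 'I_n -> nat) : R :=
  \big[Rplus/0]_(j < n) ((INR (t j) - savg s) ^ 2).

End Digraphs.

(* Main.v *)
(** The expectation is a sum, over the copies [Y] of [H], of the probability that
    [Y] is contained in (respectively, disjoint from) [G]. Revealing the arcs of [Y]
    one at a time turns this probability into a product of conditional arc
    probabilities, each in a class of digraphs with given degrees whose content on
    a sparse set of positions is frozen.

    In such a class, exchanging the contents of two columns between two rows [j]
    and [l] (a switching) is a measure preserving bijection, and yields an exact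
    identity for the mean of [(x_jk - x_lk) f]. Applied to exponential weights it
    shows that, up to superpolynomially small probability, any two rows differ in
    [2 lambda (1 - lambda) n + O~(n^(1/2))] columns. Applied to monomials in boundedly
    many entries it then shows that these entries are independent up to
    [O~(n^(-1/2))]. Applied to columns and then to rows it finally gives
      [P(jk) = lambda + d_j + h_k + kappa d_j h_k - (frozen part) + O~(n^(-3/2))]
    with [d_j = s_j/n - lambda], [h_k = t_k/n - lambda] and
    [kappa = (1 - 2 lambda) / (lambda (1 - lambda))].

    Multiplied along the arcs of [Y], these estimates produce the stated exponent
    plus the cross term [- sum_(jk in Y) d_j h_k / (lambda (1 - lambda))]. Averaging
    over the relabelings of [H] removes it: a transposition changes it very little,
    and [sum_j d_j = 0]. *)

Require Import Defs.
From mathcomp Require Import all_boot all_order fingroup perm all_algebra.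
From mathcomp Require Import ring lra.
From mathcomp Require Import reals sequences exp.
From mathcomp Require boolp classical_sets functions set_interval topology normedtype derive realfun.
Set Implicit Arguments.
Unset Strict Implicit.
Unset Printing Implicit Defensive.
Import Order.TTheory GRing.Theory Num.Theory.
Local Open Scope ring_scope.

(** * Switchings *)

(** A copy has [n] times a small power of [n] arcs, and the errors of the single arc probabilities
    add up in the exponent. Each conditional probability is therefore needed up to [n^(-3/2)], which
    leaves [n^(-1/2)] in total, small powers of [n] aside.

    The obstacle is the random denominator in the switching identity, the number of columns in which
    two rows differ: its relative fluctuation is about [n^(-1/2)], too much to replace it by its
    typical value at once. It divides a surplus that makes the quotient of order [n^(-1/2)], so what
    is needed up to [n^(-1)] is the relative share of one column among the differing ones. The
    shares add up to one, hence it suffices to compare two columns. Switching these columns in one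
    row produces another small surplus, and the mean left over is needed only up to [n^(-1/2)],
    where near independence of a few entries is enough. *)

Section Switching.
Variable n : nat.
Implicit Types (M F Z : digraph n) (i j k l v w : 'I_n) (p : 'I_n * 'I_n).

(* The positions in [F] are frozen with content [Z]; simple digraphs are the case
   where [F] is the diagonal and [Z] is empty. *)
Definition frozen_class F Z (s t : 'I_n -> nat) : {set digraph n} :=
  [set M : digraph n | (M :&: F == Z) &&
     [forall v, (outdeg M v == s v) && (indeg M v == t v)]].

Definition corners j l k k' : digraph n := [set (j, k); (j, k'); (l, k); (l, k')].

(** A symmetric difference, hence an involution of all digraphs, so that sums can be reindexed by it
    without side conditions. It preserves degrees only on [switchable] digraphs. *)
Definition switch j l k k' M : digraph n :=
  [set p | (p \in M) (+) (p \in corners j l k k')].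

Definition switchable j l k k' M :=
  [&& (j, k) \in M, (l, k) \notin M, (j, k') \notin M & (l, k') \in M].

Lemma switchK j l k k' : involutive (switch j l k k').
Proof. by move=> M; apply/setP => p; rewrite !inE -addbA addbb addbF. Qed.

Lemma in_switch_out j l k k' M p :
  p \notin corners j l k k' -> (p \in switch j l k k' M) = (p \in M).
Proof. by move=> h; rewrite inE (negbTE h) addbF. Qed.

Lemma in_switch_in j l k k' M p :
  p \in corners j l k k' -> (p \in switch j l k k' M) = (p \notin M).
Proof. by move=> h; rewrite inE h addbT. Qed.

Lemma in_corners j l k k' v w :
  ((v, w) \in corners j l k k') = ((v == j) || (v == l)) && ((w == k) || (w == k')).
Proof.
rewrite !inE !xpair_eqE.
by case: (v == j); case: (v == l); case: (w == k); case: (w == k').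
Qed.

Lemma switchable_switch j l k k' M : j != l -> k != k' ->
  switchable j l k k' (switch j l k k' M) = switchable j l k' k M.
Proof.
move=> jl kk'; rewrite /switchable !in_switch_in ?in_corners ?eqxx ?orbT //.
by rewrite !negbK; do 4 case: (_ \in M).
Qed.

(** On a [switchable] digraph row [j] has opposite contents in the columns [k] and [k'], so toggling
    both amounts to permuting this row by [tperm k k'], and its degree is preserved. The next three
    lemmas do the same for row [l] and for the two columns. *)
Lemma switch_row j l k k' M w : j != l -> k != k' -> switchable j l k k' M ->
  ((j, w) \in switch j l k k' M) = ((j, tperm k k' w) \in M).
Proof.
move=> jl kk' /and4P [h1 h2 h3 h4]; rewrite inE in_corners eqxx /=.
case: tpermP => [->|->|/eqP/negbTE -> /eqP/negbTE ->]; last by rewrite addbF.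
  by rewrite eqxx h1 /= (negbTE h3).
by rewrite eqxx orbT (negbTE h3) h1.
Qed.

Lemma switch_row2 j l k k' M w : j != l -> k != k' -> switchable j l k k' M ->
  ((l, w) \in switch j l k k' M) = ((l, tperm k k' w) \in M).
Proof.
move=> jl kk' /and4P [h1 h2 h3 h4]; rewrite inE in_corners eqxx orbT /=.
case: tpermP => [->|->|/eqP/negbTE -> /eqP/negbTE ->]; last by rewrite addbF.
  by rewrite eqxx h4 /= (negbTE h2).
by rewrite eqxx orbT h4 (negbTE h2).
Qed.

Lemma switch_col j l k k' M w : j != l -> k != k' -> switchable j l k k' M ->
  ((w, k) \in switch j l k k' M) = ((tperm j l w, k) \in M).
Proof.
move=> jl kk' /and4P [h1 h2 h3 h4]; rewrite inE in_corners eqxx andbT.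
case: tpermP => [->|->|/eqP/negbTE -> /eqP/negbTE ->]; last by rewrite addbF.
  by rewrite eqxx h1 /= (negbTE h2).
by rewrite eqxx orbT h1 (negbTE h2).
Qed.

Lemma switch_col2 j l k k' M w : j != l -> k != k' -> switchable j l k k' M ->
  ((w, k') \in switch j l k k' M) = ((tperm j l w, k') \in M).
Proof.
move=> jl kk' /and4P [h1 h2 h3 h4]; rewrite inE in_corners eqxx orbT andbT.
case: tpermP => [->|->|/eqP/negbTE -> /eqP/negbTE ->]; last by rewrite addbF.
  by rewrite eqxx h4 /= (negbTE h3).
by rewrite eqxx orbT h4 (negbTE h3).
Qed.

Lemma switch_outdeg j l k k' M v : j != l -> k != k' -> switchable j l k k' M ->
  outdeg (switch j l k k' M) v = outdeg M v.
Proof.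
move=> jl kk' sM; rewrite /outdeg.
have [->|vj] := eqVneq v j.
  rewrite -(card_preimset [set w | (j, w) \in M] (@perm_inj _ (tperm k k'))).
  by apply: eq_card => w; rewrite inE (switch_row _ _ _ sM) // !inE.
have [->|vl] := eqVneq v l.
  rewrite -(card_preimset [set w | (l, w) \in M] (@perm_inj _ (tperm k k'))).
  by apply: eq_card => w; rewrite inE (switch_row2 _ _ _ sM) // !inE.
by apply: eq_card => w; rewrite [LHS]in_set [RHS]in_set in_switch_out // in_corners (negbTE vj) (negbTE vl).
Qed.

Lemma switch_indeg j l k k' M v : j != l -> k != k' -> switchable j l k k' M ->
  indeg (switch j l k k' M) v = indeg M v.
Proof.
move=> jl kk' sM; rewrite /indeg.
have [->|vj] := eqVneq v k.
  rewrite -(card_preimset [set w | (w, k) \in M] (@perm_inj _ (tperm j l))).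
  by apply: eq_card => w; rewrite inE (switch_col _ _ _ sM) // !inE.
have [->|vl] := eqVneq v k'.
  rewrite -(card_preimset [set w | (w, k') \in M] (@perm_inj _ (tperm j l))).
  by apply: eq_card => w; rewrite inE (switch_col2 _ _ _ sM) // !inE.
apply: eq_card => w; rewrite [LHS]in_set [RHS]in_set in_switch_out // in_corners (negbTE vj) (negbTE vl).
by rewrite andbF.
Qed.

Lemma switch_class F Z s t j l k k' M : j != l -> k != k' ->
  [disjoint corners j l k k' & F] -> switchable j l k k' M ->
  (switch j l k k' M \in frozen_class F Z s t) = (M \in frozen_class F Z s t).
Proof.
move=> jl kk' dF sM; rewrite !inE; congr (_ && _).
  suff -> : switch j l k k' M :&: F = M :&: F by [].
  apply/setP => p; rewrite !in_setI.
  case pF: (p \in F); last by rewrite !andbF.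
  by rewrite in_switch_out //; apply: contraL pF => h; rewrite (disjointFr dF h).
by apply: eq_forallb => v; rewrite switch_outdeg // switch_indeg.
Qed.

(** Every estimate proved for a pair of rows is used for a pair of columns through this map. *)
Definition transpose M : digraph n := [set p | (p.2, p.1) \in M].

Lemma in_transpose M j k : ((j, k) \in transpose M) = ((k, j) \in M).
Proof. by rewrite inE. Qed.

Lemma transposeK : involutive transpose.
Proof. by move=> M; apply/setP => -[j k]; rewrite !in_transpose. Qed.

Lemma outdeg_transpose M v : outdeg (transpose M) v = indeg M v.
Proof. by apply: eq_card => w; rewrite !inE. Qed.

Lemma indeg_transpose M v : indeg (transpose M) v = outdeg M v.
Proof. by apply: eq_card => w; rewrite !inE. Qed.

Lemma transpose_class F Z s t M :
  (transpose M \in frozen_class (transpose F) (transpose Z) t s) =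
  (M \in frozen_class F Z s t).
Proof.
rewrite !inE; congr (_ && _).
  have -> : transpose M :&: transpose F = transpose (M :&: F).
    by apply/setP => -[j k]; rewrite inE !in_transpose inE.
  by rewrite (inj_eq (can_inj transposeK)).
by apply: eq_forallb => v; rewrite outdeg_transpose indeg_transpose andbC.
Qed.

End Switching.

(** * Averages over a finite set *)

Section Mean.
Variables (R : realType) (T : finType).
Implicit Types (A : {set T}) (f g : T -> R) (c : R).

(** The value on the empty set is [0], so linearity and monotonicity hold without a nonemptiness
    condition; only means of constants require one. *)
Definition mean A f : R := (\sum_(M in A) f M) / #|A|%:R.

Lemma eq_mean A f g : {in A, f =1 g} -> mean A f = mean A g.
Proof. by move=> h; rewrite /mean (eq_bigr g). Qed.

Lemma meanD A f g : mean A (fun M => f M + g M) = mean A f + mean A g.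
Proof. by rewrite /mean big_split mulrDl. Qed.

Lemma meanZ A c f : mean A (fun M => c * f M) = c * mean A f.
Proof. by rewrite /mean -mulr_sumr mulrA. Qed.

Lemma meanN A f : mean A (fun M => - f M) = - mean A f.
Proof. by rewrite /mean sumrN mulNr. Qed.

Lemma meanB A f g : mean A (fun M => f M - g M) = mean A f - mean A g.
Proof. by rewrite meanD meanN. Qed.

Lemma mean_sum A (I : finType) (K : {set I}) (f : I -> T -> R) :
  mean A (fun M => \sum_(k in K) f k M) = \sum_(k in K) mean A (f k).
Proof. by rewrite /mean exchange_big /= mulr_suml. Qed.

Lemma mean_cst A c : A != set0 -> mean A (fun => c) = c.
Proof.
move=> A0; rewrite /mean sumr_const -[c *+ _]mulr_natr mulfK //.
by rewrite pnatr_eq0 cards_eq0.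
Qed.

Lemma le_mean A f g : (forall M, M \in A -> f M <= g M) -> mean A f <= mean A g.
Proof.
by move=> h; rewrite /mean ler_wpM2r ?invr_ge0 ?ler0n // ler_sum.
Qed.

Lemma mean_ge0 A f : (forall M, M \in A -> 0 <= f M) -> 0 <= mean A f.
Proof.
by move=> h; rewrite /mean mulr_ge0 ?invr_ge0 ?ler0n // sumr_ge0.
Qed.

Lemma norm_mean_le A f g : (forall M, M \in A -> `|f M| <= g M) -> `|mean A f| <= mean A g.
Proof.
move=> h; rewrite ler_norml -meanN !le_mean // => M MA.
  by have := h _ MA; rewrite ler_norml => /andP[].
by have := h _ MA; rewrite ler_norml => /andP[].
Qed.

Lemma norm_mean_cst A f c : A != set0 -> (forall M, M \in A -> `|f M| <= c) -> `|mean A f| <= c.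
Proof. by move=> A0 h; rewrite -[leRHS](mean_cst c A0) norm_mean_le. Qed.

End Mean.

(** * The exchange identity for two rows *)

Section Exchange.
Variables (R : realType) (n : nat) (F Z : digraph n) (s t : 'I_n -> nat).
Implicit Types (M : digraph n) (j l k : 'I_n) (f : digraph n -> R).

Definition entry M j k : R := ((j, k) \in M)%:R.

Lemma entry_ge0 M j k : 0 <= entry M j k. Proof. exact: ler0n. Qed.
Lemma entry_le1 M j k : entry M j k <= 1. Proof. by rewrite /entry; case: (_ \in _). Qed.

Definition only M j l k : R := entry M j k * (1 - entry M l k).

Lemma only_ge0 M j l k : 0 <= only M j l k.
Proof. by rewrite mulr_ge0 ?entry_ge0 // subr_ge0 entry_le1. Qed.

Lemma only_le1 M j l k : only M j l k + only M l j k <= 1.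
Proof. by rewrite /only /entry; do 2 case: (_ \in M) => /=; lra. Qed.

Lemma only_sub M j l k : only M j l k - only M l j k = entry M j k - entry M l k.
Proof. by rewrite /only; ring. Qed.

Lemma only_switchable M j l k k' :
  only M j l k * only M l j k' = (switchable j l k k' M)%:R.
Proof.
rewrite /only /entry /switchable.
by do 4 case: (_ \in M) => /=; ring.
Qed.

Local Notation Om := (frozen_class F Z s t).

Section Rows.
Variables (j l : 'I_n) (K : {set 'I_n}).
Hypothesis jl : j != l.

Lemma only_switch M k k' i : only (switch j l k k' M) j l i =
  if (i == k) || (i == k') then only M l j i else only M j l i.
Proof.
rewrite /only /entry; case: ifP => h.
  rewrite !in_switch_in ?in_corners ?eqxx ?orbT ?h //.
  by do 2 case: (_ \in M) => /=; ring.
by rewrite !in_switch_out ?in_corners ?eqxx ?orbT ?h.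
Qed.

Lemma only_switch2 M k k' i : only (switch j l k k' M) l j i =
  if (i == k) || (i == k') then only M j l i else only M l j i.
Proof.
rewrite /only /entry; case: ifP => h.
  rewrite !in_switch_in ?in_corners ?eqxx ?orbT ?h //.
  by do 2 case: (_ \in M) => /=; ring.
by rewrite !in_switch_out ?in_corners ?eqxx ?orbT ?h.
Qed.

Hypothesis freeK : forall k, k \in K -> ((j, k) \notin F) && ((l, k) \notin F).

Lemma corners_free k k' : k \in K -> k' \in K -> [disjoint corners j l k k' & F].
Proof.
move=> /freeK /andP[h1 h2] /freeK /andP[h3 h4].
rewrite disjoint_subset; apply/subsetP => p; rewrite !inE.
by move=> /orP[/orP[/orP[]|]|] /eqP ->.
Qed.

(** Reindexing by the involution [switch]. The product of the two [only] factors is the indicator of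
    [switchable], so invariance of the class is needed only there; the switch turns this indicator
    into the one with [k] and [k'] exchanged. *)
Lemma mean_switch k k' f : k \in K -> k' \in K -> k != k' ->
  mean Om (fun M => only M j l k * only M l j k' * f M) =
  mean Om (fun M => only M l j k * only M j l k' * f (switch j l k k' M)).
Proof.
move=> kK k'K kk'; rewrite /mean; congr (_ / _).
rewrite (reindex_inj (can_inj (switchK j l k k'))) /=.
rewrite big_mkcond [RHS]big_mkcond /=; apply: eq_bigr => M _.
rewrite [only _ l j k * _]mulrC !only_switchable switchable_switch //.
case: (boolP (switchable j l k' k M)) => sM; last by rewrite !mul0r !if_same.
have sM' : switchable j l k k' (switch j l k k' M) by rewrite switchable_switch.
have := switch_class Z s t jl kk' (corners_free kK k'K) sM'.
by rewrite switchK => ->.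
Qed.

Definition surplus M : R := \sum_(k in K) (entry M j k - entry M l k).
Definition ndiff M : R := \sum_(k in K) (only M j l k + only M l j k).

Lemma ndiff_ge0 M : 0 <= ndiff M.
Proof. by apply: sumr_ge0 => k _; rewrite addr_ge0 ?only_ge0. Qed.

Lemma ndiff_ge M k : k \in K -> only M j l k + only M l j k <= ndiff M.
Proof.
move=> kK; rewrite /ndiff (bigD1 k) //= lerDl sumr_ge0 // => i _.
by rewrite addr_ge0 ?only_ge0.
Qed.

Lemma surplusE M : surplus M = \sum_(k in K) only M j l k - \sum_(k in K) only M l j k.
Proof. by rewrite -sumrB; apply: eq_bigr => k _; rewrite only_sub. Qed.

Lemma ndiffE M : ndiff M = \sum_(k in K) only M j l k + \sum_(k in K) only M l j k.
Proof. by rewrite -big_split. Qed.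

Lemma ndiff_switch M k k' : ndiff (switch j l k k' M) = ndiff M.
Proof.
apply: eq_bigr => i _; rewrite only_switch only_switch2.
by case: ifP; rewrite // addrC.
Qed.

(* Rows [j] and [l] differ in [ndiff] columns of [K]; given those columns, the
   ones of row [j] among them form a uniformly random set of prescribed size.
   The last sum measures the failure of [f] to depend on that data only. Where
   [ndiff] vanishes so do both [only] terms, which makes division by it harmless. *)
Lemma mean_exchange k f : k \in K ->
  mean Om (fun M => (only M j l k - only M l j k) * f M) =
  mean Om (fun M => surplus M / ndiff M * (only M j l k + only M l j k) * f M) +
  2 * \sum_(k' in K)
     mean Om (fun M => only M j l k * only M l j k' * ((f M - f (switch j l k k' M)) / ndiff M)).
Proof.
move=> kK.
(* With [a], [b] the two [only] terms at [k] and [A], [B] their sums over [K], one has [a - b = (A -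
   B) / (A + B) * (a + b) + 2 * (a * B - b * A) / (A + B)]; [g] is [f] times
   [(a * B - b * A) / (A + B)]. Switching its negative terms turns them into the positive ones with
   [f] taken at the switched digraph. *)
pose g M := \sum_(k' in K)
  (only M j l k * only M l j k' * (f M / ndiff M) - only M l j k * only M j l k' * (f M / ndiff M)).
have -> : mean Om (fun M => (only M j l k - only M l j k) * f M) =
  mean Om (fun M => surplus M / ndiff M * (only M j l k + only M l j k) * f M + 2 * g M).
  apply: eq_mean => M _.
  have -> : g M = (only M j l k * \sum_(k' in K) only M l j k' -
                   only M l j k * \sum_(k' in K) only M j l k') * (f M / ndiff M).
    by rewrite /g sumrB mulrBl !mulr_sumr !mulr_suml.
  have := ndiff_ge M kK; have := only_ge0 M j l k; have := only_ge0 M l j k.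
  have [N0|N0] := eqVneq (ndiff M) 0.
    rewrite N0 => h1 h2 h3.
    have -> : only M j l k = 0 by lra.
    have -> : only M l j k = 0 by lra.
    by ring.
  move=> _ _ _; rewrite surplusE; move: N0; rewrite ndiffE => N0.
  by field.
rewrite meanD meanZ /g mean_sum; congr (_ + 2 * _); apply: eq_bigr => k' k'K.
rewrite meanB.
have -> : mean Om (fun M => only M l j k * only M j l k' * (f M / ndiff M)) =
  mean Om (fun M => only M j l k * only M l j k' * (f (switch j l k k' M) / ndiff M)).
  have [<-|kk'] := eqVneq k k'.
    apply: eq_mean => M _.
    suff h : only M l j k * only M j l k = 0.
      by rewrite h [only M j l k * _]mulrC h !mul0r.
    by rewrite /only /entry; do 2 case: (_ \in M) => /=; ring.
  rewrite (mean_switch _ kK k'K kk'); apply: eq_mean => M _.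
  by rewrite switchK ndiff_switch.
by rewrite -meanB; apply: eq_mean => M _; ring.
Qed.

Lemma mean_exchange_inv k f : k \in K ->
  (forall M k', M \in Om -> k' \in K -> switchable j l k k' M -> f (switch j l k k' M) = f M) ->
  mean Om (fun M => (entry M j k - entry M l k) * f M) =
  mean Om (fun M => surplus M / ndiff M * (only M j l k + only M l j k) * f M).
Proof.
move=> kK inv.
under eq_mean do rewrite -only_sub.
rewrite mean_exchange // big1 ?mulr0 ?addr0 // => k' k'K.
rewrite -(mul0r (mean Om (fun => 1))) -meanZ; apply: eq_mean => M MO.
rewrite only_switchable mul0r; case: (boolP (switchable _ _ _ _ _)) => sM; last by rewrite mul0r.
by rewrite inv // subrr mul0r mulr0.
Qed.

End Rows.
End Exchange.

(** * Codegrees *)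

Section ExpMoment.
Variables (R : realType) (n : nat) (F Z : digraph n) (s t : 'I_n -> nat).
Local Notation Om := (frozen_class F Z s t).
Local Notation entry := (@entry R n).
Local Notation only := (@only R n).

Lemma row_sum M j : M \in Om -> \sum_k entry M j k = (s j)%:R.
Proof.
rewrite inE => /andP[_ /forallP /(_ j) /andP[/eqP <- _]].
rewrite -natr_sum; congr (_%:R); rewrite /outdeg -sum1_card [RHS]big_mkcond.
by apply: eq_bigr => k _; rewrite inE; case: (_ \in _).
Qed.

Lemma col_sum M k : M \in Om -> \sum_j entry M j k = (t k)%:R.
Proof.
rewrite inE => /andP[_ /forallP /(_ k) /andP[_ /eqP <-]].
rewrite -natr_sum; congr (_%:R); rewrite /indeg -sum1_card [RHS]big_mkcond.
by apply: eq_bigr => j _; rewrite inE; case: (_ \in _).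
Qed.

Variables (j l l' : 'I_n) (K : {set 'I_n}).
Hypotheses (jl : j != l) (l'j : l' != j) (l'l : l' != l).
Hypothesis freeK : forall k, k \in K -> ((j, k) \notin F) && ((l, k) \notin F).

(** The codegree of [l'] with [j] minus that with [l], on the columns [K]. Only columns in which
    rows [j] and [l] differ contribute, each with a sign that the switches of these two rows
    randomise. *)
Definition overlap_gap M : R := \sum_(k in K) entry M l' k * (entry M j k - entry M l k).

(** Row [l'] is untouched and only two columns change: in column [k] the term falls by at most [2],
    in column [k'] it passes from nonpositive to nonnegative. *)
Lemma overlap_gap_switch M k k' : k != k' -> switchable j l k k' M ->
  overlap_gap M - 2 <= overlap_gap (switch j l k k' M).
Proof.
move=> kk' sM.
suff h : overlap_gap M - overlap_gap (switch j l k k' M) <= \sum_(i in K) 2 * (i == k)%:R.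
  have : \sum_(i in K) 2 * (i == k)%:R <= (2 : R).
    rewrite -mulr_sumr; suff : \sum_(i in K) (i == k)%:R <= (1 : R) by lra.
    case: (boolP (k \in K)) => kK.
      by rewrite (bigD1 k) //= eqxx big1 ?addr0 // => i /andP[_ /negbTE ->].
    rewrite big1 ?ler01 // => i iK; case: eqP => // ik.
    by move: kK; rewrite -ik iK.
  by move: h; lra.
rewrite /overlap_gap -sumrB; apply: ler_sum => i _.
rewrite /entry; have -> : ((l', i) \in switch j l k k' M) = ((l', i) \in M).
  by rewrite in_switch_out // in_corners (negbTE l'j) (negbTE l'l).
case/and4P: sM => h1 /negbTE h2 /negbTE h3 h4.
have [->|ik] := eqVneq i k.
  rewrite !in_switch_in ?in_corners ?eqxx ?orbT // h1 h2 /=.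
  by case: (_ \in _) => /=; lra.
have [->|ik'] := eqVneq i k'.
  rewrite !in_switch_in ?in_corners ?eqxx ?orbT // h3 h4 /=.
  by case: (_ \in _) => /=; lra.
by rewrite !in_switch_out ?in_corners ?(negbTE ik) ?(negbTE ik') ?andbF //=; lra.
Qed.

Variables (B th : R).
Hypotheses (th0 : 0 <= th) (hB : forall M, M \in Om -> `|surplus R j l K M| <= B).
Hypothesis small : th * (B + 4 * th * n%:R) <= 1 / 2.
Hypothesis Om0 : Om != set0.

Let w M := expR (th * overlap_gap M).

(** The exchange identity with weight [entry M l' k * w M]. The first part is at most
    [B * mean Om w], because the entries of row [l'] only select some of the [ndiff] columns. In the
    correction a switch lowers [w] at most by the factor [1 - 2 * th], and there are at most
    [n%:R * ndiff] pairs of columns; the factor [2] of the identity gives [4 * th * n%:R]. *)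
Lemma mean_overlap_gap_exp :
  mean Om (fun M => overlap_gap M * w M) <= (B + 4 * th * n%:R) * mean Om w.
Proof.
have w0 M : 0 < w M by exact: expR_gt0.
have -> : mean Om (fun M => overlap_gap M * w M) =
   \sum_(k in K) mean Om (fun M => (only M j l k - only M l j k) * (entry M l' k * w M)).
  rewrite -mean_sum; apply: eq_mean => M _; rewrite mulr_suml.
  by apply: eq_bigr => k _; rewrite only_sub; ring.
rewrite (eq_bigr _ (fun k kK => mean_exchange Z s t jl freeK (fun M => entry M l' k * w M) kK)).
rewrite big_split /= mulrDl; apply: lerD.
  rewrite -mean_sum -meanZ; apply: le_mean => M MO.
  have -> : \sum_(k in K) surplus R j l K M / ndiff R j l K M * (only M j l k + only M l j k) *
     (entry M l' k * w M) = surplus R j l K M / ndiff R j l K M *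
      (\sum_(k in K) (only M j l k + only M l j k) * entry M l' k) * w M.
    by rewrite mulr_sumr mulr_suml; apply: eq_bigr => k _; ring.
  rewrite ler_wpM2r ?(ltW (w0 M)) //.
  apply: le_trans (hB MO); apply: le_trans (ler_norm _) _.
  set X := \sum_(k in K) _.
  have X0 : 0 <= X.
    by apply: sumr_ge0 => k _; rewrite mulr_ge0 ?entry_ge0 // addr_ge0 ?only_ge0.
  have XN : X <= ndiff R j l K M.
    apply: ler_sum => k _; rewrite ler_piMr ?entry_le1 // addr_ge0 ?only_ge0 //.
  rewrite !normrM normfV -mulrA ler_piMr // (ger0_norm X0) (ger0_norm (ndiff_ge0 _ _ _ _ _)).
  have [N0|N0] := eqVneq (ndiff R j l K M) 0; first by rewrite N0 invr0 mul0r.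
  by rewrite mulrC ler_pdivrMr ?mul1r // lt_def N0 ndiff_ge0.
rewrite -mulr_sumr.
have -> : 4 * th * n%:R * mean Om w = 2 * (mean Om (fun M => 2 * th * n%:R * w M)).
  by rewrite meanZ; ring.
rewrite ler_wpM2l //.
under eq_bigr do rewrite -mean_sum.
rewrite -mean_sum; apply: le_mean => M MO.
have step k k' : only M j l k * only M l j k' *
   ((entry M l' k * w M - entry (switch j l k k' M) l' k * w (switch j l k k' M)) / ndiff R j l K M)
   <= only M j l k * only M l j k' * (2 * th * w M / ndiff R j l K M).
  rewrite only_switchable; case: (boolP (switchable _ _ _ _ _)) => sM; last by rewrite !mul0r.
  rewrite !mul1r ler_wpM2r ?invr_ge0 ?ndiff_ge0 //.
  have kk' : k != k'.
    by apply/negP => /eqP kk'; move: sM; rewrite kk' /switchable => /and4P[-> ].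
  have -> : entry (switch j l k k' M) l' k = entry M l' k.
    by rewrite /entry in_switch_out // in_corners (negbTE l'j) (negbTE l'l).
  have h1 : w M * (1 - 2 * th) <= w (switch j l k k' M).
    have : expR (th * overlap_gap M + th * (-2)) <= w (switch j l k k' M).
      rewrite ler_expR -mulrDr ler_wpM2l //; exact: overlap_gap_switch.
    rewrite expRD; apply: le_trans; rewrite ler_wpM2l ?(ltW (w0 M)) //.
    apply: le_trans (expR_ge1Dx _); lra.
  have := w0 M; have := entry_ge0 R M l' k; have := entry_le1 R M l' k.
  move: (entry M l' k) (w (switch j l k k' M)) (w M) h1 => a c b h1 h2 h3 h4.
  have : a * (b - c) <= 1 * (2 * th * b).
    apply: (@le_trans _ _ (a * (2 * th * b))).
      by rewrite ler_wpM2l //; lra.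
    by rewrite ler_wpM2r // mulr_ge0 ?mulr_ge0 // ltW.
  by lra.
apply: (@le_trans _ _ (\sum_(k in K) \sum_(k' in K) only M j l k * only M l j k' * (2 * th * w M / ndiff R j l K M))).
  by apply: ler_sum => k _; apply: ler_sum => k' _; exact: step.
under eq_bigr => k _ do rewrite -mulr_suml -mulr_sumr.
rewrite -mulr_suml -mulr_suml.
set a := \sum_(k in K) only M j l k; set b := \sum_(k in K) only M l j k.
have Nab : ndiff R j l K M = a + b by exact: ndiffE.
have a0 : 0 <= a by apply: sumr_ge0 => k _; exact: only_ge0.
have b0 : 0 <= b by apply: sumr_ge0 => k _; exact: only_ge0.
have an : a <= n%:R.
  rewrite /a -[leRHS]mulr1n -[n in leRHS]card_ord -sumr_const big_mkcond /=.
  apply: ler_sum => k _; case: ifP => _ //.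
  by have := only_le1 R M j l k; have := only_ge0 R M l j k; lra.
have -> : a * b * (2 * th * w M / ndiff R j l K M) = 2 * th * w M * (a * (b / (a + b))).
  by rewrite Nab; ring.
have -> : 2 * th * n%:R * w M = 2 * th * w M * n%:R by ring.
rewrite ler_wpM2l ?mulr_ge0 ?(ltW (w0 M)) //.
apply: le_trans an; rewrite ler_piMr //.
have [ab0|ab0] := eqVneq (a + b) 0; first by rewrite ab0 invr0 mulr0.
by rewrite ler_pdivrMr ?mul1r ?lerDr // lt_def ab0 addr_ge0.
Qed.

(* [E w <= 1 + th * E (gap * w)] and the previous bound, fed back into each other. *)
Lemma mean_exp_overlap_gap : mean Om w <= 2.
Proof.
have w0 M : 0 < w M by exact: expR_gt0.
have h : mean Om w <= 1 + th * mean Om (fun M => overlap_gap M * w M).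
  rewrite -[X in X + _](mean_cst 1 Om0) -meanZ -meanD; apply: le_mean => M _.
  have : 1 - th * overlap_gap M <= (w M)^-1.
    by rewrite -expRN; apply: le_trans (expR_ge1Dx _).
  rewrite -(ler_pM2r (w0 M)) mulVf ?gt_eqF //; lra.
have h2 := mean_overlap_gap_exp.
have m0 : 0 <= mean Om w by apply: mean_ge0 => M _; exact: ltW.
have h3 := ler_wpM2l th0 h2.
have h4 := ler_wpM2r m0 small.
lra.
Qed.

Lemma mean_overlap_gap_tail T : mean Om (fun M => (T <= overlap_gap M)%R%:R) <= 2 * expR (- (th * T)).
Proof.
rewrite -ler_pdivrMr ?expR_gt0 // expRN invrK mulrC -meanZ.
apply: le_trans mean_exp_overlap_gap; apply: le_mean => M _.
case: (boolP (T <= overlap_gap M)) => h; last by rewrite mulr0 ltW ?expR_gt0.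
by rewrite mulr1 ler_expR ler_wpM2l.
Qed.

End ExpMoment.

Section Sums.
Variables (R : realType) (I : finType).

Lemma norm_sum_card (A : {set I}) (f : I -> R) c :
  (forall k, k \in A -> `|f k| <= c) -> `|\sum_(k in A) f k| <= c * #|A|%:R.
Proof.
move=> h; apply: le_trans (ler_norm_sum _ _ _) _.
by rewrite mulr_natr -sumr_const; apply: ler_sum.
Qed.

Lemma sum_setC (A : {set I}) (f : I -> R) :
  \sum_(k in A) f k = \sum_k f k - \sum_(k in ~: A) f k.
Proof.
have -> : \sum_k f k = \sum_(k in A) f k + \sum_(k in ~: A) f k.
  rewrite (bigID (mem A)) /=; congr (_ + _).
  by apply: eq_bigl => k; rewrite inE.
by rewrite addrK.
Qed.

Lemma sum_bool_card (A : {set I}) : \sum_i (i \in A)%:R = #|A|%:R :> R.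
Proof. by rewrite -sum1_card natr_sum [RHS]big_mkcond; apply: eq_bigr => i _; case: ifP. Qed.

End Sums.

Lemma sum_ord_cst (R : realType) n (c : R) : \sum_(i < n) c = n%:R * c.
Proof. by rewrite sumr_const card_ord mulr_natl. Qed.

Lemma norm_sum_ord (R : realType) n (f : 'I_n -> R) c :
  (forall k, `|f k| <= c) -> `|\sum_k f k| <= c * n%:R.
Proof.
move=> h; apply: le_trans (ler_norm_sum _ _ _) _.
by rewrite mulrC -sum_ord_cst; apply: ler_sum.
Qed.

(* [e] is [n^(-1/2)] and [q] is a power of [n] with a small exponent, which absorbs
   constants, logarithms and degree deviations. The exponent 40 only has to exceed
   those met in the error terms. *)
Record regime (R : realType) (n : nat) (F Z : digraph n) (s t : 'I_n -> nat)
    (L e q : R) : Prop := Regime {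
  reg_e : 0 < e;
  reg_n : n%:R * e ^+ 2 = 1;
  reg_q : 10 <= q;
  reg_small : q ^+ 40 * e <= 1;
  reg_tail : 4 * n%:R * expR (- q) <= e ^+ 12;
  reg_L : 1 <= q * L;
  reg_1L : 1 <= q * (1 - L);
  reg_out : forall j, (outdeg F j)%:R <= q;
  reg_in : forall j, (indeg F j)%:R <= q;
  reg_s : forall j, `|(s j)%:R - L * n%:R| * e <= q;
  reg_t : forall j, `|(t j)%:R - L * n%:R| * e <= q;
  reg_sum_s : \sum_j (s j)%:R = L * n%:R ^+ 2;
  reg_sum_t : \sum_j (t j)%:R = L * n%:R ^+ 2;
  reg_ex : frozen_class F Z s t != set0 }.

Lemma regime_transpose (R : realType) n (F Z : digraph n) s t (L e q : R) :
  regime F Z s t L e q -> regime (transpose F) (transpose Z) t s L e q.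
Proof.
case=> *; split => //.
- by move=> j; rewrite outdeg_transpose.
- by move=> j; rewrite indeg_transpose.
have /set0Pn[M MO] : frozen_class F Z s t != set0 by [].
by apply/set0Pn; exists (transpose M); rewrite transpose_class.
Qed.

Lemma mean_transpose (R : realType) n (F Z : digraph n) s t (f : digraph n -> R) :
  mean (frozen_class F Z s t) f =
  mean (frozen_class (transpose F) (transpose Z) t s) (f \o @transpose n).
Proof.
rewrite /mean; congr (_ / _).
  rewrite (reindex_inj (can_inj (@transposeK n))) /=; apply: eq_bigl => M.
  by rewrite -{1}(transposeK F) -{1}(transposeK Z) transpose_class.
congr (_%:R); rewrite -(card_imset _ (can_inj (@transposeK n))); apply: eq_card => M.
by rewrite -{1}[M]transposeK (mem_imset _ _ (can_inj (@transposeK n))) -transpose_class transposeK.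
Qed.

Section Concentration.
Variables (R : realType) (n : nat) (F Z : digraph n) (s t : 'I_n -> nat) (L e q : R).
Hypothesis rg : regime F Z s t L e q.
Local Notation Om := (frozen_class F Z s t).
Local Notation entry := (@entry R n).
Local Notation only := (@only R n).

Lemma reg_r0 : 0 < e^-1. Proof. by rewrite invr_gt0 (reg_e rg). Qed.
Lemma reg_nr : n%:R = e^-1 ^+ 2.
Proof. by rewrite -[LHS](mulfK (expf_neq0 2 (lt0r_neq0 (reg_e rg)))) (reg_n rg) div1r exprVn. Qed.
Lemma reg_qr : q ^+ 40 <= e^-1.
Proof. by rewrite -[leRHS]mul1r ler_pdivlMr ?(reg_e rg) // (reg_small rg). Qed.
Lemma reg_qXr m : (m <= 40)%N -> q ^+ m <= e^-1.
Proof.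
move=> m40; apply: le_trans reg_qr; rewrite ler_eXn2l //.
by have := reg_q rg; lra.
Qed.
Lemma reg_sr j : `|(s j)%:R - L * n%:R| <= q * e^-1.
Proof. by rewrite ler_pdivlMr ?(reg_e rg) // (reg_s rg). Qed.
Lemma reg_tr j : `|(t j)%:R - L * n%:R| <= q * e^-1.
Proof. by rewrite ler_pdivlMr ?(reg_e rg) // (reg_t rg). Qed.

Lemma reg_L01 : 0 < L < 1.
Proof.
have := reg_L rg; have := reg_1L rg; have := reg_q rg => q10 h1 h2.
have q0 : 0 < q by lra.
apply/andP; split; first by rewrite -(pmulr_rgt0 _ q0); lra.
by rewrite -subr_gt0 -(pmulr_rgt0 _ q0); lra.
Qed.

Definition free_cols j l := [set k | ((j, k) \notin F) && ((l, k) \notin F)].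

Lemma card_out_frozen j : (#|[set k | (j, k) \in F]|)%:R <= q.
Proof. exact: reg_out rg j. Qed.

Lemma free_cols_compl j l : #|~: free_cols j l|%:R <= 2 * q.
Proof.
apply: (@le_trans _ _ ((outdeg F j)%:R + (outdeg F l)%:R)); last first.
  by have := reg_out rg j; have := reg_out rg l; lra.
rewrite -natrD ler_nat /outdeg -cardsUI; apply: leq_trans (leq_addr _ _).
by apply: subset_leq_card; apply/subsetP => k; rewrite !inE negb_and !negbK.
Qed.

Lemma free_colsP j l k : k \in free_cols j l -> ((j, k) \notin F) && ((l, k) \notin F).
Proof. by rewrite inE. Qed.

Lemma entry_sub_norm M j l k : `|entry M j k - entry M l k| <= 1.
Proof. by rewrite /entry; do 2 case: (_ \in M) => /=; rewrite ler_norml; lra. Qed.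

(** Over all columns the surplus is [s j - s l], and the columns outside [K] change it little. Their
    number allows [2 * q] for positions frozen in the two rows and [3] for columns discarded because
    a monomial uses them. *)
Lemma surplus_bound (K : {set 'I_n}) j l M : #|~: K|%:R <= 2 * q + 3 -> M \in Om ->
  `|surplus R j l K M| <= 3 * q * e^-1.
Proof.
move=> cK MO; rewrite /surplus sum_setC sumrB !(row_sum _ _ MO).
have h1 := norm_sum_card (fun k (_ : k \in ~: K) => entry_sub_norm M j l k).
have h2 := reg_sr j; have h3 := reg_sr l; have h4 := reg_qXr (isT : (1 <= 40)%N).
have h5 := reg_q rg.
have : 10 * q <= q * e^-1 by rewrite mulrC ler_wpM2l //; lra.
move: h1 h2 h3; rewrite !ler_norml; lra.
Qed.

Lemma free_surplus_bound j l M : M \in Om -> `|surplus R j l (free_cols j l) M| <= 3 * q * e^-1.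
Proof. by apply: surplus_bound; have := free_cols_compl j l; lra. Qed.

Definition codegree M j l : R := \sum_k entry M j k * entry M l k.

Lemma codegree_gap M j l l' :
  `|codegree M j l' - codegree M l l' - overlap_gap R j l l' (free_cols j l) M| <= 2 * q.
Proof.
rewrite /codegree /overlap_gap sum_setC -sumrB.
have -> : \sum_i (entry M j i * entry M l' i - entry M l i * entry M l' i) =
  \sum_i entry M l' i * (entry M j i - entry M l i) by apply: eq_bigr => k _; ring.
rewrite opprB addrC subrK.
apply: (@le_trans _ _ (1 * #|~: free_cols j l|%:R)); first apply: norm_sum_card => k _.
  by rewrite /entry; do 3 case: (_ \in M) => /=; rewrite ler_norml; lra.
by rewrite mul1r free_cols_compl.
Qed.

(** With [th = e / (8 * q)] the exponent [th * T] in the tail bound is exactly [q]. *)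
Let T := 8 * q ^+ 2 * e^-1.

Lemma gap_tail j l l' : j != l -> l' != j -> l' != l ->
  mean Om (fun M => (T <= overlap_gap R j l l' (free_cols j l) M)%R%:R) <= 2 * expR (- q).
Proof.
move=> jl l'j l'l.
have q10 := reg_q rg; have r0 := reg_r0.
have rr : e * e^-1 = 1 by rewrite divff // gt_eqF ?(reg_e rg).
have th0 : 0 <= e / (8 * q) by rewrite divr_ge0 ?(ltW (reg_e rg)) //; lra.
have q0 : q != 0 by rewrite gt_eqF //; lra.
have e0 : e != 0 by rewrite gt_eqF // (reg_e rg).
(* For this [th] the two terms are [3 / 8], from the surplus bound, and [1 / (16 * q ^+ 2)]. *)
have sm : e / (8 * q) * (3 * q * e^-1 + 4 * (e / (8 * q)) * n%:R) <= 1 / 2.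
  rewrite reg_nr.
  have -> : e / (8 * q) * (3 * q * e^-1 + 4 * (e / (8 * q)) * e^-1 ^+ 2) = 3 / 8 + (1 / 16) * (q^-1) ^+ 2.
    by field; rewrite q0 e0.
  have : (q^-1) ^+ 2 <= 1.
    by rewrite expr_le1 ?invr_ge0 ?invf_le1 //; lra.
  by lra.
have := mean_overlap_gap_tail jl l'j l'l (@free_colsP j l) th0
   (fun M => @free_surplus_bound j l M) sm (reg_ex rg) T.
suff -> : e / (8 * q) * T = q by [].
by rewrite /T; field; rewrite q0 e0.
Qed.

(** The two orders of [j] and [l] give both signs of the deviation. The event does not mention the
    column set of a later exchange, so one bound on its probability serves them all. *)
Definition far_codegree j l' M : bool :=
  [exists l, [&& l != j, l != l' & (T <= overlap_gap R j l l' (free_cols j l) M) ||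
                                    (T <= overlap_gap R l j l' (free_cols l j) M)]].

(** A union bound over [l] and the two signs, each tail costing [2 * expR (- q)]. The power
    [e ^+ 12] survives the later trivial bounds on inverse counts, which lose up to [e ^- 4]. *)
Lemma mean_far j l' : j != l' -> mean Om (fun M => (far_codegree j l' M)%:R) <= e ^+ 12.
Proof.
move=> jl'; apply: le_trans (reg_tail rg).
pose g l M : R := (T <= overlap_gap R j l l' (free_cols j l) M)%R%:R +
  (T <= overlap_gap R l j l' (free_cols l j) M)%R%:R.
apply: (@le_trans _ _ (mean Om (fun M => \sum_(l in [set l | (l != j) && (l != l')]) g l M))).
  apply: le_mean => M _; case: (boolP (far_codegree _ _ _)) => [|_]; last first.
    by apply: sumr_ge0 => l _; rewrite addr_ge0 ?ler0n.
  case/existsP => l /and3P[lj ll' h]; rewrite (bigD1 l) ?inE ?lj //=.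
  have h2 : 1 <= g l M.
    rewrite /g; case: (T <= _) h => //= h; first by rewrite lerDl ler0n.
    by rewrite h add0r.
  apply: le_trans h2 _; rewrite lerDl; apply: sumr_ge0 => i _.
  by rewrite addr_ge0 ?ler0n.
rewrite mean_sum.
apply: (@le_trans _ _ (\sum_(l in [set l | (l != j) && (l != l')]) (4 * expR (- q)))).
  apply: ler_sum => l; rewrite inE => /andP[lj ll']; rewrite meanD.
  have h1 : mean Om (fun M => (T <= overlap_gap R j l l' (free_cols j l) M)%R%:R) <= 2 * expR (- q).
    by apply: gap_tail; rewrite // eq_sym.
  have h2 : mean Om (fun M => (T <= overlap_gap R l j l' (free_cols l j) M)%R%:R) <= 2 * expR (- q).
    by apply: gap_tail; rewrite // eq_sym.
  by lra.
rewrite sumr_const -[_ *+ _]mulr_natl -mulrA [leRHS]mulrCA ler_wpM2r ?mulr_ge0 ?expR_ge0 //.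
by rewrite ler_nat -[X in (_ <= X)%N]card_ord max_card.
Qed.

(* All codegrees of row [l'] are close to each other, and their sum is determined
   by the degrees. *)
Lemma codegree_near M j l' : M \in Om -> j != l' -> ~~ far_codegree j l' M ->
  `|codegree M j l' - L ^+ 2 * n%:R| <= 11 * q ^+ 2 * e^-1.
Proof.
move=> MO jl' /existsPn far.
have q10 := reg_q rg; have r0 := reg_r0.
have qr : q <= e^-1 := reg_qXr (isT : (1 <= 40)%N).
have hl l : l != l' -> `|codegree M j l' - codegree M l l'| <= T + 2 * q.
  move=> ll'; have [->|lj] := eqVneq l j.
    rewrite subrr normr0 /T; have : 0 <= q ^+ 2 * e^-1 by rewrite mulr_ge0 ?exprn_ge0 ?ltW //; lra.
    by lra.
  have := far l; rewrite lj ll' /= negb_or -!ltNge => /andP[h1 h2].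
  have := codegree_gap M j l l'; have := codegree_gap M l j l'.
  move: h1 h2; rewrite !ler_norml; lra.
(* Counting by columns: the sum over all [l] is determined by the in-degrees of the columns that row
   [l'] occupies, and the term [l = l'] is the out-degree of [l']. *)
have sumE : \sum_(l | l != l') codegree M l l' =
   \sum_k entry M l' k * ((t k)%:R - L * n%:R) + L * n%:R * (s l')%:R - (s l')%:R.
  have -> : \sum_(l | l != l') codegree M l l' = \sum_l codegree M l l' - codegree M l' l'.
    by rewrite [in RHS](bigD1 l') //= addrC addrK.
  have -> : codegree M l' l' = (s l')%:R.
    rewrite -(row_sum _ _ MO); apply: eq_bigr => k _.
    by rewrite /entry; case: (_ \in _); rewrite /= ?mulr1 ?mulr0.
  congr (_ - _); rewrite -[in RHS](row_sum _ _ MO) mulr_sumr -big_split exchange_big /=.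
  apply: eq_bigr => k _; rewrite -mulr_suml (col_sum _ _ MO).
  ring.
have sumh : `|\sum_(l | l != l') (codegree M j l' - codegree M l l')| <= (T + 2 * q) * n%:R.
  apply: le_trans (ler_norm_sum _ _ _) _.
  apply: (@le_trans _ _ (\sum_(l < n | l != l') (T + 2 * q))).
    by apply: ler_sum => l ll'; exact: hl.
  rewrite sumr_const -[_ *+ _]mulr_natr ler_wpM2l //.
    rewrite /T; have : 0 <= q ^+ 2 * e^-1 by rewrite mulr_ge0 ?exprn_ge0 ?ltW //; lra.
    by lra.
  by rewrite ler_nat -[X in (_ <= X)%N]card_ord max_card.
have sumc : \sum_(l | l != l') (codegree M j l') = n%:R * codegree M j l' - codegree M j l'.
  rewrite -sum_ord_cst.
  by rewrite [in RHS](bigD1 l') //= addrC addrK.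
have e1 : `|\sum_k entry M l' k * ((t k)%:R - L * n%:R)| <= q * e^-1 * n%:R.
  apply: norm_sum_ord => k; rewrite normrM ger0_norm ?entry_ge0 //.
  by apply: le_trans (reg_tr k); rewrite ler_piMl ?entry_le1.
have sumle (f : 'I_n -> R) : (forall k, 0 <= f k <= 1) -> 0 <= \sum_k f k <= n%:R.
  move=> hf; apply/andP; split; first by apply: sumr_ge0 => k _; case/andP: (hf k).
  rewrite -[leRHS]mulr1 -sum_ord_cst.
  by apply: ler_sum => k _; case/andP: (hf k).
have sn : 0 <= ((s l')%:R : R) <= n%:R.
  by rewrite -(row_sum _ _ MO) sumle // => k; rewrite entry_ge0 entry_le1.
have cn : 0 <= codegree M j l' <= n%:R.
  apply: sumle => k; rewrite /entry; do 2 case: (_ \in _) => /=; lra.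
have := reg_sr l'; have /andP[L0 L1] := reg_L01.
move: sumh; rewrite sumrB sumc sumE => sumh sl.
have n0 : 0 < n%:R :> R by rewrite reg_nr exprn_gt0.
have sl2 : `|L * n%:R * ((s l')%:R - L * n%:R)| <= q * e^-1 * n%:R.
  rewrite normrM (gtr0_norm (mulr_gt0 L0 n0)) [leRHS]mulrC.
  by rewrite ler_pM ?mulr_ge0 ?(ltW L0) ?(ltW n0) // ler_piMl ?(ltW n0) ?(ltW L1).
have fin : `|n%:R * (codegree M j l' - L ^+ 2 * n%:R)| <= (T + 2 * q + 2 * q * e^-1 + 2) * n%:R.
  move: sumh e1 sl2 sn cn; rewrite !ler_norml; lra.
have : `|codegree M j l' - L ^+ 2 * n%:R| <= T + 2 * q + 2 * q * e^-1 + 2.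
  by rewrite -(ler_pM2l n0) -{1}(gtr0_norm n0) -normrM [leRHS]mulrC.
move/le_trans; apply; rewrite /T.
have h1 : 10 * (q * e^-1) <= q ^+ 2 * e^-1 by rewrite expr2 mulrA !ler_wpM2r ?(ltW r0) //; lra.
have h2 : 10 * q <= q * e^-1 by rewrite mulrC ler_wpM2l //; lra.
lra.
Qed.

(** Over all columns the number of differences is [s j + s l - 2 * codegree M j l], and off the
    exceptional event the codegree is near [L ^+ 2 * n%:R]. *)
Lemma ndiff_near M j l (K : {set 'I_n}) : M \in Om -> j != l -> ~~ far_codegree j l M ->
  #|~: K|%:R <= 2 * q + 3 ->
  `|ndiff R j l K M - 2 * L * (1 - L) * n%:R| <= q ^+ 4 * e^-1.
Proof.
move=> MO jl far cK; have h1 := codegree_near MO jl far.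
have q10 := reg_q rg; have r0 := reg_r0.
have h2 := reg_sr j; have h3 := reg_sr l.
rewrite /ndiff sum_setC.
have -> : \sum_k (only M j l k + only M l j k) = (s j)%:R + (s l)%:R - 2 * codegree M j l.
  rewrite -!(row_sum _ _ MO) -big_split /= mulr_sumr -sumrB.
  by apply: eq_bigr => k _; rewrite /only; ring.
have h4 : `|\sum_(k in ~: K) (only M j l k + only M l j k)| <= 1 * #|~: K|%:R.
  apply: norm_sum_card => k _; rewrite ger0_norm ?only_le1 //.
  by rewrite addr_ge0 ?only_ge0.
have p1 : 10 * (q * e^-1) <= q ^+ 2 * e^-1 by rewrite expr2 mulrA !ler_wpM2r ?(ltW r0) //; lra.
have p2 : 10 * q <= q * e^-1.
  by rewrite mulrC ler_wpM2l; [lra..|]; have := reg_qXr (isT : (1 <= 40)%N); lra.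
have p3 : 100 * (q ^+ 2 * e^-1) <= q ^+ 4 * e^-1.
  rewrite mulrA ler_wpM2r ?(ltW r0) // (exprD q 2 2) ler_wpM2r ?exprn_ge0 //; first lra.
  have : 10 * 10 <= q * q by rewrite ler_pM //; lra.
  by rewrite expr2; lra.
move: h1 h2 h3 h4; rewrite !ler_norml; lra.
Qed.

End Concentration.

(** * A calculus of error orders *)

Section Bounds.
Variables (R : realType) (q e : R).
Hypotheses (q10 : 10 <= q) (e0 : 0 < e) (small : q ^+ 40 * e <= 1).

(* In terms of [n], [x = O~(n^(-k/2))]. *)
Definition bnd (m k : nat) (x : R) := `|x| <= q ^+ m * e ^+ k.

Let q0 : 0 < q. Proof. by have := q10; lra. Qed.
Let q1 : 1 <= q. Proof. by have := q10; lra. Qed.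

Lemma bnd_e1 : e <= 1.
Proof.
apply: le_trans small; rewrite ler_peMl ?(ltW e0) //.
by rewrite exprn_ege1.
Qed.

Lemma bnd_unit_ge0 m k : 0 <= q ^+ m * e ^+ k.
Proof. by rewrite mulr_ge0 ?exprn_ge0 ?(ltW e0) ?(ltW q0). Qed.

Lemma bnd_weak m' k' m k x : (m <= m')%N -> (k' <= k)%N -> bnd m k x -> bnd m' k' x.
Proof.
move=> mm kk h; apply: le_trans h _.
apply: ler_pM; rewrite ?exprn_ge0 ?(ltW q0) ?(ltW e0) //; first by rewrite ler_weXn2l.
by rewrite ler_wiXn2l ?(ltW e0) // bnd_e1.
Qed.

(** One factor [e] pays for up to forty factors [q], by [small]. *)
Lemma bnd_trade m0 m k x : (m0 <= 40)%N -> bnd (m0 + m) k.+1 x -> bnd m k x.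
Proof.
move=> m40 h; apply: le_trans h _.
have -> : q ^+ (m0 + m) * e ^+ k.+1 = q ^+ m0 * e * (q ^+ m * e ^+ k).
  by rewrite exprD exprS; ring.
rewrite ler_piMl ?bnd_unit_ge0 //; apply: le_trans small.
by rewrite ler_wpM2r ?(ltW e0) // ler_weXn2l.
Qed.

(** Numerical constants up to [10] are absorbed into one more factor [q]. *)
Lemma bnd10 m k x : `|x| <= 10 * (q ^+ m * e ^+ k) -> bnd m.+1 k x.
Proof.
move/le_trans; apply; rewrite exprS -mulrA ler_wpM2r ?bnd_unit_ge0 //.
Qed.

Lemma bndN m k x : bnd m k x -> bnd m k (- x).
Proof. by rewrite /bnd normrN. Qed.

Lemma bndD m k x y : bnd m k x -> bnd m k y -> bnd m.+1 k (x + y).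
Proof.
rewrite /bnd => hx hy; apply: bnd10; apply: le_trans (ler_normD _ _) _.
by have := bnd_unit_ge0 m k; move: hx hy; lra.
Qed.

Lemma bndB m k x y : bnd m k x -> bnd m k y -> bnd m.+1 k (x - y).
Proof. by move=> hx hy; apply: bndD => //; apply: bndN. Qed.

Lemma bndM m k m' k' x y : bnd m k x -> bnd m' k' y -> bnd (m + m') (k + k') (x * y).
Proof.
rewrite /bnd normrM => hx hy.
have -> : q ^+ (m + m') * e ^+ (k + k') = q ^+ m * e ^+ k * (q ^+ m' * e ^+ k').
  by rewrite !exprD; ring.
by rewrite ler_pM.
Qed.

Lemma bnd0 m k : bnd m k 0.
Proof. by rewrite /bnd normr0 bnd_unit_ge0. Qed.

Lemma bnd_e k : bnd 0 k (e ^+ k).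
Proof. by rewrite /bnd expr0 mul1r ger0_norm // exprn_ge0 ?(ltW e0). Qed.

End Bounds.

(** * Correlations of boundedly many entries *)

Section FewPoints.
Variables (R : realType) (n : nat) (F Z : digraph n) (s t : 'I_n -> nat) (L e q : R).
Hypothesis rg : regime F Z s t L e q.
Local Notation Om := (frozen_class F Z s t).
Local Notation entry := (@entry R n).
Local Notation only := (@only R n).
Local Notation ndiff := (@ndiff R n).
Local Notation far := (far_codegree F e q).

Let v := 2 * L * (1 - L).

(** [2 * L * (1 - L)], the limiting proportion of columns in which two rows differ, is at least the
    smaller of [L] and [1 - L], since the larger one is at least [1 / 2]. *)
Lemma reg_v : 1 <= q * v.
Proof.
have := reg_L rg; have := reg_1L rg; have /andP[h1 h2] := reg_L01 rg.
have q0 : 0 < q by have := reg_q rg; lra.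
rewrite /v => h3 h4; case: (leP L (1 / 2)) => hL.
  by have := ler_pM ler01 (_ : 0 <= 1) h4 (_ : 1 <= 2 * (1 - L)); rewrite !mul1r; lra.
by have := ler_pM ler01 (_ : 0 <= 1) h3 (_ : 1 <= 2 * L); rewrite !mul1r; lra.
Qed.

Lemma reg_v0 : 0 < v.
Proof.
have := reg_v; have q0 : 0 < q by have := reg_q rg; lra.
by rewrite -(pmulr_rgt0 _ q0); lra.
Qed.

Lemma reg_vV : v^-1 <= q.
Proof. by rewrite -[v^-1]mul1r ler_pdivrMr ?reg_v0 // reg_v. Qed.

Lemma reg_e2 : e ^+ 2 * e^-1 = e.
Proof. by rewrite expr2 mulfK // gt_eqF // (reg_e rg). Qed.

Lemma inv_ndiff_near M j l (K : {set 'I_n}) : M \in Om -> j != l -> ~~ far j l M ->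
  #|~: K|%:R <= 2 * q + 3 ->
  bnd q e 7 1 ((e ^+ 2 * ndiff j l K M)^-1 - v^-1) /\ 0 <= (e ^+ 2 * ndiff j l K M)^-1 <= 2 * q.
Proof.
move=> MO jl fa cK; have := ndiff_near rg MO jl fa cK.
have q10 := reg_q rg; have e0 := reg_e rg; have v0 := reg_v0; have hv := reg_v; have hvV := reg_vV.
have q0 : 0 < q by lra.
have e20 : 0 < e ^+ 2 by rewrite exprn_gt0.
set N := ndiff _ _ _ _; rewrite -/v => hN.
have h1 : `|e ^+ 2 * N - v| <= q ^+ 4 * e.
  have -> : e ^+ 2 * N - v = e ^+ 2 * (N - v * n%:R).
    by rewrite mulrBr mulrCA [e ^+ 2 * n%:R]mulrC (reg_n rg) mulr1.
  rewrite normrM (gtr0_norm e20) -[leRHS](_ : e ^+ 2 * (q ^+ 4 * e^-1) = _).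
    by rewrite ler_wpM2l // ltW.
  by rewrite mulrCA reg_e2.
have h2 : 2 * q ^+ 5 * e <= 1.
  apply: le_trans (reg_small rg); rewrite ler_wpM2r ?(ltW e0) //.
  apply: (@le_trans _ _ (q * q ^+ 5)); first by rewrite ler_wpM2r ?exprn_ge0 ?(ltW q0) //; lra.
  by rewrite -exprS ler_weXn2l //; lra.
have h3 : 2 * q ^+ 4 * e <= v.
  rewrite -(ler_pM2l q0); apply: le_trans hv.
  have -> : q * (2 * q ^+ 4 * e) = 2 * q ^+ 5 * e by ring.
  by [].
have h4 : v / 2 <= e ^+ 2 * N by move: h1; rewrite ler_norml; lra.
have nu0 : 0 < e ^+ 2 * N by lra.
have h5 : (e ^+ 2 * N)^-1 <= 2 * q.
  apply: (@le_trans _ _ (v / 2)^-1); first by rewrite lef_pV2 ?posrE //; lra.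
  by rewrite invfM invrK; lra.
split; last by rewrite h5 invr_ge0 ltW.
have -> : (e ^+ 2 * N)^-1 - v^-1 = - ((e ^+ 2 * N - v) * (v^-1 * (e ^+ 2 * N)^-1)).
  by field; rewrite !gt_eqF //= -(pmulr_rgt0 _ e20).
apply: bndN.
have := @bndM _ q e 4 1 3 0 (e ^+ 2 * N - v) (v^-1 * (e ^+ 2 * N)^-1); apply; first by rewrite /bnd expr1.
apply: bnd10 => //.
rewrite mulr1 normrM !ger0_norm ?invr_ge0 ?(ltW nu0) ?(ltW v0) //.
have : v^-1 * (e ^+ 2 * N)^-1 <= q * (2 * q).
  by rewrite ler_pM ?invr_ge0 ?(ltW nu0) ?(ltW v0).
have : 0 <= q * q by rewrite mulr_ge0 ?ltW.
by rewrite expr2; lra.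
Qed.

(** The random count is replaced by its typical value. Off the event [far] this is [inv_ndiff_near];
    on it the domination of [f] by the two [only] terms keeps [f] below the count, so the quotient
    is at most [e ^-2], also when the count vanishes. *)
Lemma mean_div_ndiff j l (K : {set 'I_n}) k (f : digraph n -> R) :
  j != l -> k \in K -> #|~: K|%:R <= 2 * q + 3 ->
  (forall M, M \in Om -> `|f M| <= only M j l k + only M l j k) ->
  bnd q e 8 1 (mean Om (fun M => f M / (e ^+ 2 * ndiff j l K M)) - v^-1 * mean Om f).
Proof.
move=> jl kK cK hf; rewrite -meanZ -meanB.
have q10 := reg_q rg; have e0 := reg_e rg; have v0 := reg_v0; have hvV := reg_vV.
apply: bnd10 => //; apply: (@le_trans _ _ (q ^+ 7 * e ^+ 1 + (e ^-2 + q) * e ^+ 12)).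
  apply: (@le_trans _ _ (mean Om (fun M => q ^+ 7 * e ^+ 1 + (e ^-2 + q) * (far j l M)%:R))).
    apply: norm_mean_le => M MO; have := hf M MO.
    have := only_le1 R M j l k; have := ndiff_ge R j l M kK.
    move=> h1 h2 h3; case: (boolP (far j l M)) => fa; last first.
      have [h4 _] := inv_ndiff_near MO jl fa cK.
      rewrite mulr0 addr0 [v^-1 * _]mulrC -mulrBr normrM; apply: le_trans h4.
      by rewrite ler_piMl //; lra.
    rewrite mulr1; apply: (@le_trans _ _ (e ^-2 + q)); last first.
      by rewrite lerDr mulr_ge0 ?exprn_ge0 ?(ltW e0) //; lra.
    apply: le_trans (ler_normB _ _) _; apply: lerD.
      rewrite normrM normfV normrM (gtr0_norm (exprn_gt0 2 e0)) (ger0_norm (ndiff_ge0 _ _ _ _ _)).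
      rewrite invfM mulrCA ler_piMr ?invr_ge0 ?exprn_ge0 ?(ltW e0) //.
      have [N0|N0] := eqVneq (ndiff j l K M) 0; first by rewrite N0 invr0 mulr0 ler01.
      by rewrite ler_pdivrMr ?mul1r ?lt_def ?N0 ?ndiff_ge0 //; lra.
    rewrite normrM ger0_norm ?invr_ge0 ?(ltW v0) //.
    by apply: le_trans hvV; rewrite ler_piMr ?invr_ge0 ?(ltW v0) //; lra.
  rewrite meanD mean_cst ?(reg_ex rg) // meanZ lerD2l ler_wpM2l //.
    by rewrite addr_ge0 ?invr_ge0 ?exprn_ge0 ?(ltW e0) //; lra.
  exact: (mean_far rg).
have -> : (e ^-2 + q) * e ^+ 12 = e ^+ 10 + q * e ^+ 12.
  by field; rewrite gt_eqF.
have h1 : e ^+ 10 <= q ^+ 7 * e ^+ 1.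
  have := @bnd_weak _ q e q10 e0 (reg_small rg) 7 1 0 10 (e ^+ 10) isT isT (bnd_e _ e0 _).
  by rewrite /bnd ger0_norm ?exprn_ge0 ?(ltW e0).
have h2 : q * e ^+ 12 <= q ^+ 7 * e ^+ 1.
  rewrite ler_pM ?exprn_ge0 ?(ltW e0) //; try lra.
    by rewrite -{1}[q]expr1 ler_weXn2l //; lra.
  by rewrite ler_wiXn2l ?(ltW e0) //; apply: bnd_e1 q10 e0 (reg_small rg).
have := bnd_unit_ge0 q10 e0 7 1; lra.
Qed.

Lemma mean_div_ndiff_le j l (K : {set 'I_n}) k :
  j != l -> k \in K -> #|~: K|%:R <= 2 * q + 3 ->
  mean Om (fun M => (only M j l k + only M l j k) / (e ^+ 2 * ndiff j l K M)) <= 2 * q.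
Proof.
move=> jl kK cK.
have hf M : M \in Om -> `|only M j l k + only M l j k| <= only M j l k + only M l j k.
  by move=> _; rewrite ger0_norm // addr_ge0 ?only_ge0.
have := mean_div_ndiff jl kK cK hf.
have q10 := reg_q rg; have e0 := reg_e rg; have v0 := reg_v0; have hvV := reg_vV.
move/(@bnd_trade _ _ _ q10 e0 (reg_small rg) 8 0 0 _ isT).
rewrite /bnd mulr1 ler_norml => /andP[_]; set m := mean Om (fun M => _ + _).
have : v^-1 * m <= q * 1.
  rewrite ler_pM ?invr_ge0 ?(ltW v0) //.
    by apply: mean_ge0 => M _; rewrite addr_ge0 ?only_ge0.
  by rewrite -(mean_cst 1 (reg_ex rg)); apply: le_mean => M _; exact: only_le1.
lra.
Qed.

Definition monomial (ps : seq ('I_n * 'I_n)) (M : digraph n) : R :=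
  \prod_(p <- ps) (p \in M)%:R.

Lemma monomial01 ps M : 0 <= monomial ps M <= 1.
Proof.
rewrite /monomial; elim: ps => [|p ps /andP[h1 h2]]; first by rewrite big_nil ler01 lexx.
rewrite big_cons; case: (_ \in _); rewrite ?mul1r ?mul0r ?h1 //.
by rewrite lexx ler01.
Qed.

(** The entry [(j, k)] is compared with the entries [(l, k)] of its column, whose sum [t k] is
    known. For a row [l] that the monomial does not meet, switches in suitable columns leave the
    monomial unchanged, so the difference is governed by the surplus over the count, of order [e] up
    to powers of [q]. *)
Lemma mean_entry_monomial j k ps : (j, k) \notin F -> (j, k) \notin ps -> (size ps <= 3)%N ->
  bnd q e 3 1 (mean Om (fun M => (entry M j k - L) * monomial ps M)).
Proof.
move=> jkF jkps sps.
have q10 := reg_q rg; have e0 := reg_e rg; have r0 := reg_r0 rg.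
pose A := [set l | [&& l != j, (l, k) \notin F & l \notin map fst ps]].
have cA : #|~: A|%:R <= q + 4.
  apply: (@le_trans _ _ (1 + #|[set l | (l, k) \in F]| + size ps)%N%:R).
    rewrite ler_nat -(cards1 j).
    apply: (@leq_trans #|[set j] :|: [set l | (l, k) \in F] :|: [set l in map fst ps]|).
      apply: subset_leq_card; apply/subsetP => l; rewrite !inE.
      by rewrite !negb_and !negbK orbA.
    apply: leq_trans (leq_card_setU _ _) _; apply: leq_add.
      by apply: leq_trans (leq_card_setU _ _) _.
    by rewrite cardsE; apply: leq_trans (card_size _) _; rewrite size_map.
  rewrite !natrD; have := reg_in rg k; rewrite /indeg.
  have : (size ps)%:R <= (3 : R) by rewrite ler_nat.
  lra.
have key l : l \in A ->
    `|mean Om (fun M => (entry M j k - entry M l k) * monomial ps M)| <= 6 * q ^+ 2 * e.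
  rewrite inE => /and3P[lj lkF lps].
  have jl : j != l by rewrite eq_sym.
  pose K := free_cols F j l :\: [set k' | (j, k') \in ps].
  have kK : k \in K by rewrite !inE jkps jkF lkF.
  have freeK k' : k' \in K -> ((j, k') \notin F) && ((l, k') \notin F).
    by rewrite !inE => /andP[_].
  have cK : #|~: K|%:R <= 2 * q + 3.
    apply: (@le_trans _ _ (#|~: free_cols F j l| + size ps)%N%:R).
      rewrite ler_nat setCD; apply: leq_trans (leq_card_setU _ _) _; rewrite leq_add2l.
      rewrite -(size_map snd); apply: leq_trans (card_size _).
      apply: subset_leq_card; apply/subsetP => k'; rewrite inE => h.
      by apply/mapP; exists (j, k').
    rewrite natrD; have := free_cols_compl rg j l.
    have : (size ps)%:R <= (3 : R) by rewrite ler_nat.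
    lra.
  rewrite (mean_exchange_inv jl freeK kK); last first.
    move=> M k' _; rewrite !inE => /andP[h1 _] _; apply: eq_big_seq => -[a b] abps /=.
    congr (_%:R); congr nat_of_bool; rewrite in_switch_out // in_corners.
    apply/negP => /andP[/orP[]/eqP ea /orP[]/eqP eb]; subst a b.
    - by rewrite abps in jkps.
    - by rewrite abps in h1.
    - by move/negP: lps; apply; apply/mapP; exists (l, k).
    - by move/negP: lps; apply; apply/mapP; exists (l, k').
  apply: (@le_trans _ _ (mean Om (fun M => 3 * q * e *
      ((only M j l k + only M l j k) / (e ^+ 2 * ndiff j l K M))))).
    apply: norm_mean_le => M MO; rewrite !normrM normfV.
    have /andP[m0 m1] := monomial01 ps M.
    have h := surplus_bound rg j l cK MO.
    have N0 := ndiff_ge0 R j l K M.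
    have p0 : 0 <= only M j l k + only M l j k by rewrite addr_ge0 ?only_ge0.
    rewrite (ger0_norm N0) (ger0_norm m0) (ger0_norm p0).
    have -> : 3 * q * e * ((only M j l k + only M l j k) / (e ^+ 2 * ndiff j l K M)) =
      3 * q * e^-1 * ((only M j l k + only M l j k) * (ndiff j l K M)^-1).
      by rewrite [(e ^+ 2 * _)^-1]invfM; move: (ndiff _ _ _ _)^-1 => x; field; rewrite gt_eqF.
    apply: (@le_trans _ _ (`|surplus R j l K M| / ndiff j l K M * (only M j l k + only M l j k))).
      by rewrite ler_piMr // mulr_ge0 // mulr_ge0 ?invr_ge0.
    rewrite -mulrA [(ndiff _ _ _ _)^-1 * _]mulrC.
    by rewrite ler_wpM2r // mulr_ge0 ?invr_ge0.
  rewrite meanZ.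
  apply: (@le_trans _ _ (3 * q * e * (2 * q))).
    by rewrite ler_wpM2l ?mulr_ge0 ?(ltW e0) ?mean_div_ndiff_le //; lra.
  by have -> : 3 * q * e * (2 * q) = 6 * q ^+ 2 * e by ring.
have sumE M : M \in Om -> n%:R * (entry M j k - L) = \sum_(l in A) (entry M j k - entry M l k) +
    \sum_(l in ~: A) (entry M j k - entry M l k) + ((t k)%:R - L * n%:R).
  move=> MO; rewrite sum_setC subrK sumrB sum_ord_cst (col_sum _ k MO); ring.
have n0 : 0 < n%:R :> R by rewrite (reg_nr rg) exprn_gt0.
rewrite /bnd -(ler_pM2l n0) -{1}(gtr0_norm n0) -normrM -meanZ.
have -> : mean Om (fun M => n%:R * ((entry M j k - L) * monomial ps M)) =
   \sum_(l in A) mean Om (fun M => (entry M j k - entry M l k) * monomial ps M) +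
   mean Om (fun M => (\sum_(l in ~: A) (entry M j k - entry M l k) + ((t k)%:R - L * n%:R)) * monomial ps M).
  rewrite -mean_sum -meanD; apply: eq_mean => M MO.
  by rewrite mulrA sumE // -mulr_suml; ring.
apply: le_trans (ler_normD _ _) _.
have h1 : `|\sum_(l in A) mean Om (fun M => (entry M j k - entry M l k) * monomial ps M)| <= 6 * q ^+ 2 * e * n%:R.
  apply: le_trans (norm_sum_card key) _.
  rewrite ler_wpM2l ?ler_nat ?mulr_ge0 ?exprn_ge0 ?(ltW e0) //; try lra.
  by rewrite -[X in (_ <= X)%N]card_ord max_card.
have h2 : `|mean Om (fun M => (\sum_(l in ~: A) (entry M j k - entry M l k) + ((t k)%:R - L * n%:R)) * monomial ps M)|
   <= q + 4 + q * e^-1.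
  apply: norm_mean_cst (reg_ex rg) _ => M MO; have /andP[m0 m1] := monomial01 ps M.
  rewrite normrM (ger0_norm m0); apply: (@le_trans _ _ (1 * (q + 4 + q * e^-1))); last by rewrite mul1r.
  rewrite mulrC; apply: ler_pM => //; apply: le_trans (ler_normD _ _) _; apply: lerD; last exact: (reg_tr rg).
  apply: le_trans cA; rewrite -[leRHS]mul1r.
  by apply: norm_sum_card => l _; exact: entry_sub_norm.
have en : e * n%:R = e^-1 by rewrite (reg_nr rg); field; rewrite gt_eqF.
have h3 : q + 4 + q * e^-1 <= 2 * q * e^-1.
  have : q * 10 <= q * e^-1.
    by rewrite ler_wpM2l; [lra..|]; have := reg_qXr rg (isT : (1 <= 40)%N); lra.
  lra.
have -> : n%:R * (q ^+ 3 * e ^+ 1) = q ^+ 3 * e^-1 by rewrite -en; ring.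
move: h1; have -> : 6 * q ^+ 2 * e * n%:R = 6 * (q ^+ 2 * e^-1) by rewrite -en; ring.
have p1 : 10 * (q * e^-1) <= q ^+ 2 * e^-1 by rewrite expr2 mulrA !ler_wpM2r ?(ltW r0) //; lra.
have p2 : 10 * (q ^+ 2 * e^-1) <= q ^+ 3 * e^-1.
  have -> : q ^+ 3 * e^-1 = q * (q ^+ 2 * e^-1) by ring.
  by rewrite ler_wpM2r ?mulr_ge0 ?exprn_ge0 ?(ltW r0) //; lra.
by move: h2; lra.
Qed.

End FewPoints.

Section Monomials.
Variables (R : realType) (n : nat) (F Z : digraph n) (s t : 'I_n -> nat) (L e q : R).
Hypothesis rg : regime F Z s t L e q.
Local Notation Om := (frozen_class F Z s t).
Local Notation entry := (@entry R n).

(** Entries are peeled off one at a time, each replaced by [L] at the cost of one error from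
    [mean_entry_monomial]. *)
Lemma mean_monomial_le ps : uniq ps -> all (fun p => p \notin F) ps -> (size ps <= 4)%N ->
  `|mean Om (monomial R ps) - L ^+ size ps| <= (size ps)%:R * (q ^+ 3 * e).
Proof.
have /andP[L0 L1] := reg_L01 rg; have q10 := reg_q rg; have e0 := reg_e rg.
elim: ps => [|[j k] ps IH] /=.
  move=> _ _ _; rewrite mul0r expr0.
  have -> : mean Om (monomial R [::]) = mean Om (fun => 1).
    by apply: eq_mean => M _; rewrite /monomial big_nil.
  by rewrite mean_cst ?(reg_ex rg) // subrr normr0.
move=> /andP[jps ups] /andP[jF psF] sps.
have IH' := IH ups psF (ltnW sps).
have h := mean_entry_monomial rg jF jps sps.
have -> : mean Om (monomial R ((j, k) :: ps)) - L ^+ (size ps).+1 =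
  mean Om (fun M => (entry M j k - L) * monomial R ps M) + L * (mean Om (monomial R ps) - L ^+ size ps).
  rewrite mulrBr -exprS addrA -meanZ -meanD; congr (_ - _); apply: eq_mean => M _.
  by rewrite /monomial big_cons -/(monomial R ps M) /entry; ring.
apply: le_trans (ler_normD _ _) _; rewrite -natr1 mulrDl mul1r addrC; apply: lerD; last first.
  by move: h; rewrite /bnd expr1.
rewrite normrM (gtr0_norm L0); apply: le_trans IH'.
by rewrite ler_piMl // ltW.
Qed.

Lemma mean_monomial ps : uniq ps -> all (fun p => p \notin F) ps -> (size ps <= 4)%N ->
  bnd q e 4 1 (mean Om (monomial R ps) - L ^+ size ps).
Proof.
move=> ups psF sps; have q10 := reg_q rg; have e0 := reg_e rg.
apply: bnd10 => //; apply: le_trans (mean_monomial_le ups psF sps) _.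
rewrite expr1 ler_wpM2r ?mulr_ge0 ?exprn_ge0 ?(ltW e0) //; try lra.
by rewrite (ler_nat _ _ 10); apply: leq_trans sps _.
Qed.

Lemma mean_mono1 j k : (j, k) \notin F -> bnd q e 4 1 (mean Om (fun M => entry M j k) - L).
Proof.
move=> h; have := @mean_monomial [:: (j, k)] isT; rewrite /= h expr1 => /(_ isT isT).
by under eq_mean do rewrite /monomial big_cons big_nil mulr1.
Qed.

Lemma mean_mono2 j k j' k' : (j, k) \notin F -> (j', k') \notin F -> (j, k) != (j', k') ->
  bnd q e 4 1 (mean Om (fun M => entry M j k * entry M j' k') - L ^+ 2).
Proof.
move=> h h' ne; have := @mean_monomial [:: (j, k); (j', k')].
rewrite /= inE ne h h' => /(_ isT isT isT).
by under eq_mean do rewrite /monomial !big_cons big_nil mulr1.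
Qed.

Lemma mean_mono3 j k j' k' i l : (j, k) \notin F -> (j', k') \notin F -> (i, l) \notin F ->
  uniq [:: (j, k); (j', k'); (i, l)] ->
  bnd q e 4 1 (mean Om (fun M => entry M j k * entry M j' k' * entry M i l) - L ^+ 3).
Proof.
move=> h h' h2 ne; have := @mean_monomial [:: (j, k); (j', k'); (i, l)] ne.
rewrite /= h h' h2 => /(_ isT isT).
by under eq_mean do rewrite /monomial !big_cons big_nil mulr1 mulrA.
Qed.

Lemma kappa_bnd : bnd q e 2 0 ((1 - 2 * L) / (L * (1 - L))).
Proof.
have /andP[L0 L1] := reg_L01 rg; have q10 := reg_q rg; have e0 := reg_e rg.
apply: bnd10 => //; rewrite mulr1 expr1.
have -> : (1 - 2 * L) / (L * (1 - L)) = (1 - 2 * L) * (2 * (2 * L * (1 - L))^-1).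
  by field; rewrite !gt_eqF //; lra.
have hv := reg_vV rg; have v0 := reg_v0 rg.
rewrite normrM [X in _ * X]ger0_norm ?mulr_ge0 ?invr_ge0 ?(ltW v0) //.
apply: (@le_trans _ _ (1 * (2 * q))); last by lra.
by apply: ler_pM; rewrite ?mulr_ge0 ?invr_ge0 ?(ltW v0) ?ler_wpM2l // ler_norml; lra.
Qed.

Lemma vV_bnd : bnd q e 1 0 (2 * L * (1 - L))^-1.
Proof.
rewrite /bnd expr1 mulr1 ger0_norm ?(reg_vV rg) //.
by rewrite invr_ge0 ltW // (reg_v0 rg).
Qed.

Lemma dev_t_bnd k : bnd q e 1 1 (e ^+ 2 * ((t k)%:R - L * n%:R)).
Proof.
rewrite /bnd !expr1 normrM ger0_norm ?exprn_ge0 ?(ltW (reg_e rg)) //.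
rewrite expr2 -mulrA mulrC ler_wpM2r ?(ltW (reg_e rg)) // mulrC.
exact: (reg_t rg).
Qed.

Lemma dev_s_bnd k : bnd q e 1 1 (e ^+ 2 * ((s k)%:R - L * n%:R)).
Proof.
rewrite /bnd !expr1 normrM ger0_norm ?exprn_ge0 ?(ltW (reg_e rg)) //.
rewrite expr2 -mulrA mulrC ler_wpM2r ?(ltW (reg_e rg)) // mulrC.
exact: (reg_s rg).
Qed.

End Monomials.

Section ColumnExchange.
Variables (R : realType) (n : nat) (F Z : digraph n) (s t : 'I_n -> nat) (L e q : R).
Hypothesis rg : regime F Z s t L e q.
Local Notation Om := (frozen_class F Z s t).
Local Notation entry := (@entry R n).
Local Notation only := (@only R n).
Local Notation ndiff := (@ndiff R n).
Local Notation surplus := (@surplus R n).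
Local Notation far := (far_codegree F e q).
Local Notation rgT := (regime_transpose rg).
Let v := 2 * L * (1 - L).

Lemma entry_transpose M j k : entry (transpose M) j k = entry M k j.
Proof. by rewrite /entry in_transpose. Qed.

(** The analogue of [mean_div_ndiff] with two denominators, one for a pair of rows and one for a
    pair of columns. The last hypothesis keeps both counts at least [1] where [f] does not vanish,
    so on the exceptional events the quotient is at most [e ^- 4]. *)
Lemma mean_div_ndiff2 j l k k' (K J : {set 'I_n}) (f : digraph n -> R) :
  j != l -> k != k' -> #|~: K|%:R <= 2 * q + 3 -> #|~: J|%:R <= 2 * q + 3 ->
  (forall M, M \in Om -> `|f M| <= 1) ->
  (forall M, M \in Om -> f M != 0 -> 1 <= ndiff j l K M /\ 1 <= ndiff k k' J (transpose M)) ->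
  bnd q e 10 1 (mean Om (fun M => f M / ((e ^+ 2 * ndiff j l K M) * (e ^+ 2 * ndiff k k' J (transpose M))))
     - v^-1 ^+ 2 * mean Om f).
Proof.
move=> jl kk' cK cJ f1 fN; rewrite -meanZ -meanB.
have q10 := reg_q rg; have e0 := reg_e rg; have v0 := reg_v0 rg; have hvV := reg_vV rg.
have sm := reg_small rg.
pose bad M : R := (far j l M)%:R + (far_codegree (transpose F) e q k k' (transpose M))%:R.
have bad12 : mean Om bad <= 2 * e ^+ 12.
  rewrite meanD; have h1 := mean_far rg jl.
  have : mean Om (fun M => (far_codegree (transpose F) e q k k' (transpose M))%:R) <= e ^+ 12.
    rewrite mean_transpose /comp; under eq_mean do rewrite transposeK.
    exact: (mean_far rgT kk').
  lra.
apply: bnd10 => //.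
apply: (@le_trans _ _ (3 * (q ^+ 8 * e ^+ 1) + (e ^- 4 + q ^+ 2) * (2 * e ^+ 12))).
  apply: (@le_trans _ _ (mean Om (fun M => 3 * (q ^+ 8 * e ^+ 1) + (e ^- 4 + q ^+ 2) * bad M))).
    apply: norm_mean_le => M MO.
    have hf := f1 M MO; have hN := fN M MO.
    have N0 := ndiff_ge0 R j l K M; have N0' := ndiff_ge0 R k k' J (transpose M).
    have c0 : 0 <= e ^- 4 + q ^+ 2.
      by rewrite addr_ge0 ?invr_ge0 ?exprn_ge0 ?(ltW e0) //; lra.
    case: (boolP (far j l M || far_codegree (transpose F) e q k k' (transpose M))) => fa; last first.
      move: fa; rewrite negb_or => /andP[fa fa'].
      have [h1 /andP[h2 h3]] := inv_ndiff_near rg MO jl fa cK.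
      have MT : transpose M \in frozen_class (transpose F) (transpose Z) t s by rewrite transpose_class.
      have [h1' /andP[h2' h3']] := inv_ndiff_near rgT MT kk' fa' cJ.
      rewrite /bad (negbTE fa) (negbTE fa') addr0 mulr0 addr0.
      rewrite invfM; move: (e ^+ 2 * ndiff j l K M)^-1 (e ^+ 2 * ndiff k k' J (transpose M))^-1 h1 h2 h3 h1' h2' h3'.
      move=> a b; rewrite /bnd => h1 h2 h3 h1' h2' h3'.
      have -> : f M * (a * b) - v^-1 ^+ 2 * f M = f M * ((a - v^-1) * b + (b - v^-1) * v^-1) by ring.
      rewrite normrM; apply: (@le_trans _ _ (1 * `|(a - v^-1) * b + (b - v^-1) * v^-1|)).
        by rewrite ler_wpM2r.
      rewrite mul1r; apply: le_trans (ler_normD _ _) _; rewrite !normrM (ger0_norm h2').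
      rewrite (@ger0_norm _ v^-1) ?invr_ge0 ?(ltW v0) //.
      have -> : 3 * (q ^+ 8 * e ^+ 1) = q ^+ 7 * e ^+ 1 * (2 * q) + q ^+ 7 * e ^+ 1 * q by ring.
      by apply: lerD; apply: ler_pM; rewrite ?invr_ge0 ?(ltW v0).
    have b1 : 1 <= bad M.
      rewrite /bad; case: (far j l M) fa => //= fa; first by rewrite lerDl ler0n.
      by rewrite fa add0r.
    apply: (@le_trans _ _ ((e ^- 4 + q ^+ 2) * 1)); last first.
      apply: (@le_trans _ _ ((e ^- 4 + q ^+ 2) * bad M)); first by rewrite ler_wpM2l.
      by rewrite lerDr mulr_ge0 ?bnd_unit_ge0.
    rewrite mulr1; apply: le_trans (ler_normB _ _) _; apply: lerD; last first.
      rewrite normrM ger0_norm ?exprn_ge0 ?invr_ge0 ?(ltW v0) //.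
      rewrite -[leRHS]mulr1; apply: ler_pM; rewrite ?exprn_ge0 ?invr_ge0 ?(ltW v0) //.
      by rewrite lerXn2r ?nnegrE ?invr_ge0 ?(ltW v0) //; lra.
    have [f0|/hN [n1 n2]] := eqVneq (f M) 0.
      by rewrite f0 mul0r normr0 invr_ge0 exprn_ge0 ?ltW.
    have -> : e ^+ 2 * ndiff j l K M * (e ^+ 2 * ndiff k k' J (transpose M)) =
       e ^+ 4 * (ndiff j l K M * ndiff k k' J (transpose M)) by ring.
    rewrite invfM mulrCA normrM ger0_norm ?invr_ge0 ?exprn_ge0 ?(ltW e0) //.
    rewrite ler_piMr ?invr_ge0 ?exprn_ge0 ?(ltW e0) // normrM.
    rewrite -[leRHS]mulr1; apply: ler_pM => //.
    rewrite ger0_norm ?invr_ge0 ?mulr_ge0 // invf_le1.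
      by rewrite -[leLHS]mulr1; apply: ler_pM.
    by rewrite mulr_gt0; lra.
  rewrite meanD mean_cst ?(reg_ex rg) // meanZ lerD2l ler_wpM2l //.
  by rewrite addr_ge0 ?invr_ge0 ?exprn_ge0 ?(ltW e0) //; lra.
have -> : (e ^- 4 + q ^+ 2) * (2 * e ^+ 12) = 2 * e ^+ 8 + 2 * (q ^+ 2 * e ^+ 12).
  by field; rewrite gt_eqF.
have h0 := bnd_unit_ge0 q10 e0 8 1.
have h1 : e ^+ 8 <= q ^+ 9 * e ^+ 1.
  have := @bnd_weak _ q e q10 e0 sm 9 1 0 8 (e ^+ 8) isT isT (bnd_e _ e0 _).
  by rewrite /bnd ger0_norm ?exprn_ge0 ?(ltW e0).
have h2 : q ^+ 2 * e ^+ 12 <= q ^+ 9 * e ^+ 1.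
  apply: ler_pM; rewrite ?exprn_ge0 ?(ltW e0) //; try lra.
    by rewrite ler_weXn2l //; lra.
  by rewrite ler_wiXn2l ?(ltW e0) //; apply: bnd_e1 q10 e0 sm.
have h3 : 10 * (q ^+ 8 * e ^+ 1) <= q ^+ 9 * e ^+ 1.
  have -> : q ^+ 9 * e ^+ 1 = q * (q ^+ 8 * e ^+ 1) by ring.
  by rewrite ler_wpM2r.
lra.
Qed.

End ColumnExchange.

(** * Arc probabilities *)

Section GapWeight.
Variables (R : realType) (n : nat) (F Z : digraph n) (s t : 'I_n -> nat) (L e q : R).
Hypothesis rg : regime F Z s t L e q.
Local Notation Om := (frozen_class F Z s t).
Local Notation entry := (@entry R n).
Local Notation only := (@only R n).
Local Notation ndiff := (@ndiff R n).
Local Notation surplus := (@surplus R n).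
Local Notation OmT := (frozen_class (transpose F) (transpose Z) t s).
Local Notation rgT := (regime_transpose rg).
Let v := 2 * L * (1 - L).
Let kappa := (1 - 2 * L) / (L * (1 - L)).
Local Notation eta k := (e ^+ 2 * ((t k)%:R - L * n%:R)).

Lemma mean_transpose_back (f : digraph n -> R) : mean OmT f = mean Om (f \o @transpose n).
Proof.
by rewrite mean_transpose !transposeK.
Qed.

Variables (j l : 'I_n).
Hypothesis jl : j != l.
Local Notation K := (free_cols F j l).

Section TwoColumns.
Variables (k k' : 'I_n).
Hypotheses (kk' : k != k') (kK : k \in K) (k'K : k' \in K).

(** Write [a], [b] for the entries of rows [j], [l] in column [k] and [a'], [b'] for those in column
    [k']. The indicators that the rows differ in [k] and in [k'] have the difference [(a - a') * (1
    - b - b') + (b - b') * (1 - a - a')]; [phi] is the factor of [a - a']. *)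
Let phi M : R := 1 - entry M l k - entry M l k'.
(** Row [l] is left out so that switches of the columns [k] and [k'] do not affect [phi]. *)
Let J := free_cols (transpose F) k k' :\ l.

Lemma jJ : j \in J.
Proof. by move: kK k'K; rewrite !inE /= jl => /andP[-> _] /andP[-> _]. Qed.

Lemma cardJ : #|~: J|%:R <= 2 * q + 1.
Proof.
apply: (@le_trans _ _ (#|~: free_cols (transpose F) k k'| + 1)%N%:R).
  rewrite ler_nat setCD; apply: leq_trans (leq_card_setU _ _) _.
  by rewrite cards1.
by rewrite natrD lerD2r; apply: (free_cols_compl rgT).
Qed.

Lemma cardK : #|~: K|%:R <= 2 * q + 3.
Proof. by have := free_cols_compl rg j l; lra. Qed.

Let f' M := phi (transpose M) / (e ^+ 2 * ndiff j l K (transpose M)).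

(* [phi] vanishes unless row [l] agrees in the columns [k] and [k']; if it does, the
   switch only permutes the columns in which rows [j] and [l] differ. *)
Lemma div_ndiff_switch M r : r \in J -> switchable k k' j r M ->
  f' (switch k k' j r M) = f' M.
Proof.
rewrite 2!inE => /andP[rl _] sM.
have lj : l != j by rewrite eq_sym.
have lr : l != r by rewrite eq_sym.
have el i : entry (transpose (switch k k' j r M)) l i = entry (transpose M) l i.
  by rewrite !entry_transpose /entry in_switch_out // in_corners (negbTE lj) (negbTE lr) andbF.
rewrite /f' /phi !el.
have [ab|ab] := eqVneq (entry (transpose M) l k) (entry (transpose M) l k'); last first.
  suff -> : 1 - entry (transpose M) l k - entry (transpose M) l k' = 0 by rewrite !mul0r.
  move: ab; rewrite /entry; do 2 case: (_ \in transpose M) => //=; rewrite ?eqxx // => _; lra.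
congr (_ / (_ * _)); rewrite /ndiff.
rewrite [RHS](reindex_inj (@perm_inj _ (tperm k k'))) /=.
have tK i : (tperm k k' i \in K) = (i \in K).
  by case: tpermP => [->|->|//]; rewrite kK k'K.
rewrite [RHS](eq_bigl (fun i => i \in K)) //; apply: eq_bigr => i _.
rewrite /only !el !entry_transpose /entry; case/and4P: sM => h1 h2 h3 h4.
have el' : ((k, l) \in M) = ((k', l) \in M).
  by move/eqP: ab; rewrite /entry !in_transpose eqr_nat; do 2 case: (_ \in M).
case: tpermP => [->|->|/eqP/negbTE ik /eqP/negbTE ik'].
- by rewrite in_switch_in ?in_corners ?eqxx ?orbT // h1 (negbTE h2) el'.
- by rewrite in_switch_in ?in_corners ?eqxx ?orbT // h1 (negbTE h2) el'.
by rewrite in_switch_out ?in_corners ?ik ?ik'.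
Qed.

Let h M := (only (transpose M) k k' j + only (transpose M) k' k j) * phi M.

Lemma h_le1 M : `|h M| <= 1.
Proof.
rewrite /h /phi /only !entry_transpose /entry.
by do 4 case: (_ \in M) => /=; rewrite ler_norml; lra.
Qed.

(** If row [j] changes from column [k] to column [k'] while row [l] does not, the two rows differ in
    one of these columns. This makes division by both counts harmless. *)
Lemma h_neq0 M : h M != 0 -> 1 <= ndiff j l K M /\ 1 <= ndiff k k' J (transpose M).
Proof.
move=> h0.
have n2 : 1 <= only (transpose M) k k' j + only (transpose M) k' k j.
  move: h0; rewrite /h /only !entry_transpose /entry.
  by do 2 case: (_ \in M) => /=; rewrite ?(subrr, subr0, mulr0, mulr1, addr0, add0r, mul0r, eqxx).
split; last by apply: le_trans n2 _; apply: ndiff_ge jJ.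
have : 1 <= only M j l k + only M l j k \/ 1 <= only M j l k' + only M l j k'.
  move: h0; rewrite /h /phi /only !entry_transpose /entry.
  do 4 case: (_ \in M) => /=; rewrite ?(subrr, subr0, mulr0, mulr1, addr0, add0r, mul0r, eqxx) //; by [left|right].
by case=> hh; apply: le_trans hh _; apply: ndiff_ge.
Qed.

(** The two factors of [h] concern different rows; for independent entries of density [L] their
    means are [v] and [1 - 2 * L]. Expanded, [h] consists of monomials of degree at most three,
    which are close to their independent values. *)
Lemma mean_h : bnd q e 6 1 (mean Om h - v * (1 - 2 * L)).
Proof.
have q10 := reg_q rg; have e0 := reg_e rg.
move: kK k'K; rewrite !inE => /andP[jk lk] /andP[jk' lk'].
have ne1 : (j, k) != (j, k') by rewrite xpair_eqE eqxx.
have ne2 : (j, k) != (l, k) by rewrite xpair_eqE (negbTE jl).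
have ne3 : (j, k) != (l, k') by rewrite xpair_eqE (negbTE jl).
have ne4 : (j, k') != (l, k) by rewrite xpair_eqE (negbTE jl).
have ne5 : (j, k') != (l, k') by rewrite xpair_eqE (negbTE jl).
have u1 : uniq [:: (j, k); (j, k'); (l, k)] by rewrite /= !inE negb_or ne1 ne2 ne4.
have u2 : uniq [:: (j, k); (j, k'); (l, k')] by rewrite /= !inE negb_or ne1 ne3 ne5.
have b1 := mean_mono1 rg jk; have b2 := mean_mono1 rg jk'.
have b3 := mean_mono2 rg jk lk ne2; have b4 := mean_mono2 rg jk lk' ne3.
have b5 := mean_mono2 rg jk' lk ne4; have b6 := mean_mono2 rg jk' lk' ne5.
have b7 := mean_mono2 rg jk jk' ne1.
have b8 := mean_mono3 rg jk jk' lk u1; have b9 := mean_mono3 rg jk jk' lk' u2.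
have -> : mean Om h = mean Om (fun M => entry M j k) + mean Om (fun M => entry M j k')
   - 2 * mean Om (fun M => entry M j k * entry M j k')
   - mean Om (fun M => entry M j k * entry M l k) - mean Om (fun M => entry M j k * entry M l k')
   - mean Om (fun M => entry M j k' * entry M l k) - mean Om (fun M => entry M j k' * entry M l k')
   + 2 * mean Om (fun M => entry M j k * entry M j k' * entry M l k)
   + 2 * mean Om (fun M => entry M j k * entry M j k' * entry M l k').
  rewrite -!meanZ -meanD -!meanB -!meanD; apply: eq_mean => M _.
  by rewrite /h /phi /only !entry_transpose; ring.
move: (mean Om (fun M => entry M j k)) b1 => m1 b1.
move: (mean Om (fun M => entry M j k')) b2 => m2 b2.
move: (mean Om _) b3 (mean Om _) b4 (mean Om _) b5 (mean Om _) b6 (mean Om _) b7 (mean Om _) b8 (mean Om _) b9.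
move=> m3 b3 m4 b4 m5 b5 m6 b6 m7 b7 m8 b8 m9 b9.
apply: bnd10 => //.
have h0 := bnd_unit_ge0 q10 e0 4 1.
have h1 : 10 * (q ^+ 4 * e ^+ 1) <= q ^+ 5 * e ^+ 1.
  have -> : q ^+ 5 * e ^+ 1 = q * (q ^+ 4 * e ^+ 1) by ring.
  by rewrite ler_wpM2r.
have -> : v * (1 - 2 * L) = L + L - 2 * L ^+ 2 - L ^+ 2 - L ^+ 2 - L ^+ 2 - L ^+ 2 + 2 * L ^+ 3 + 2 * L ^+ 3.
  by rewrite /v; ring.
move: b1 b2 b3 b4 b5 b6 b7 b8 b9; rewrite /bnd !ler_norml; lra.
Qed.

Lemma eta_diff_bnd : bnd q e 2 1 (eta k - eta k').
Proof. by apply: bndB; rewrite ?(reg_q rg) ?(reg_e rg) //; apply: (dev_t_bnd rg). Qed.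

(** The columns [k] and [k'] are exchanged in row [j]. Their normalised surplus [eta k - eta k'] is
    already of order [e], so the mean of [h] over both counts is needed only to leading order. That
    is [v * (1 - 2 * L) / v ^+ 2], the origin of [kappa / 2]. *)
Lemma half_exchange :
  bnd q e 14 2 (mean Om (fun M => (entry M j k - entry M j k') * (phi M / (e ^+ 2 * ndiff j l K M)))
    - kappa / 2 * (eta k - eta k')).
Proof.
have q10 := reg_q rg; have e0 := reg_e rg; have sm := reg_small rg; have v0 := reg_v0 rg.
have freeJ i : i \in J -> ((k, i) \notin transpose F) && ((k', i) \notin transpose F).
  by rewrite 2!inE => /andP[_]; apply: free_colsP.
have cJ : #|~: J|%:R <= 2 * q + 3 by have := cardJ; lra.
have -> : mean Om (fun M => (entry M j k - entry M j k') * (phi M / (e ^+ 2 * ndiff j l K M))) =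
   mean OmT (fun M => (entry M k j - entry M k' j) * f' M).
  by rewrite mean_transpose; apply: eq_mean => M _; rewrite /comp /f' !entry_transpose.
rewrite (mean_exchange_inv kk' freeJ jJ); last by move=> M r _ rJ; exact: div_ndiff_switch.
rewrite mean_transpose_back /comp.
pose D M := e ^+ 2 * ndiff j l K M * (e ^+ 2 * ndiff k k' J (transpose M)).
(* The correction due to the rows outside [J]: at most [3 * q], it contributes only at order
   [e ^+ 2]. *)
pose w M := surplus k k' J (transpose M) - ((t k)%:R - (t k')%:R).
have -> : mean Om (fun M => surplus k k' J (transpose M) / ndiff k k' J (transpose M) *
      (only (transpose M) k k' j + only (transpose M) k' k j) * f' (transpose M)) =
   (eta k - eta k') * mean Om (fun M => h M / D M) + e ^+ 2 * mean Om (fun M => w M * (h M / D M)).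
  rewrite -!meanZ -meanD; apply: eq_mean => M _.
  rewrite /w /f' transposeK /h /D !invfM; have : e ^+ 2 != 0 by rewrite expf_neq0 // gt_eqF.
  move: (ndiff k k' J _)^-1 (ndiff j l K _)^-1 (surplus _ _ _ _) => a b c e20.
  by field; rewrite gt_eqF.
have b1 := mean_div_ndiff2 rg jl kk' cardK cJ (fun M _ => h_le1 M) (fun M _ => @h_neq0 M).
have b2 : bnd q e 4 0 (mean Om (fun M => w M * (h M / D M))).
  have habs0 M : M \in Om -> `| `|h M| | <= 1 by rewrite normr_id h_le1.
  have habs1 M : M \in Om -> `|h M| != 0 -> 1 <= ndiff j l K M /\ 1 <= ndiff k k' J (transpose M).
    by rewrite normr_eq0 => _; apply: h_neq0.
  have b3 := mean_div_ndiff2 rg jl kk' cardK cJ habs0 habs1.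
  apply: bnd10 => //; rewrite mulr1.
  apply: (@le_trans _ _ (mean Om (fun M => 3 * q * (`|h M| / D M)))).
    apply: norm_mean_le => M MO; rewrite normrM normf_div.
    have -> : `|D M| = D M.
      by rewrite ger0_norm // /D !mulr_ge0 ?exprn_ge0 ?ndiff_ge0 // ltW.
    rewrite ler_wpM2r ?divr_ge0 ?mulr_ge0 ?exprn_ge0 ?ndiff_ge0 ?(ltW e0) //.
    rewrite /w /surplus sum_setC sumrB.
    have MT : transpose M \in OmT by rewrite transpose_class.
    rewrite !(row_sum _ _ MT) addrAC subrr add0r normrN.
    have := norm_sum_card (fun i (_ : i \in ~: J) => entry_sub_norm R (transpose M) k k' i).
    by have := cardJ; lra.
  rewrite meanZ.
  have : mean Om (fun M => `|h M| / D M) <= 2 * q ^+ 2.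
    have := @bnd_trade _ _ _ q10 e0 sm 10 0 0 _ isT b3.
    rewrite /bnd mulr1 ler_norml => /andP[_]; set m := mean Om (fun M => `|h M|).
    have : v^-1 ^+ 2 * m <= q ^+ 2 * 1.
      apply: ler_pM; rewrite ?exprn_ge0 ?invr_ge0 ?(ltW v0) //.
      - by apply: mean_ge0.
      - by rewrite lerXn2r ?nnegrE ?invr_ge0 ?(ltW v0) ?(reg_vV rg) //; lra.
      by rewrite -[leRHS](mean_cst 1 (reg_ex rg)); apply: le_mean => M _; exact: h_le1.
    have : 1 * 1 <= q * q by apply: ler_pM; lra.
    by rewrite expr2 -/v; lra.
  have q0 : 0 <= 3 * q by lra.
  move/(ler_wpM2l q0)/le_trans; apply.
  have -> : 3 * q * (2 * q ^+ 2) = 6 * q ^+ 3 by ring.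
  by rewrite ler_wpM2r ?exprn_ge0 //; lra.
have b4 : bnd q e 10 1 (v^-1 ^+ 2 * (mean Om h - v * (1 - 2 * L))).
  apply: (@bnd_weak _ _ _ q10 e0 sm 10 1 (2 + 6) (0 + 1)) => //.
  apply: bndM => //; last exact: mean_h.
  by rewrite expr2; apply: (@bndM _ q e 1 0 1 0); exact: (vV_bnd rg).
have b5 : bnd q e 11 1 (mean Om (fun M => h M / D M) - kappa / 2).
  have -> : kappa / 2 = v^-1 ^+ 2 * (v * (1 - 2 * L)).
    have /andP[L0 L1] := reg_L01 rg.
    by rewrite /kappa /v; field; rewrite !gt_eqF //; lra.
  have := bndD q10 e0 b1 b4; rewrite -/v.
  by congr (bnd _ _ _ _ _); rewrite /D; ring.
have b6 := bndM eta_diff_bnd b5.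
have b7 : bnd q e 12 2 (e ^+ 2 * mean Om (fun M => w M * (h M / D M))).
  apply: (@bnd_weak _ _ _ q10 e0 sm 12 2 (0 + 4) (2 + 0)) => //.
  by apply: bndM => //; exact: bnd_e.
have b8 := bndD q10 e0 b6 (bnd_weak q10 e0 sm (isT : (12 <= 13)%N) (leqnn 2) b7).
by move: b8; congr (bnd _ _ _ _ _); ring.
Qed.

End TwoColumns.
End GapWeight.

Section EntryMean.
Variables (R : realType) (n : nat) (F Z : digraph n) (s t : 'I_n -> nat) (L e q : R).
Hypothesis rg : regime F Z s t L e q.
Local Notation Om := (frozen_class F Z s t).
Local Notation entry := (@entry R n).
Local Notation only := (@only R n).
Local Notation ndiff := (@ndiff R n).
Local Notation surplus := (@surplus R n).
Local Notation bW := (bnd_weak (reg_q rg) (reg_e rg) (reg_small rg)).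
Local Notation bD := (bndD (reg_q rg) (reg_e rg)).
Local Notation bB := (bndB (reg_q rg) (reg_e rg)).
Let kappa := (1 - 2 * L) / (L * (1 - L)).
Local Notation eta k := (e ^+ 2 * ((t k)%:R - L * n%:R)).
Local Notation delta j := (e ^+ 2 * ((s j)%:R - L * n%:R)).

(** This is [n] times the mean share of column [k] among the free columns in which rows [j] and [l]
    differ. *)
Definition gap_weight j l k : R :=
  mean Om (fun M => (only M j l k + only M l j k) / (e ^+ 2 * ndiff j l (free_cols F j l) M)).

Lemma free_colsC j l : free_cols F j l = free_cols F l j.
Proof. by apply/setP => k; rewrite !inE andbC. Qed.

Lemma ndiffC j l K M : ndiff j l K M = ndiff l j K M.
Proof. by apply: eq_bigr => k _; rewrite addrC. Qed.

(** [half_exchange] for [(j, l)] and for [(l, j)], each giving half of [kappa]. *)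
Lemma gap_weight_diff j l k k' : j != l -> k \in free_cols F j l -> k' \in free_cols F j l ->
  bnd q e 15 2 (gap_weight j l k - gap_weight j l k' - kappa * (eta k - eta k')).
Proof.
move=> jl kK k'K; have q10 := reg_q rg; have e0 := reg_e rg.
have [<-|kk'] := eqVneq k k'; first by rewrite !subrr mulr0 subr0; exact: bnd0.
have lj : l != j by rewrite eq_sym.
have h1 := half_exchange rg jl kk' kK k'K.
have h2 := half_exchange rg lj kk' (_ : k \in free_cols F l j) (_ : k' \in free_cols F l j).
move: h2; rewrite -(free_colsC j l) => /(_ kK k'K) h2.
have := bD h1 h2; congr (bnd _ _ _ _ _).
rewrite /gap_weight -meanB.
have -> : mean Om (fun M => (only M j l k + only M l j k) / (e ^+ 2 * ndiff j l (free_cols F j l) M) -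
     (only M j l k' + only M l j k') / (e ^+ 2 * ndiff j l (free_cols F j l) M)) =
   mean Om (fun M => (entry M j k - entry M j k') *
     ((1 - entry M l k - entry M l k') / (e ^+ 2 * ndiff j l (free_cols F j l) M))) +
   mean Om (fun M => (entry M l k - entry M l k') *
     ((1 - entry M j k - entry M j k') / (e ^+ 2 * ndiff l j (free_cols F j l) M))).
  rewrite -meanD; apply: eq_mean => M _; rewrite (ndiffC l j) -mulrBl !mulrA -mulrDl; congr (_ / _).
  by rewrite /only; ring.
by rewrite /kappa; field; have /andP[L0 L1] := reg_L01 rg; rewrite !gt_eqF //; lra.
Qed.

(** The shares add up to one unless rows [j] and [l] agree on all free columns, which happens only
    on the event [far_codegree]. *)
Lemma sum_gap_weight j l : j != l ->
  bnd q e 0 12 (e ^+ 2 * (\sum_(k in free_cols F j l) gap_weight j l k) - 1).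
Proof.
move=> jl; have q10 := reg_q rg; have e0 := reg_e rg.
have e20 : e ^+ 2 != 0 by rewrite expf_neq0 // gt_eqF.
set K := free_cols F j l.
have -> : e ^+ 2 * (\sum_(k in K) gap_weight j l k) - 1 =
  mean Om (fun M => ndiff j l K M / ndiff j l K M - 1).
  rewrite meanB mean_cst ?(reg_ex rg) // -mean_sum -meanZ; congr (_ - _).
  apply: eq_mean => M _; rewrite -mulr_suml -/(ndiff j l K M) invfM.
  by rewrite -/K; move: (ndiff j l K M)^-1 => a; field; rewrite gt_eqF.
rewrite /bnd mul1r; apply: le_trans (mean_far rg jl).
apply: norm_mean_le => M MO; have cK : #|~: K|%:R <= 2 * q + 3 by have := free_cols_compl rg j l; lra.
have [N0|N0] := eqVneq (ndiff j l K M) 0; last by rewrite divff // subrr normr0 ler0n.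
case: (boolP (far_codegree F e q j l M)) => fa; first by rewrite N0 invr0 mul0r sub0r normrN1.
have [h _] := inv_ndiff_near rg MO jl fa cK; move: h; rewrite N0 mulr0 invr0 sub0r.
move/bndN; rewrite opprK => h.
have := @bnd_trade _ _ _ q10 e0 (reg_small rg) 7 0 0 _ isT h.
rewrite /bnd mulr1 => h2.
have := reg_v0 rg; have /andP[L0 L1] := reg_L01 rg => v0.
(* Off the exceptional event a vanishing count would put its default inverse [0] within [1] of this
   number. *)
have : 1 < (2 * L * (1 - L))^-1.
  rewrite -[ltLHS]invr1 ltf_pV2 ?posrE //.
  have : 0 <= (2 * L - 1) ^+ 2 by exact: sqr_ge0.
  rewrite expr2; lra.
by move: h2; rewrite ger0_norm ?invr_ge0 ?(ltW v0) // => h2; lra.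
Qed.

Lemma gap_weight_ge0 j l k : 0 <= gap_weight j l k.
Proof.
apply: mean_ge0 => M _; rewrite divr_ge0 ?addr_ge0 ?only_ge0 //.
by rewrite mulr_ge0 ?exprn_ge0 ?ndiff_ge0 // ltW // (reg_e rg).
Qed.

Lemma sum_eta : \sum_k eta k = 0.
Proof. by rewrite -mulr_sumr sumrB (reg_sum_t rg) sum_ord_cst; ring. Qed.

Lemma sum_delta : \sum_k delta k = 0.
Proof. by rewrite -mulr_sumr sumrB (reg_sum_s rg) sum_ord_cst; ring. Qed.

Lemma e2_card_bnd (A : {set 'I_n}) : #|A|%:R <= 2 * q + 3 -> bnd q e 2 2 (e ^+ 2 * #|A|%:R).
Proof.
move=> cA; have q10 := reg_q rg; have e0 := reg_e rg.
rewrite /bnd mulrC ger0_norm ?mulr_ge0 ?exprn_ge0 ?(ltW e0) //.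
rewrite ler_wpM2r ?exprn_ge0 ?(ltW e0) //; apply: le_trans cA _.
by have : 10 * q <= q ^+ 2; [rewrite expr2 ler_wpM2r //; lra|lra].
Qed.

(** [gap_weight_diff] is averaged over [k']: the total weight is known from [sum_gap_weight], and
    the deviations [eta k'] sum to zero, up to the few columns outside [K]. *)
Lemma gap_weightE j l k : j != l -> k \in free_cols F j l ->
  bnd q e 18 2 (gap_weight j l k - 1 - kappa * eta k).
Proof.
move=> jl kK; have q10 := reg_q rg; have e0 := reg_e rg; have sm := reg_small rg.
set K := free_cols F j l.
have cK : #|~: K|%:R <= 2 * q + 3 by have := free_cols_compl rg j l; lra.
have g2q : gap_weight j l k <= 2 * q.
  exact: (mean_div_ndiff_le rg jl kK cK).
have e2n : e ^+ 2 * n%:R = 1 by rewrite mulrC (reg_n rg).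
have b1 := e2_card_bnd cK.
have b2 : bnd q e 2 0 (gap_weight j l k).
  rewrite /bnd mulr1 ger0_norm ?gap_weight_ge0 //; apply: le_trans g2q _.
  by have : 10 * q <= q ^+ 2; [rewrite expr2 ler_wpM2r //; lra|lra].
have b3 := sum_gap_weight jl.
have b4 : bnd q e 15 2 (e ^+ 2 * \sum_(k' in K) (gap_weight j l k - gap_weight j l k' - kappa * (eta k - eta k'))).
  rewrite /bnd normrM ger0_norm ?exprn_ge0 ?(ltW e0) //.
  have := norm_sum_card (fun k' (k'K : k' \in K) => gap_weight_diff jl kK k'K).
  move/(ler_wpM2l (exprn_ge0 2 (ltW e0)))/le_trans; apply.
  rewrite mulrCA ler_piMr ?bnd_unit_ge0 // -[leRHS]e2n ler_wpM2l ?exprn_ge0 ?(ltW e0) //.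
  by rewrite ler_nat -[X in (_ <= X)%N]card_ord max_card.
have b5 : bnd q e 3 3 (e ^+ 2 * \sum_(k' in ~: K) eta k').
  have := norm_sum_card (fun k' (_ : k' \in ~: K) => dev_t_bnd rg k').
  move/(ler_wpM2l (exprn_ge0 2 (ltW e0))).
  rewrite -{1}(ger0_norm (exprn_ge0 2 (ltW e0))) -normrM => h; apply: le_trans h _.
  rewrite mulrCA mulrC.
  have -> : q ^+ 3 * e ^+ 3 = q ^+ 2 * e ^+ 2 * (q ^+ 1 * e ^+ 1) by ring.
  rewrite ler_wpM2r ?bnd_unit_ge0 //; apply: le_trans b1; exact: ler_norm.
have b6 := kappa_bnd rg; have b7 := dev_t_bnd rg k.
have c1 := bndM b1 b2; have c2 := bndM b1 (bndM b6 b7); have c3 := bndM b6 b5.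
have sK : \sum_(k' in K) (gap_weight j l k - gap_weight j l k' - kappa * (eta k - eta k')) =
    (n%:R - #|~: K|%:R) * (gap_weight j l k - kappa * eta k) - \sum_(k' in K) gap_weight j l k'
    - kappa * \sum_(k' in ~: K) eta k'.
  have -> : \sum_(k' in ~: K) eta k' = - \sum_(k' in K) eta k'.
    by rewrite [in RHS]sum_setC sum_eta sub0r opprK.
  have -> : n%:R - #|~: K|%:R = #|K|%:R :> R.
    by rewrite -[n in n%:R]card_ord -(cardsC K) natrD addrK.
  rewrite mulrN opprK mulr_natl -sumr_const -sumrB mulr_sumr -big_split.
  by apply: eq_bigr => k' _ /=; ring.
have -> : gap_weight j l k - 1 - kappa * eta k =
   (e ^+ 2 * \sum_(k' in K) (gap_weight j l k - gap_weight j l k' - kappa * (eta k - eta k'))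
   + (e ^+ 2 * (\sum_(k in K) gap_weight j l k) - 1)) +
   (e ^+ 2 * #|~: K|%:R * gap_weight j l k - e ^+ 2 * #|~: K|%:R * (kappa * eta k))
   + kappa * (e ^+ 2 * \sum_(k' in ~: K) eta k').
  have -> : gap_weight j l k - 1 - kappa * eta k =
      e ^+ 2 * n%:R * (gap_weight j l k - kappa * eta k) - 1 by rewrite e2n; ring.
  rewrite sK; ring.
apply: (bD (m := 17)); last exact: bW c3.
apply: (bD (m := 16)); first by apply: (bD (m := 15)); [exact: b4 | exact: bW b3].
by apply: (bB (m := 15)); [exact: bW c1 | exact: bW c2].
Qed.

End EntryMean.

Section EntryFormula.
Variables (R : realType) (n : nat) (F Z : digraph n) (s t : 'I_n -> nat) (L e q : R).
Hypothesis rg : regime F Z s t L e q.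
Local Notation Om := (frozen_class F Z s t).
Local Notation entry := (@entry R n).
Local Notation only := (@only R n).
Local Notation ndiff := (@ndiff R n).
Local Notation surplus := (@surplus R n).
Local Notation gap_weight := (gap_weight F Z s t e).
Local Notation bW := (bnd_weak (reg_q rg) (reg_e rg) (reg_small rg)).
Local Notation bD := (bndD (reg_q rg) (reg_e rg)).
Local Notation bB := (bndB (reg_q rg) (reg_e rg)).
Let v := 2 * L * (1 - L).
Let kappa := (1 - 2 * L) / (L * (1 - L)).
Local Notation eta k := (e ^+ 2 * ((t k)%:R - L * n%:R)).
Local Notation delta j := (e ^+ 2 * ((s j)%:R - L * n%:R)).

Definition base_entry j k : R := if (j, k) \in F then ((j, k) \in Z)%:R else L.
Definition base_row j : R := \sum_k base_entry j k.
Definition base_col k : R := \sum_j base_entry j k.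

Lemma frozen_entry M j k : M \in Om -> (j, k) \in F -> entry M j k = ((j, k) \in Z)%:R.
Proof.
rewrite inE => /andP[/eqP <- _] jkF.
by rewrite /entry inE jkF andbT.
Qed.

Lemma base_entry01 j k : 0 <= base_entry j k <= 1.
Proof.
have /andP[L0 L1] := reg_L01 rg; rewrite /base_entry; case: ifP => _; last by rewrite !ltW.
by rewrite ler0n; case: (_ \in _); rewrite /= ?ler01.
Qed.

Lemma mean_only j l k : j != l -> k \in free_cols F j l ->
  bnd q e 5 1 (mean Om (fun M => only M j l k + only M l j k) - v).
Proof.
move=> jl; rewrite inE => /andP[jk lk]; have q10 := reg_q rg; have e0 := reg_e rg.
have ne : (j, k) != (l, k) by rewrite xpair_eqE (negbTE jl).
have b1 := mean_mono1 rg jk; have b2 := mean_mono1 rg lk; have b3 := mean_mono2 rg jk lk ne.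
have -> : mean Om (fun M => only M j l k + only M l j k) = mean Om (fun M => entry M j k) +
   mean Om (fun M => entry M l k) - 2 * mean Om (fun M => entry M j k * entry M l k).
  by rewrite -meanZ -meanD -meanB; apply: eq_mean => M _; rewrite /only; ring.
move: (mean Om _) b1 (mean Om _) b2 (mean Om _) b3 => m1 b1 m2 b2 m3 b3.
apply: bnd10 => //; have h0 := bnd_unit_ge0 q10 e0 4 1.
by move: b1 b2 b3; rewrite /bnd /v !ler_norml; lra.
Qed.

(** A column outside [free_cols F j l] is frozen in one of the two rows but may be free in the
    other, where its entry is nearly independent of the entries in column [k]. *)
Lemma mean_entry_only i j l k k' : j != l -> k \in free_cols F j l ->
  (i == j) || (i == l) -> k' \notin free_cols F j l ->
  bnd q e 5 1 (mean Om (fun M => entry M i k' * (only M j l k + only M l j k)) - base_entry i k' * v).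
Proof.
move=> jl kK ijl k'K; have q10 := reg_q rg; have e0 := reg_e rg.
have kk' : k != k' by apply: contraNneq k'K => <-.
rewrite /base_entry; case: ifP => [ikF|/negbT ikF].
  rewrite (eq_mean (g := fun M => ((i, k') \in Z)%:R * (only M j l k + only M l j k))); last first.
    by move=> M MO; rewrite frozen_entry.
  rewrite meanZ -mulrBr; have := bndM (_ : bnd q e 0 0 ((i, k') \in Z)%:R) (mean_only jl kK).
  by apply; rewrite /bnd mulr1 normr_nat; case: (_ \in _); rewrite /= ?ler01.
move: (kK); rewrite inE => /andP[jk lk].
have n1 : (i, k') != (j, k) by rewrite xpair_eqE (eq_sym k') (negbTE kk') andbF.
have n2 : (i, k') != (l, k) by rewrite xpair_eqE (eq_sym k') (negbTE kk') andbF.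
have n3 : (j, k) != (l, k) by rewrite xpair_eqE (negbTE jl).
have u : uniq [:: (i, k'); (j, k); (l, k)] by rewrite /= !inE negb_or n1 n2 n3.
have b1 := mean_mono2 rg ikF jk n1; have b2 := mean_mono2 rg ikF lk n2.
have b3 := mean_mono3 rg ikF jk lk u.
have -> : mean Om (fun M => entry M i k' * (only M j l k + only M l j k)) =
   mean Om (fun M => entry M i k' * entry M j k) + mean Om (fun M => entry M i k' * entry M l k)
   - 2 * mean Om (fun M => entry M i k' * entry M j k * entry M l k).
  by rewrite -meanZ -meanD -meanB; apply: eq_mean => M _; rewrite /only; ring.
move: (mean Om _) b1 (mean Om _) b2 (mean Om _) b3 => m1 b1 m2 b2 m3 b3.
apply: bnd10 => //; have h0 := bnd_unit_ge0 q10 e0 4 1.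
have -> : L * v = L ^+ 2 + L ^+ 2 - 2 * L ^+ 3 by rewrite /v; ring.
by move: b1 b2 b3; rewrite /bnd !ler_norml; lra.
Qed.

(** A sum over [O(q)] indices, divided by [n], gains [e ^+ 2]; over arbitrary index sets, as in the
    next lemma, it keeps the order of its terms. *)
Lemma sum_bnd (A : {set 'I_n}) (f : 'I_n -> R) m k : #|A|%:R <= 2 * q + 3 ->
  (forall i, i \in A -> bnd q e m k (f i)) -> bnd q e m.+2 k.+2 (e ^+ 2 * \sum_(i in A) f i).
Proof.
move=> cA hf; have q10 := reg_q rg; have e0 := reg_e rg.
have h := e2_card_bnd rg cA; rewrite /bnd normrM (ger0_norm (exprn_ge0 2 (ltW e0))).
have := norm_sum_card hf; move/(ler_wpM2l (exprn_ge0 2 (ltW e0)))/le_trans; apply.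
have -> : q ^+ m.+2 * e ^+ k.+2 = q ^+ 2 * e ^+ 2 * (q ^+ m * e ^+ k).
  by rewrite -addn2 -[k.+2]addn2 !exprD; ring.
rewrite mulrCA mulrC ler_wpM2r ?bnd_unit_ge0 //; apply: le_trans h.
exact: ler_norm.
Qed.

Lemma sum_bnd_all (A : {set 'I_n}) (f : 'I_n -> R) m k :
  (forall i, i \in A -> bnd q e m k (f i)) -> bnd q e m k (e ^+ 2 * \sum_(i in A) f i).
Proof.
move=> hf; have q10 := reg_q rg; have e0 := reg_e rg.
rewrite /bnd normrM (ger0_norm (exprn_ge0 2 (ltW e0))).
have := norm_sum_card hf; move/(ler_wpM2l (exprn_ge0 2 (ltW e0)))/le_trans; apply.
rewrite mulrCA ler_piMr ?bnd_unit_ge0 // -[leRHS](reg_n rg) mulrC.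
rewrite ler_wpM2r ?exprn_ge0 ?(ltW e0) //.
by rewrite ler_nat -[X in (_ <= X)%N]card_ord max_card.
Qed.

(** The exchange identity with constant weight. The surplus on the free columns is [s j - s l] minus
    the surplus on the few others. After division by [n] the first part has order [e] and meets
    [gap_weight], known up to [e ^+ 2]; the second has order [e ^+ 2] and is needed only to leading
    order. *)
Lemma entry_row_diff j l k : j != l -> k \in free_cols F j l ->
  bnd q e 21 3 (mean Om (fun M => entry M j k) - mean Om (fun M => entry M l k) -
    ((delta j - delta l) * (1 + kappa * eta k) - e ^+ 2 * (base_row j - base_row l))).
Proof.
move=> jl kK; have q10 := reg_q rg; have e0 := reg_e rg; have sm := reg_small rg.
set K := free_cols F j l in kK *.
have cK : #|~: K|%:R <= 2 * q + 3 by have := free_cols_compl rg j l; lra.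
have := @mean_exchange_inv R n F Z s t j l K jl (@free_colsP _ F j l) k (fun => 1) kK
  (fun M k' _ _ _ => erefl).
rewrite (eq_mean (g := fun M => entry M j k - entry M l k)) => [|M _]; last by rewrite mulr1.
rewrite meanB => ->.
pose p M := only M j l k + only M l j k.
have -> : mean Om (fun M => surplus j l K M / ndiff j l K M * (only M j l k + only M l j k) * 1) =
  (delta j - delta l) * gap_weight j l k -
  e ^+ 2 * \sum_(k' in ~: K) mean Om (fun M => (entry M j k' - entry M l k') * p M / (e ^+ 2 * ndiff j l K M)).
  rewrite -mean_sum -!meanZ -meanB; apply: eq_mean => M MO.
  rewrite -mulr_suml -mulr_suml {1}/surplus sum_setC sumrB !(row_sum _ _ MO) -/(p M) -/K.
  rewrite invfM; move: (ndiff j l K M)^-1 => a.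
  by move: (\sum_(i in _) _) => b; field; rewrite gt_eqF.
have b1 := bndM (bB (dev_s_bnd rg j) (dev_s_bnd rg l)) (gap_weightE rg jl kK).
have hb k' : k' \in ~: K -> bnd q e 9 1 (mean Om (fun M => (entry M j k' - entry M l k') * p M / (e ^+ 2 * ndiff j l K M))
    - (base_entry j k' - base_entry l k')).
  rewrite inE => k'K.
  have hp M : M \in Om -> `|(entry M j k' - entry M l k') * p M| <= only M j l k + only M l j k.
    move=> _; rewrite normrM [`|p M|]ger0_norm ?addr_ge0 ?only_ge0 //.
    by rewrite ler_piMl ?addr_ge0 ?only_ge0 // entry_sub_norm.
  have c1 := mean_div_ndiff rg jl kK cK hp.
  have jjl : (j == j) || (j == l) by rewrite eqxx.
  have ljl : (l == j) || (l == l) by rewrite eqxx orbT.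
  have c2 := mean_entry_only jl kK jjl k'K.
  have c3 := mean_entry_only jl kK ljl k'K.
  have c4 := bndM (vV_bnd rg) (bB c2 c3).
  have v0 := reg_v0 rg.
  have := bD c1 (bW (isT : (1 + 6 <= 8)%N) (isT : (1 <= 0 + 1)%N) c4).
  congr (bnd _ _ _ _ _).
  have -> : mean Om (fun M => (entry M j k' - entry M l k') * p M) =
     mean Om (fun M => entry M j k' * (only M j l k + only M l j k)) -
     mean Om (fun M => entry M l k' * (only M j l k + only M l j k)).
    by rewrite -meanB; apply: eq_mean => M _; rewrite mulrBl.
  move: (mean Om _) (mean Om _) (mean Om _) => x y z.
  by rewrite /v; field; have /andP[L0 L1] := reg_L01 rg; rewrite !gt_eqF //; lra.
have b2 := sum_bnd cK hb.
have rowE : base_row j - base_row l = \sum_(k' in ~: K) (base_entry j k' - base_entry l k').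
  rewrite -sumrB [RHS]sum_setC [X in _ = _ - X]big1 ?subr0 // => k'.
  by rewrite inE in_setC negbK /base_entry inE => /andP[/negbTE -> /negbTE ->]; rewrite subrr.
have := bB b1 (bW (isT : (11 <= 20)%N) (isT : (3 <= 3)%N) b2).
congr (bnd _ _ _ _ _); rewrite rowE sumrB /kappa.
set x := bigop _ _ _; set y := bigop _ _ _; move: (gap_weight _ _ _) => z.
ring.
Qed.

Lemma base_row_sub j : `|base_row j - L * n%:R| <= q.
Proof.
have /andP[L0 L1] := reg_L01 rg.
have -> : base_row j - L * n%:R = \sum_(k in [set k | (j, k) \in F]) (base_entry j k - L).
  rewrite mulrC -sum_ord_cst /base_row -sumrB (bigID (fun k => (j, k) \in F)) /=.
  rewrite [X in _ + X]big1 ?addr0; last by move=> k /negbTE jk; rewrite /base_entry jk subrr.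
  by apply: eq_bigl => k; rewrite inE.
apply: le_trans (card_out_frozen rg j); rewrite -[leRHS]mul1r; apply: norm_sum_card => k _.
by have /andP[h1 h2] := base_entry01 j k; rewrite ler_norml; lra.
Qed.

Definition base_mean : R := e ^+ 2 * \sum_l base_row l.

Lemma entry_mean j k : (j, k) \notin F ->
  bnd q e 24 3 (mean Om (fun M => entry M j k) -
    (L + delta j + eta k + kappa * delta j * eta k
       - e ^+ 2 * (base_row j - base_mean) - e ^+ 2 * (base_col k - L * n%:R))).
Proof.
move=> jkF; have q10 := reg_q rg; have e0 := reg_e rg; have sm := reg_small rg.
pose A := [set l | (l, k) \notin F].
have jA : j \in A by rewrite inE.
have e2n : e ^+ 2 * n%:R = 1 by rewrite mulrC (reg_n rg).
have cA : #|~: A|%:R <= 2 * q + 3.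
  have -> : #|~: A| = indeg F k by apply: eq_card => l; rewrite !inE negbK.
  by have := reg_in rg k; lra.
pose rho l := mean Om (fun M => entry M l k).
pose T l := (delta j - delta l) * (1 + kappa * eta k) - e ^+ 2 * (base_row j - base_row l).
have b1 l : l \in A -> bnd q e 21 3 (rho j - rho l - T l).
  rewrite inE => lk; have [<-|jl] := eqVneq j l.
    by rewrite /T !subrr mul0r mulr0 !subrr; exact: bnd0.
  by apply: entry_row_diff => //; rewrite inE jkF.
have b2 := sum_bnd_all b1.
have b3 : bnd q e 1 0 (1 + kappa * eta k).
  have := bndM (kappa_bnd rg) (dev_t_bnd rg k).
  move/(@bnd_trade _ _ _ q10 e0 sm 3 0 0 _ isT) => h; apply: bD => //.
  by rewrite /bnd mulr1 normr1.
have b4 l : bnd q e 4 1 (T l).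
  have h1 := bndM (bB (dev_s_bnd rg j) (dev_s_bnd rg l)) b3.
  have h2 : bnd q e 3 2 (e ^+ 2 * (base_row j - base_row l)).
    apply: (@bndM _ q e 0 2 3 0); first exact: bnd_e.
    apply: (bW (m := 2) (k := 0)) => //; apply: bnd10 => //.
    by have := base_row_sub j; have := base_row_sub l; rewrite mulr1 expr1 !ler_norml; lra.
  by apply: (bB (m := 3)); [exact: bW h1 | exact: bW h2].
have b5 := sum_bnd cA (fun l _ => b4 l).
have b6 : bnd q e 6 3 (e ^+ 2 * #|~: A|%:R * (rho j - L)).
  exact: (bndM (e2_card_bnd rg cA) (mean_mono1 rg jkF)).
have sumT : e ^+ 2 * \sum_l T l = delta j * (1 + kappa * eta k) - e ^+ 2 * (base_row j - base_mean).
  have gen d c y (dl yl : 'I_n -> R) : \sum_l dl l = 0 ->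
      e ^+ 2 * \sum_l ((d - dl l) * c - e ^+ 2 * (y - yl l)) = d * c - e ^+ 2 * (y - e ^+ 2 * \sum_l yl l).
    move=> dl0; have -> : \sum_l ((d - dl l) * c - e ^+ 2 * (y - yl l)) =
        n%:R * (d * c - e ^+ 2 * y) - c * \sum_l dl l + e ^+ 2 * \sum_l yl l.
      rewrite -sum_ord_cst !mulr_sumr -sumrB -big_split; apply: eq_bigr => l _ /=; ring.
    rewrite dl0 mulr0 subr0 mulrDr [e ^+ 2 * (n%:R * _)]mulrA e2n; set x := bigop _ _ _; ring.
  exact: gen (sum_delta rg).
have colE : \sum_(l in ~: A) rho l = base_col k - L * (n%:R - #|~: A|%:R).
  have -> : \sum_(l in ~: A) rho l = \sum_(l in ~: A) base_entry l k.
    apply: eq_bigr => l; rewrite !inE negbK => lk; rewrite /base_entry lk.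
    rewrite /rho -[RHS](mean_cst _ (reg_ex rg)); apply: eq_mean => M MO.
    exact: frozen_entry.
  have -> : n%:R - #|~: A|%:R = #|A|%:R :> R.
    by rewrite -[n in n%:R]card_ord -(cardsC A) natrD addrK.
  rewrite sum_setC setCK mulr_natr -sumr_const; congr (_ - _).
  by apply: eq_bigr => l; rewrite inE /base_entry => /negbTE ->.
have sumrho : \sum_l rho l = (t k)%:R.
  rewrite /rho -[RHS](mean_cst _ (reg_ex rg)).
  have := mean_sum Om [set: 'I_n] (fun l M => entry M l k).
  rewrite (eq_bigl xpredT) => [<-|l]; last by rewrite inE.
  apply: eq_mean => M MO; rewrite -(col_sum R k MO); apply: eq_bigl => l; by rewrite inE.
have SA : \sum_(l in A) (rho j - rho l) = (n%:R - #|~: A|%:R) * rho j - ((t k)%:R - (base_col k - L * (n%:R - #|~: A|%:R))).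
  rewrite -sumrho -colE sumrB -sum_setC; congr (_ - _).
  have -> : n%:R - #|~: A|%:R = #|A|%:R :> R.
    by rewrite -[n in n%:R]card_ord -(cardsC A) natrD addrK.
  by rewrite sumr_const mulr_natl.
have main : rho j - (L + delta j + eta k + kappa * delta j * eta k
       - e ^+ 2 * (base_row j - base_mean) - e ^+ 2 * (base_col k - L * n%:R)) =
   e ^+ 2 * \sum_(l in A) (rho j - rho l - T l) - e ^+ 2 * \sum_(l in ~: A) T l + e ^+ 2 * #|~: A|%:R * (rho j - L).
  rewrite [\sum_(l in A) _]sumrB SA.
  have -> : \sum_(l in A) T l = \sum_l T l - \sum_(l in ~: A) T l by exact: sum_setC.
  have ex (x y z : R) : e ^+ 2 * (x - (y - z)) = e ^+ 2 * x - e ^+ 2 * y + e ^+ 2 * z.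
    by ring.
  rewrite ex sumT; move: (\sum_(l in ~: A) T l) (base_mean) (base_row j) (base_col k) => x y z u.
  apply/eqP; rewrite -subr_eq0; apply/eqP.
  (* As polynomials the two sides differ by a multiple of [1 - e ^+ 2 * n%:R], which is zero. *)
  transitivity ((1 - e ^+ 2 * n%:R) * (rho j - L)); last by rewrite e2n subrr mul0r.
  by move: (rho j) => w; ring.
rewrite main; apply: (bD (m := 23)); last exact: bW b6.
by apply: (bB (m := 22)); [exact: bW b2 | exact: bW b5].
Qed.

End EntryFormula.

(** * Two elementary expansions of the exponential *)

Module ExpTaylor.
Import classical_sets functions set_interval topology normedtype derive realfun.
Import numFieldNormedType.Exports.
Local Open Scope ring_scope.
Local Open Scope classical_set_scope.

Section ExpExpansion.
Variable R : realType.

Lemma exp_log_near (y : R) : `|y| <= 1 / 2 -> exists2 r, 1 + y = expR r & `|r| <= 2 * `|y|.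
Proof.
move=> hy; have y1 : 0 < 1 + y by move: hy; rewrite ler_norml; lra.
exists (ln (1 + y)); first by rewrite lnK.
have u : ln (1 + y) <= y by rewrite -ler_expR lnK // expR_ge1Dx.
have l : y / (1 + y) <= ln (1 + y).
  rewrite -ler_expR lnK ?posrE // -[leRHS]invrK -lef_pV2 ?posrE ?expR_gt0 ?invr_gt0 ?invrK //.
  rewrite -expRN; apply: le_trans (expR_ge1Dx _).
  by rewrite le_eqVlt; apply/orP; left; apply/eqP; field; rewrite gt_eqF.
have : - (2 * `|y|) <= y / (1 + y).
  rewrite ler_pdivlMr //; have [y0|y0] := leP 0 y.
    by rewrite ger0_norm //; nra.
  by rewrite ltr0_norm //; move: hy; rewrite ltr0_norm //; nra.
have := ler_norm y; have := normr_ge0 y; rewrite [X in X -> _ -> _]/=.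
by rewrite ler_norml; lra.
Qed.

Lemma is_derive_exp_quadratic (x : R) :
  is_derive x 1 (fun x : R => (1 + x + x ^+ 2 / 2) * expR (- x)) (- (x ^+ 2 / 2) * expR (- x)).
Proof.
have -> : (fun x : R => (1 + x + x ^+ 2 / 2) * expR (- x)) =
  ((cst 1 + id + 2^-1 \*: (id ^+ 2)) * (expR \o -%R) : R -> R).
  by apply/boolp.funext => y; rewrite !fctE /= [y ^+ 2 / 2]mulrC.
apply: is_derive_eq; rewrite !fctE /= /GRing.scale /=.
by rewrite expr1; field.
Qed.

(** The derivative of this product is [- (x ^+ 2 / 2) * expR (- x)], already of second order, so the
    mean value theorem gives a cubic bound. *)
Lemma exp_quadratic (u : R) : `|u| <= 1 / 2 -> `|(1 + u + u ^+ 2 / 2) * expR (- u) - 1| <= `|u| ^+ 3.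
Proof.
move=> hu; set g := fun x : R => (1 + x + x ^+ 2 / 2) * expR (- x).
have g0 : g 0 = 1 by rewrite /g oppr0 expR0; ring.
have cg (a b : R) : {within `[a, b], continuous g}.
  apply: derivable_within_continuous => x _.
  by have := is_derive_exp_quadratic x => -[].
have bound c : `|c| <= `|u| -> `|c ^+ 2 / 2 * expR (- c)| <= `|u| ^+ 2.
  move=> cu; rewrite normrM normrM normrX (gtr0_norm (expR_gt0 _)) (@ger0_norm _ 2^-1) ?invr_ge0 //.
  have : expR (- c) <= 2.
    have : 1 / 2 <= expR c.
      apply: le_trans (expR_ge1Dx _); have : `|c| <= 1 / 2 by exact: le_trans cu hu.
      by rewrite ler_norml; lra.
    by rewrite expRN => h; rewrite -[leRHS]invrK lef_pV2 ?posrE ?expR_gt0 ?invr_gt0 //; lra.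
  move=> h; apply: (@le_trans _ _ (`|c| ^+ 2 / 2 * 2)).
    by rewrite ler_wpM2l // mulr_ge0 ?exprn_ge0 ?invr_ge0.
  by rewrite divfK ?pnatr_eq0 // lerXn2r ?nnegrE.
have [u0|u0|u0] := ltgtP u 0.
- have [c cin] := MVT u0 (fun x _ => is_derive_exp_quadratic x) (@cg u 0).
  rewrite -/g -/(g u) -/(g 0) g0 sub0r distrC => ->.
  rewrite normrM mulNr normrN [`|u| ^+ 3]exprSr normrN ler_wpM2r ?normr_ge0 //; apply: bound.
  by move: cin; rewrite in_itv /= => /andP[h1 h2]; rewrite !ltr0_norm //; lra.
- have [c cin] := MVT u0 (fun x _ => is_derive_exp_quadratic x) (@cg 0 u).
  rewrite -/g -/(g u) -/(g 0) g0 subr0 => ->.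
  rewrite normrM mulNr normrN [`|u| ^+ 3]exprSr ler_wpM2r ?normr_ge0 //; apply: bound.
  by move: cin; rewrite in_itv /= => /andP[h1 h2]; rewrite !gtr0_norm //; lra.
by rewrite u0 -/(g 0) g0 subrr normr0 exprn_ge0.
Qed.

End ExpExpansion.

End ExpTaylor.

(** * Adding the arcs of a copy one at a time *)

Section StepExpansion.
Variables (R : realType) (q e : R).
Hypotheses (q10 : 10 <= q) (e0 : 0 < e) (small : q ^+ 40 * e <= 1).
Local Notation bW := (bnd_weak q10 e0 small).
Local Notation bD := (bndD q10 e0).
Local Notation bB := (bndB q10 e0).

Lemma bnd_half m k x : bnd q e m k x -> bnd q e m k (x / 2).
Proof.
rewrite /bnd normrM (@ger0_norm _ 2^-1) ?invr_ge0 // => h; apply: le_trans h.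
by have := normr_ge0 x; lra.
Qed.

Lemma bnd_small m x : (m < 40)%N -> bnd q e m 1 x -> `|x| <= 1 / 2.
Proof.
move=> m40 h; have : bnd q e m.+1 1 (2 * x).
  apply: bnd10 => //; rewrite normrM ger0_norm //.
  by move: h; rewrite /bnd; have := bnd_unit_ge0 q10 e0 m 1; lra.
rewrite -[m.+1]addn0 => /(@bnd_trade _ _ _ q10 e0 small m.+1 0 0 _ m40).
by rewrite /bnd mulr1 normrM ger0_norm //; lra.
Qed.

(** Here [pi] is the exact density, [mu] its limit, and [d] and [w] are the first and second order
    terms of an arc probability. With [W = d / mu + w / mu - (d / mu) ^+ 2 / 2], the polynomial
    [1 + W + W ^+ 2 / 2] is [1 + (d + w) / mu] up to third order, and exchanging [mu] for [pi] under
    [d + w] is a third order change too. *)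
Lemma step_exp (pi mu d w prob : R) :
  0 < pi -> mu != 0 -> bnd q e 1 0 mu^-1 -> bnd q e 2 0 pi^-1 -> bnd q e 1 2 (mu - pi) ->
  bnd q e 2 1 d -> bnd q e 6 2 w -> bnd q e 25 3 (prob - (pi + (d + w))) ->
  exists2 r, bnd q e 32 3 r & prob = pi * expR (d / mu + w / mu - (d / mu) ^+ 2 / 2 + r).
Proof.
move=> pi0 mu0 hmu hpi hmp hd hw hprob.
set a := d / mu; set w' := w / mu.
have ha : bnd q e 3 1 a by exact: (@bndM _ q e 2 1 1 0).
have hw' : bnd q e 7 2 w' by exact: (@bndM _ q e 6 2 1 0).
have ha2 : bnd q e 6 2 (a ^+ 2 / 2) by apply: bnd_half; rewrite expr2; exact: (@bndM _ q e 3 1 3 1).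
pose w2 := w' - a ^+ 2 / 2.
have hw2 : bnd q e 8 2 w2 by apply: (bB (m := 7)) => //; exact: bW ha2.
pose W := a + w2.
have hW : bnd q e 9 1 W by apply: (bD (m := 8)); [exact: bW ha | exact: bW hw2].
have W12 : `|W| <= 1 / 2 by apply: bnd_small hW.
have hexp : bnd q e 1 0 (expR (- W)).
  apply: bnd10 => //; rewrite mulr1 expr0 ger0_norm ?expR_ge0 // mulr1.
  rewrite expRN; have : 1 / 2 <= expR W.
    by apply: le_trans (expR_ge1Dx _); move: W12; rewrite ler_norml; lra.
  move=> h; apply: (@le_trans _ _ 2); last by lra.
  by rewrite -[leRHS]invrK lef_pV2 ?posrE ?expR_gt0 ?invr_gt0 //; lra.
have W3 : bnd q e 27 3 ((1 + W + W ^+ 2 / 2) * expR (- W) - 1).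
  apply: le_trans (ExpTaylor.exp_quadratic W12) _; have := bndM (bndM hW hW) hW.
  by rewrite /bnd !normrM -expr2 -exprSr.
pose eps := prob / pi - (1 + W + W ^+ 2 / 2).
have heps : bnd q e 29 3 eps.
  have h1 := bndM hprob hpi.
  have hdw : bnd q e 7 1 (d + w) by apply: (bD (m := 6)); [exact: bW hd | exact: bW hw].
  have h2 := bndM hdw (bndM hmp (bndM hpi hmu)).
  have h3 := bndM ha hw2.
  have h4 : bnd q e 16 4 (w2 ^+ 2 / 2) by apply: bnd_half; rewrite expr2; exact: (@bndM _ q e 8 2 8 2).
  have -> : eps = ((prob - (pi + (d + w))) * pi^-1 + (d + w) * ((mu - pi) * (pi^-1 * mu^-1))) -
       (a * w2 + w2 ^+ 2 / 2).
    by rewrite /eps /W /w2 /a /w'; field; rewrite mu0 gt_eqF.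
  apply: (bB (m := 28)).
    by apply: (bD (m := 27)); [exact: h1 | exact: bW h2].
  by apply: (bW (m := 17) (k := 3)) => //; apply: (bD (m := 16)); [exact: bW h3 | exact: bW h4].
pose y := (1 + W + W ^+ 2 / 2) * expR (- W) - 1 + eps * expR (- W).
have hy : bnd q e 31 3 y.
  by apply: (bD (m := 30)); [exact: bW W3 | exact: (bndM heps hexp)].
have [r yr hr] := ExpTaylor.exp_log_near (bnd_small (isT : (31 < 40)%N) (bW (leqnn 31) (isT : (1 <= 3)%N) hy)).
exists r.
  apply: bnd10 => //; apply: le_trans hr _.
  by move: hy; rewrite /bnd; have := bnd_unit_ge0 q10 e0 31 3; lra.
have -> : d / mu + w / mu - (d / mu) ^+ 2 / 2 = W by rewrite /W /w2 -/a -/w'; ring.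
rewrite expRD -yr mulrA.
have -> : 1 + y = prob / pi * expR (- W) by rewrite /y /eps; ring.
transitivity (prob / pi * pi * (expR W * expR (- W))); last by ring.
by rewrite expRxMexpNx_1 mulr1 divfK // gt_eqF.
Qed.

End StepExpansion.

Section Extension.
Variables (R : realType) (n : nat) (s t : 'I_n -> nat) (L e q : R) (b : bool).

Definition diagonal : digraph n := [set p | p.1 == p.2].
(* [b] tells whether the positions in [Y] are required to be arcs or non-arcs. *)
Definition pinned (Y : digraph n) : digraph n := if b then Y else set0.
Definition pinned_class Y := frozen_class (diagonal :|: Y) (pinned Y) s t.

Lemma pinned_class0 : pinned_class set0 = frozen_class diagonal set0 s t.
Proof. by rewrite /pinned_class setU0 /pinned; case: b. Qed.

(** Pinning one more position is conditioning on its state, so ratios of class sizes are conditional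
    arc probabilities. *)
Lemma pinned_class_step Y p : p \notin diagonal :|: Y ->
  pinned_class (p |: Y) = [set M in pinned_class Y | (p \in M) == b].
Proof.
move=> pY; apply/setP => M; rewrite !inE.
rewrite [RHS]andbAC; congr (_ && _).
have pinp : (p \in pinned (p |: Y)) = b by rewrite /pinned; case: b; rewrite !inE ?eqxx.
have pin p' : p' != p -> (p' \in pinned (p |: Y)) = (p' \in pinned Y).
  by move=> /negbTE pp; rewrite /pinned; case: b; rewrite !inE ?pp.
have pinY : p \in pinned Y = false.
  by move: pY; rewrite /pinned inE negb_or => /andP[_ /negbTE h]; case: b; rewrite ?inE.
apply/eqP/andP => [h|[/eqP h /eqP hb]].
  have hp : (p \in M) = b.
    by rewrite -pinp -h !inE eqxx /= orbT andbT.
  split; last by rewrite hp.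
  apply/eqP/setP => p'; have [->|pp] := eqVneq p' p.
    by rewrite inE (negbTE pY) andbF pinY.
  by rewrite -(pin _ pp) -h !inE (negbTE pp).
apply/setP => p'; have [->|pp] := eqVneq p' p.
  by rewrite !inE eqxx /= orbT andbT hb pinp.
by rewrite (pin _ pp) -h !inE (negbTE pp).
Qed.

Lemma regime_ext F Z F' Z' : regime F Z s t L e q ->
  (forall j, (outdeg F' j)%:R <= q) -> (forall j, (indeg F' j)%:R <= q) ->
  frozen_class F' Z' s t != set0 -> regime F' Z' s t L e q.
Proof. by case=> *; split. Qed.

Definition dens_limit : R := if b then L else 1 - L.
Definition dens_sign : R := if b then 1 else -1.
(** [L * n%:R / (n%:R - 1)] is [p], the density on the [n * (n - 1)] positions off the diagonal. *)
Definition dens_exact : R := if b then L * n%:R / (n%:R - 1) else 1 - L * n%:R / (n%:R - 1).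

Lemma base_rowE (Y : digraph n) j : [disjoint Y & diagonal] ->
  base_row (diagonal :|: Y) (pinned Y) L j = L * n%:R - L + (b%:R - L) * (outdeg Y j)%:R.
Proof.
move=> dY.
have -> : (outdeg Y j)%:R = \sum_k ((j, k) \in Y)%:R :> R.
  by rewrite -sum_bool_card; apply: eq_bigr => k _; rewrite inE.
have -> : L * n%:R - L + (b%:R - L) * \sum_k ((j, k) \in Y)%:R =
    \sum_(k < n) (L - L * (k == j)%:R + (b%:R - L) * ((j, k) \in Y)%:R).
  rewrite big_split sumrB sum_ord_cst -!mulr_sumr; congr (_ - _ + _); first by rewrite mulrC.
  rewrite (bigD1 j) //= eqxx big1 ?addr0 ?mulr1 // => k /negbTE ->; by [].
apply: eq_bigr => k _; rewrite /base_entry /pinned !inE /= eq_sym.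
have [->|kj] := eqVneq k j => /=.
  have jY0 : ((j, j) \in Y) = false.
    by apply/negbTE/negP => jY; have := disjointFr dY jY; rewrite inE eqxx.
  by case: b; rewrite ?inE ?jY0 /=; ring.
case: ifP => jkY; last by rewrite ?jkY /=; ring.
by case: b; rewrite ?inE ?jkY /=; ring.
Qed.

Lemma base_colE (Y : digraph n) k : [disjoint Y & diagonal] ->
  base_col (diagonal :|: Y) (pinned Y) L k = L * n%:R - L + (b%:R - L) * (indeg Y k)%:R.
Proof.
move=> dY.
have -> : (indeg Y k)%:R = \sum_j ((j, k) \in Y)%:R :> R.
  by rewrite -sum_bool_card; apply: eq_bigr => j _; rewrite inE.
have -> : L * n%:R - L + (b%:R - L) * \sum_j ((j, k) \in Y)%:R =
    \sum_(j < n) (L - L * (j == k)%:R + (b%:R - L) * ((j, k) \in Y)%:R).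
  rewrite big_split sumrB sum_ord_cst -!mulr_sumr; congr (_ - _ + _); first by rewrite mulrC.
  rewrite (bigD1 k) //= eqxx big1 ?addr0 ?mulr1 // => j /negbTE ->; by [].
apply: eq_bigr => j _; rewrite /base_entry /pinned !inE /=.
have [->|kj] := eqVneq j k => /=.
  have jY0 : ((k, k) \in Y) = false.
    by apply/negbTE/negP => jY; have := disjointFr dY jY; rewrite inE eqxx.
  by case: b; rewrite ?inE ?jY0 /=; ring.
case: ifP => jkY; last by rewrite ?jkY /=; ring.
by case: b; rewrite ?inE ?jkY /=; ring.
Qed.

Lemma sum_outdeg (Y : digraph n) : \sum_j (outdeg Y j)%:R = #|Y|%:R :> R.
Proof.
rewrite -sum_bool_card.
rewrite (eq_bigr (fun p : 'I_n * 'I_n => ((p.1, p.2) \in Y)%:R)); last by case.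
rewrite -(pair_bigA _ (fun j k => ((j, k) \in Y)%:R)) /=; apply: eq_bigr => j _.
by rewrite -sum_bool_card; apply: eq_bigr => k _; rewrite inE.
Qed.

End Extension.

Section StepCount.
Variables (R : realType) (n : nat) (s t : 'I_n -> nat) (L e q : R) (b : bool).
Hypothesis rg0 : regime (diagonal n) set0 s t L e q.
Let kappa := (1 - 2 * L) / (L * (1 - L)).
Local Notation eta k := (e ^+ 2 * ((t k)%:R - L * n%:R)).
Local Notation delta j := (e ^+ 2 * ((s j)%:R - L * n%:R)).
Local Notation mu := (dens_limit L b).
Local Notation zeta := (dens_sign R b).
Local Notation dens := (dens_exact n L b).
Local Notation pinned_class := (pinned_class s t b).
Local Notation bW := (bnd_weak (reg_q rg0) (reg_e rg0) (reg_small rg0)).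
Local Notation bD := (bndD (reg_q rg0) (reg_e rg0)).
Local Notation bB := (bndB (reg_q rg0) (reg_e rg0)).

Lemma dens_limit_gt0 : 0 < mu.
Proof. by have /andP[L0 L1] := reg_L01 rg0; rewrite /dens_limit; case: b; lra. Qed.

Lemma dens_limit_lt1 : mu < 1.
Proof. by have /andP[L0 L1] := reg_L01 rg0; rewrite /dens_limit; case: b; lra. Qed.

Lemma dens_limitV : 1 <= q * mu.
Proof. by rewrite /dens_limit; case: b; [exact: reg_L rg0|exact: reg_1L rg0]. Qed.

Lemma dens_limit_bnd : bnd q e 1 0 mu^-1.
Proof.
have m0 := dens_limit_gt0; rewrite /bnd mulr1 ger0_norm ?invr_ge0 ?(ltW m0) //.
by rewrite expr1 -[leLHS]mul1r ler_pdivrMr // dens_limitV.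
Qed.

Lemma e_small : e ^+ 2 <= 1 / 100 /\ e ^+ 2 * (100 * q) <= 1.
Proof.
have q10 := reg_q rg0; have e0 := reg_e rg0; have sm := reg_small rg0.
have h1 : q ^+ 3 * e ^+ 2 <= 1.
  have := @bnd_trade _ _ _ q10 e0 sm 3 0 0 (q ^+ 3 * e ^+ 2) isT.
  rewrite /bnd mulr1 ger0_norm ?bnd_unit_ge0 //; apply.
  by apply: ler_wpM2l; [rewrite exprn_ge0 //; lra | rewrite ler_wiXn2l ?(ltW e0) // (bnd_e1 q10 e0 sm)].
have q2 : 100 <= q ^+ 2 by have : 10 * 10 <= q * q; [apply: ler_pM; lra | rewrite expr2; lra].
have e20 : 0 <= e ^+ 2 by rewrite exprn_ge0 // ltW.
have h2 : e ^+ 2 * (100 * q) <= 1.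
  apply: le_trans h1; rewrite mulrC ler_wpM2r //.
  have -> : q ^+ 3 = q ^+ 2 * q by ring.
  by rewrite ler_wpM2r //; lra.
split=> //; have : e ^+ 2 * (100 * 1) <= e ^+ 2 * (100 * q) by rewrite ler_wpM2l //; lra.
lra.
Qed.

Lemma ratio_e : n%:R / (n%:R - 1) = (1 - e ^+ 2)^-1 :> R.
Proof.
have e0 := reg_e rg0; have [h _] := e_small.
have e20 : 0 < e ^+ 2 by rewrite exprn_gt0.
have -> : n%:R = (e ^+ 2)^-1 :> R by rewrite -[LHS](mulfK (lt0r_neq0 e20)) (reg_n rg0) div1r.
by field; rewrite !gt_eqF //; lra.
Qed.

Lemma dens_diff : bnd q e 1 4 (L * n%:R / (n%:R - 1) - L - e ^+ 2 * L).
Proof.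
have q10 := reg_q rg0; have e0 := reg_e rg0; have [h _] := e_small.
have /andP[L0 L1] := reg_L01 rg0.
rewrite -mulrA ratio_e; apply: bnd10 => //.
have -> : L / (1 - e ^+ 2) - L - e ^+ 2 * L = L / (1 - e ^+ 2) * e ^+ 4.
  by field; rewrite gt_eqF //; lra.
rewrite expr0 mul1r normrM ger0_norm; last by rewrite divr_ge0 //; lra.
rewrite ger0_norm ?exprn_ge0 ?(ltW e0) // ler_wpM2r ?exprn_ge0 ?(ltW e0) //.
by rewrite ler_pdivrMr; lra.
Qed.

Lemma dens_near : bnd q e 1 2 (mu - dens).
Proof.
have q10 := reg_q rg0; have e0 := reg_e rg0; have [h _] := e_small.
have /andP[L0 L1] := reg_L01 rg0.
have hh : bnd q e 1 2 (L * n%:R / (n%:R - 1) - L).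
  rewrite -mulrA ratio_e; apply: bnd10 => //.
  have -> : L / (1 - e ^+ 2) - L = L / (1 - e ^+ 2) * e ^+ 2 by field; rewrite gt_eqF //; lra.
  rewrite expr0 mul1r normrM ger0_norm; last by rewrite divr_ge0 //; lra.
  rewrite ger0_norm ?exprn_ge0 ?(ltW e0) // ler_wpM2r ?exprn_ge0 ?(ltW e0) //.
  by rewrite ler_pdivrMr; lra.
rewrite /dens_limit /dens_exact; case: b.
  by rewrite -opprB; apply: bndN.
by move: hh; congr (bnd _ _ _ _ _); ring.
Qed.

Lemma dens_gt : 1 <= 2 * q * dens.
Proof.
have q10 := reg_q rg0; have e0 := reg_e rg0; have [h1 h2] := e_small.
have := dens_near; have := dens_limitV; rewrite /bnd expr1 ler_norml => h3 /andP[_ h4].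
have q0 : 0 <= q by lra.
have := ler_wpM2l q0 h4.
have : q * (q * e ^+ 2) <= 1 / 2.
  have sm := reg_small rg0.
  have := @bnd_small _ q e q10 e0 sm 2 (q ^+ 2 * e ^+ 2) isT.
  rewrite ger0_norm ?bnd_unit_ge0 // mulrA -expr2; apply.
  rewrite /bnd ger0_norm ?bnd_unit_ge0 //.
  by apply: ler_wpM2l; [rewrite exprn_ge0 //; lra | rewrite ler_wiXn2l ?(ltW e0) // (bnd_e1 q10 e0 sm)].
lra.
Qed.

Lemma dens_gt0 : 0 < dens.
Proof.
have := dens_gt; have q10 := reg_q rg0 => h.
have q0 : 0 < 2 * q by lra.
by rewrite -(pmulr_rgt0 _ q0); lra.
Qed.

Lemma dens_bnd : bnd q e 2 0 dens^-1.
Proof.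
have q10 := reg_q rg0; have e0 := reg_e rg0; have d0 := dens_gt0.
apply: bnd10 => //; rewrite mulr1 expr1 ger0_norm ?invr_ge0 ?(ltW d0) //.
rewrite -[leLHS]mul1r ler_pdivrMr //; apply: le_trans dens_gt _.
by rewrite ler_wpM2r ?(ltW d0) //; lra.
Qed.

Section Step.
Variables (Y : digraph n) (j k : 'I_n).
Hypotheses (jkY : (j, k) \notin diagonal n :|: Y) (dY : [disjoint Y & diagonal n]).
Hypothesis Y0 : pinned_class Y != set0.
Hypothesis hout : forall j, (outdeg Y j)%:R + 1 <= q.
Hypothesis hin : forall j, (indeg Y j)%:R + 1 <= q.

Lemma regime_pinned : regime (diagonal n :|: Y) (pinned b Y) s t L e q.
Proof.
apply: (regime_ext rg0) => // [i|i].
  apply: le_trans (hout i); rewrite natr1 ler_nat -add1n.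
  rewrite -(cards1 i); apply: leq_trans (leq_card_setU _ _).
  by apply: subset_leq_card; apply/subsetP => w; rewrite !inE eq_sym.
apply: le_trans (hin i); rewrite natr1 ler_nat -add1n.
rewrite -(cards1 i); apply: leq_trans (leq_card_setU _ _).
by apply: subset_leq_card; apply/subsetP => w; rewrite !inE.
Qed.

Definition step_main : R := zeta * (delta j + eta k).
(** Each position already pinned in the row or column has used up [1 - mu] more of the state [b]
    than is expected of it; in this form the correction is the same for both values of [b]. *)
Definition step_rest : R := zeta * (kappa * delta j * eta k) -
  (1 - mu) * (e ^+ 2 * ((outdeg Y j)%:R + (indeg Y k)%:R - e ^+ 2 * #|Y|%:R)).

Lemma zeta_bnd : bnd q e 0 0 zeta.
Proof. by rewrite /bnd mulr1 /dens_sign; case: b; rewrite ?normrN normr1. Qed.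

Lemma step_main_bnd : bnd q e 2 1 step_main.
Proof.
apply: (@bndM _ q e 0 0 2 1); first exact: zeta_bnd.
by apply: bD; [exact: (dev_s_bnd rg0) | exact: (dev_t_bnd rg0)].
Qed.

Lemma step_rest_bnd : bnd q e 6 2 step_rest.
Proof.
have q10 := reg_q rg0; have e0 := reg_e rg0.
apply: (bB (m := 5)).
  apply: bW (bndM zeta_bnd (bndM (bndM (kappa_bnd rg0) (dev_s_bnd rg0 j)) (dev_t_bnd rg0 k))) => //.
have h1 : bnd q e 0 0 (1 - mu).
  rewrite /bnd mulr1 ger0_norm; have := dens_limit_gt0; have := dens_limit_lt1; lra.
have h2 : bnd q e 2 0 ((outdeg Y j)%:R + (indeg Y k)%:R - e ^+ 2 * #|Y|%:R).
  apply: bnd10 => //; rewrite mulr1 expr1.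
  have : 0 <= e ^+ 2 * #|Y|%:R <= q.
    rewrite mulr_ge0 ?exprn_ge0 ?(ltW e0) //= -(sum_outdeg R Y).
    have : \sum_i (outdeg Y i)%:R <= \sum_(i < n) q.
      by apply: ler_sum => i _; have := hout i; lra.
    rewrite sum_ord_cst => /(ler_wpM2l (exprn_ge0 2 (ltW e0)))/le_trans; apply.
    by rewrite mulrA [e ^+ 2 * _]mulrC (reg_n rg0) mul1r.
  have := hout j; have := hin k; have : 0 <= (outdeg Y j)%:R :> R by []; have : 0 <= (indeg Y k)%:R :> R by [].
  rewrite ler_norml; lra.
by apply: bW (bndM h1 (bndM (bnd_e q e0 2) h2)).
Qed.

Definition step_prob : R := mean (pinned_class Y) (fun M => (((j, k) \in M) == b)%:R).

Lemma card_step : #|pinned_class ((j, k) |: Y)|%:R = #|pinned_class Y|%:R * step_prob.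
Proof.
rewrite /step_prob /mean mulrCA divff ?mulr1 ?pnatr_eq0 ?cards_eq0 //.
rewrite pinned_class_step // -sum_bool_card [RHS]big_mkcond; apply: eq_bigr => M _.
by rewrite [in LHS]inE; case: (M \in _).
Qed.

(** [entry_mean] with the diagonal and [Y] frozen. The empty diagonal cancels between [base_row] and
    [base_mean], but adds [e ^+ 2 * L] through [base_col]; up to order [e ^+ 4] this turns [L] into
    [p]. *)
Lemma step_prob_near : bnd q e 25 3 (step_prob - (dens + (step_main + step_rest))).
Proof.
have q10 := reg_q rg0; have e0 := reg_e rg0.
have h := entry_mean regime_pinned jkY.
rewrite base_rowE // base_colE // /base_mean in h.
have bm : e ^+ 2 * \sum_l base_row (diagonal n :|: Y) (pinned b Y) L l =
   L * n%:R - L + (b%:R - L) * (e ^+ 2 * #|Y|%:R).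
  under eq_bigr => l _ do rewrite base_rowE //.
  rewrite big_split sum_ord_cst -mulr_sumr sum_outdeg mulrDr mulrA [e ^+ 2 * n%:R]mulrC (reg_n rg0) /=.
  by ring.
rewrite bm in h.
have hd := dens_diff.
have pr : step_prob = 1 - b%:R + zeta * mean (pinned_class Y) (fun M => entry R M j k).
  rewrite -meanZ -[X in X + _](mean_cst (1 - b%:R : R) Y0) -meanD; apply: eq_mean => M _.
  by rewrite /dens_sign /entry; case: (b); case: (_ \in M) => /=; ring.
have {}hd := bW (isT : (1 <= 24)%N) (isT : (3 <= 4)%N) hd.
have := bB h hd.
rewrite pr /step_main /step_rest /dens_exact /dens_sign /dens_limit.
rewrite -/(pinned_class Y); move: (mean _ _) => m; case: (b) => /=.
  by congr (bnd _ _ _ _ _); rewrite /kappa; ring.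
by move/bndN; congr (bnd _ _ _ _ _); rewrite /kappa; ring.
Qed.

Lemma step_count : exists2 r, bnd q e 32 3 r &
  #|pinned_class ((j, k) |: Y)|%:R = #|pinned_class Y|%:R *
    (dens * expR (step_main / mu + step_rest / mu - (step_main / mu) ^+ 2 / 2 + r)).
Proof.
have [r hr pr] := step_exp (reg_q rg0) (reg_e rg0) (reg_small rg0) dens_gt0 (lt0r_neq0 dens_limit_gt0)
  dens_limit_bnd dens_bnd dens_near step_main_bnd step_rest_bnd step_prob_near.
by exists r => //; rewrite card_step pr.
Qed.

End Step.
End StepCount.

Section ArcSums.
Variables (R : realType) (n : nat).
Implicit Types (Y : digraph n).

Lemma sum_arcs Y (f : 'I_n -> 'I_n -> R) :
  \sum_(p in Y) f p.1 p.2 = \sum_j \sum_k ((j, k) \in Y)%:R * f j k.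
Proof.
rewrite pair_bigA /= big_mkcond; apply: eq_bigr => -[j k] _ /=.
by case: (_ \in Y); rewrite ?mul1r ?mul0r.
Qed.

Lemma sum_arcs_tail Y (f : 'I_n -> R) : \sum_(p in Y) f p.1 = \sum_j (outdeg Y j)%:R * f j.
Proof.
rewrite (sum_arcs Y (fun j _ => f j)); apply: eq_bigr => j _; rewrite -mulr_suml; congr (_ * _).
by rewrite -sum_bool_card; apply: eq_bigr => k _; rewrite inE.
Qed.

Lemma sum_arcs_head Y (f : 'I_n -> R) : \sum_(p in Y) f p.2 = \sum_k (indeg Y k)%:R * f k.
Proof.
rewrite (sum_arcs Y (fun _ k => f k)) exchange_big; apply: eq_bigr => k _; rewrite -mulr_suml; congr (_ * _).
by rewrite -sum_bool_card; apply: eq_bigr => j _; rewrite inE.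
Qed.

Lemma outdeg_setU1 Y j k i : (j, k) \notin Y -> outdeg ((j, k) |: Y) i = (outdeg Y i + (i == j))%N.
Proof.
move=> jkY; rewrite /outdeg; have [->|ij] := eqVneq i j.
  have -> : [set w | (j, w) \in (j, k) |: Y] = k |: [set w | (j, w) \in Y].
    by apply/setP => w; rewrite !inE xpair_eqE eqxx.
  by rewrite cardsU1 inE jkY addnC.
by rewrite addn0; apply: eq_card => w; rewrite !inE xpair_eqE (negbTE ij).
Qed.

Lemma indeg_setU1 Y j k i : (j, k) \notin Y -> indeg ((j, k) |: Y) i = (indeg Y i + (i == k))%N.
Proof.
move=> jkY; rewrite /indeg; have [->|ij] := eqVneq i k.
  have -> : [set w | (w, k) \in (j, k) |: Y] = j |: [set w | (w, k) \in Y].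
    by apply/setP => w; rewrite !inE xpair_eqE eqxx andbT.
  by rewrite cardsU1 inE jkY addnC.
by rewrite addn0; apply: eq_card => w; rewrite !inE xpair_eqE (negbTE ij) andbF.
Qed.

Lemma outdeg_set0 i : outdeg (set0 : digraph n) i = 0%N.
Proof. by apply: eq_card0 => w; rewrite !inE. Qed.

Lemma indeg_set0 i : indeg (set0 : digraph n) i = 0%N.
Proof. by apply: eq_card0 => w; rewrite !inE. Qed.

Definition choose2 (m : nat) : R := m%:R * (m%:R - 1) / 2.

Lemma choose2S m : choose2 m.+1 = choose2 m + m%:R.
Proof. by rewrite /choose2 -natr1; field. Qed.

Lemma sum_choose2 (f g : 'I_n -> nat) j : (forall i, g i = (f i + (i == j))%N) ->
  \sum_i choose2 (g i) = \sum_i choose2 (f i) + (f j)%:R.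
Proof.
move=> h; rewrite (bigD1 j) //= [in RHS](bigD1 j) //= h eqxx addn1 choose2S addrAC; congr (_ + _ + _).
by apply: eq_bigr => i /negbTE ij; rewrite h ij addn0.
Qed.

End ArcSums.

Section Product.
Variables (R : realType) (n : nat) (s t : 'I_n -> nat) (L e q : R) (b : bool).
Hypothesis rg0 : regime (diagonal n) set0 s t L e q.
Let kappa := (1 - 2 * L) / (L * (1 - L)).
Local Notation eta k := (e ^+ 2 * ((t k)%:R - L * n%:R)).
Local Notation delta j := (e ^+ 2 * ((s j)%:R - L * n%:R)).
Local Notation mu := (dens_limit L b).
Local Notation zeta := (dens_sign R b).
Local Notation dens := (dens_exact n L b).
Local Notation pinned_class := (pinned_class s t b).
Local Notation main j k := (step_main s t L e b j k).

Definition arc_weight j k : R :=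
  main j k / mu + zeta * (kappa * delta j * eta k) / mu - (main j k / mu) ^+ 2 / 2.

(* The order in which arcs are added is immaterial: the degrees met along the way
   add up to [choose2] of the final ones. *)
Definition potential (Y : digraph n) : R :=
  \sum_(p in Y) arc_weight p.1 p.2 - (1 - mu) / mu * (e ^+ 2 *
    (\sum_j choose2 R (outdeg Y j) + \sum_k choose2 R (indeg Y k) - e ^+ 2 * choose2 R #|Y|)).

Lemma potential_step (Y : digraph n) j k : (j, k) \notin Y ->
  potential ((j, k) |: Y) = potential Y +
    (main j k / mu + step_rest s t L e b Y j k / mu - (main j k / mu) ^+ 2 / 2).
Proof.
move=> jkY; rewrite /potential big_setU1 //= cardsU1 jkY add1n choose2S.
rewrite (sum_choose2 R (fun i => outdeg_setU1 i jkY)) (sum_choose2 R (fun i => indeg_setU1 i jkY)).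
rewrite /arc_weight /step_rest -/kappa.
move: (\sum_(i in Y) _) (\sum_j _) (\sum_k _) (choose2 _ _) => x y z w.
have := dens_limit_gt0 b rg0; move: (main j k) (mu) => a m m0.
by field; rewrite gt_eqF.
Qed.

Lemma le_outdeg (Y Y' : digraph n) j : Y \subset Y' -> (outdeg Y j <= outdeg Y' j)%N.
Proof. by move=> /subsetP h; apply: subset_leq_card; apply/subsetP => w; rewrite !inE; exact: h. Qed.

Lemma le_indeg (Y Y' : digraph n) j : Y \subset Y' -> (indeg Y j <= indeg Y' j)%N.
Proof. by move=> /subsetP h; apply: subset_leq_card; apply/subsetP => w; rewrite !inE; exact: h. Qed.

Variables (H : digraph n).
Hypotheses (dH : [disjoint H & diagonal n]).
Hypothesis hout : forall j, (outdeg H j)%:R + 1 <= q.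
Hypothesis hin : forall j, (indeg H j)%:R + 1 <= q.

Lemma count_product (Y : digraph n) : Y \subset H ->
  exists2 r, `|r| <= #|Y|%:R * (q ^+ 32 * e ^+ 3) &
  #|pinned_class Y|%:R = #|pinned_class set0|%:R * (dens ^+ #|Y| * expR (potential Y + r)).
Proof.
have q10 := reg_q rg0; have e0 := reg_e rg0.
move cY : #|Y| => m; elim: m Y cY => [|m IH] Y cY YH.
  have -> : Y = set0 by apply/eqP; rewrite -cards_eq0 cY.
  exists 0; first by rewrite normr0 mul0r.
  rewrite /potential big_set0 cards0 !big1 => [|i _|i _].
  - by rewrite /choose2 !mul0r mulr0 !addr0 subr0 mulr0 mulr0 subr0 expr0 expR0 !mulr1.
  - by rewrite /choose2 indeg_set0 !mul0r.
  - by rewrite /choose2 outdeg_set0 !mul0r.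
have /set0Pn[[j k] jkY] : Y != set0 by rewrite -cards_eq0 cY.
pose Y' := Y :\ (j, k).
have jkY' : (j, k) \notin Y' by rewrite !inE eqxx.
have YE : Y = (j, k) |: Y' by rewrite setD1K.
have cY' : #|Y'| = m by move: cY; rewrite (cardsD1 (j, k)) jkY => -[].
have Y'H : Y' \subset H by apply: subset_trans YH; apply: subD1set.
have [r hr E] := IH Y' cY' Y'H.
have dY : [disjoint Y' & diagonal n] by apply: disjointWl dH.
have jkd : (j, k) \notin diagonal n :|: Y'.
  rewrite inE negb_or jkY' andbT.
  by have := disjointFr dH (subsetP YH _ jkY) => ->.
(* All factors of the product formula for [Y'] are nonzero, so no class met on the way is empty. *)
have Y'0 : pinned_class Y' != set0.
  rewrite -cards_eq0 -(pnatr_eq0 R) E mulf_neq0 //.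
    by rewrite pnatr_eq0 cards_eq0 pinned_class0 (reg_ex rg0).
  by rewrite mulf_neq0 ?expf_neq0 ?gt_eqF ?expR_gt0 ?(dens_gt0 b rg0).
have ho i : (outdeg Y' i)%:R + 1 <= q.
  by apply: le_trans (hout i); rewrite lerD2r ler_nat le_outdeg.
have hi i : (indeg Y' i)%:R + 1 <= q.
  by apply: le_trans (hin i); rewrite lerD2r ler_nat le_indeg.
have [r' hr' E'] := step_count rg0 jkd dY Y'0 ho hi.
exists (r + r').
  rewrite -natr1 mulrDl mul1r; apply: le_trans (ler_normD _ _) _.
  by apply: lerD.
rewrite YE E' E potential_step // [dens ^+ m.+1]exprSr [potential _ + _ + (r + r')]addrACA.
rewrite [expR (_ + _ + (_ + r'))]expRD; ring.
Qed.

Variable x : nat.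
Hypotheses (xout : forall j, outdeg H j = x) (xin : forall k, indeg H k = x).

(** As [e ^+ 2] is [1 / n], this is [(R + C) / n ^ 2] in the notation of the statement. *)
Definition spread : R := \sum_j delta j ^+ 2 + \sum_k eta k ^+ 2.
(** The coefficient of [delta * eta] in [arc_weight] is [zeta * kappa / mu - mu ^-2], which has this
    value for both states [b]. *)
Definition cross_term (Y : digraph n) : R := - (L * (1 - L))^-1 * \sum_(p in Y) (delta p.1 * eta p.2).

(** Regularity makes the linear terms vanish, since the deviations sum to zero. The degree part is
    [x (x - 1) - x ^ 2 / 2 = x (x - 2) / 2], up to [x * e ^+ 2 / 2]; the subtracted square comes
    from [choose2] of the total number [n x] of arcs. *)
Lemma potential_regular :
  potential H = - ((1 - mu) * x%:R * (x%:R - 2)) / (2 * mu) - spread * x%:R / (2 * mu ^+ 2)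
    + cross_term H - (1 - mu) / mu * (x%:R * e ^+ 2 / 2).
Proof.
have m0 := dens_limit_gt0 b rg0; have e0 := reg_e rg0.
have cH : #|H|%:R = n%:R * x%:R :> R.
  rewrite -(sum_outdeg R H) -sum_ord_cst; apply: eq_bigr => j _; by rewrite xout.
have /andP[L0 L1] := reg_L01 rg0.
have S1 : \sum_(p in H) delta p.1 = 0.
  rewrite (sum_arcs_tail H (fun j => delta j)); under eq_bigr do rewrite xout.
  by rewrite -mulr_sumr (sum_delta rg0) mulr0.
have S2 : \sum_(p in H) eta p.2 = 0.
  rewrite (sum_arcs_head H (fun j => eta j)); under eq_bigr do rewrite xin.
  by rewrite -mulr_sumr (sum_eta rg0) mulr0.
have S3 : \sum_(p in H) delta p.1 ^+ 2 + \sum_(p in H) eta p.2 ^+ 2 = x%:R * spread.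
  rewrite (sum_arcs_head H (fun j => eta j ^+ 2)) (sum_arcs_tail H (fun j => delta j ^+ 2)) /spread mulrDr !mulr_sumr.
  by congr (_ + _); apply: eq_bigr => j _; rewrite ?xout ?xin.
have S : \sum_(p in H) arc_weight p.1 p.2 = - spread * x%:R / (2 * mu ^+ 2) + cross_term H.
  have -> : \sum_(p in H) arc_weight p.1 p.2 = zeta / mu * (\sum_(p in H) delta p.1) + zeta / mu * (\sum_(p in H) eta p.2)
      - (2 * mu ^+ 2)^-1 * (\sum_(p in H) delta p.1 ^+ 2 + \sum_(p in H) eta p.2 ^+ 2) + cross_term H.
    rewrite /cross_term -big_split !mulr_sumr -big_split -sumrB -big_split; apply: eq_bigr => -[j k] _ /=.
    rewrite /arc_weight /step_main /kappa.
    move: (delta j) (eta k) => d h; rewrite /dens_sign /dens_limit; move: m0; rewrite /dens_limit.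
    by case: (b) => m0; field; rewrite !gt_eqF //; lra.
  rewrite S1 S2 S3; ring.
have C1 : \sum_j choose2 R (outdeg H j) = n%:R * choose2 R x.
  by rewrite -sum_ord_cst; apply: eq_bigr => j _; rewrite xout.
have C2 : \sum_k choose2 R (indeg H k) = n%:R * choose2 R x.
  by rewrite -sum_ord_cst; apply: eq_bigr => j _; rewrite xin.
rewrite /potential S C1 C2 /choose2 cH.
have -> : n%:R = (e ^+ 2)^-1 :> R.
  by rewrite -[LHS](mulfK (expf_neq0 2 (lt0r_neq0 e0))) (reg_n rg0) div1r.
move: (spread) (cross_term H) => y z.
by field; rewrite !gt_eqF.
Qed.

(** There are [n x] steps with an error of order [e ^+ 3] each, and [n%:R * e ^+ 2 = 1] leaves one
    factor [e]. *)
Lemma count_regular : exists2 r, `|r| <= q ^+ 34 * e &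
  #|pinned_class H|%:R = #|pinned_class set0|%:R * (dens ^+ #|H| *
    expR (- ((1 - mu) * x%:R * (x%:R - 2)) / (2 * mu) - spread * x%:R / (2 * mu ^+ 2) + cross_term H + r)).
Proof.
have q10 := reg_q rg0; have e0 := reg_e rg0; have sm := reg_small rg0.
have m0 := dens_limit_gt0 b rg0; have m1 := dens_limit_lt1 b rg0.
have [r hr E] := count_product (subxx H).
exists (- ((1 - mu) / mu * (x%:R * e ^+ 2 / 2)) + r); last first.
  by rewrite E potential_regular !addrA.
have [n0|n0] := posnP n.
  have := reg_n rg0; rewrite n0 mul0r => /eqP; rewrite eq_sym oner_eq0 //.
have xq : x%:R + 1 <= q by rewrite -(xout (Ordinal n0)); apply: hout.
have x0 : 0 <= x%:R :> R by [].
have q0 : 0 <= q by exact: le_trans (ler0n _ 10) q10.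
have xleq : x%:R <= q by apply: le_trans xq; rewrite lerDl.
have cH : #|H|%:R = n%:R * x%:R :> R.
  rewrite -(sum_outdeg R H) -sum_ord_cst; apply: eq_bigr => j _; by rewrite xout.
have b1 : bnd q e 33 1 r.
  apply: le_trans hr _; rewrite cH.
  have -> : n%:R * x%:R * (q ^+ 32 * e ^+ 3) = n%:R * e ^+ 2 * (x%:R * (q ^+ 32 * e)) by ring.
  rewrite (reg_n rg0) mul1r; have -> : q ^+ 33 * e ^+ 1 = q * (q ^+ 32 * e) by ring.
 by rewrite ler_wpM2r ?mulr_ge0 ?exprn_ge0 ?(ltW e0).
have b2 : bnd q e 33 1 (- ((1 - mu) / mu * (x%:R * e ^+ 2 / 2))).
  apply: bndN; have h1 : bnd q e 0 0 (1 - mu) by rewrite /bnd mulr1 ger0_norm ?subr_ge0 ?(ltW m1) // gerBl ltW.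
  have h2 : bnd q e 1 0 x%:R by rewrite /bnd mulr1 ger0_norm.
  have h3 : bnd q e 0 2 (e ^+ 2) by exact: bnd_e.
  have h4 := bndM (bndM h1 (dens_limit_bnd b rg0)) (bnd_half (bndM h2 h3)).
  exact: (bnd_weak q10 e0 sm (isT : (0 + 1 + (1 + 0) <= 33)%N) (isT : (1 <= 0 + 0 + (0 + 2))%N) h4).
by have := bndD q10 e0 b2 b1; rewrite /bnd expr1.
Qed.

End Product.

(** * Averaging over relabelings *)

Section Relabel.
Variable n : nat.
Implicit Types (D : digraph n) (sigma tau : {perm 'I_n}).

Lemma in_relabel sigma D j k : ((sigma j, sigma k) \in relabel sigma D) = ((j, k) \in D).
Proof.
apply/imsetP/idP => [[[a b] abD /= [/perm_inj -> /perm_inj ->]] //|jkD].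
by exists (j, k).
Qed.

Lemma relabelM sigma tau D : relabel tau (relabel sigma D) = relabel (sigma * tau)%g D.
Proof.
apply/setP => -[j k]; rewrite -(permKV tau j) -(permKV tau k) in_relabel.
rewrite -(permKV sigma ((tau^-1)%g j)) -(permKV sigma ((tau^-1)%g k)) in_relabel.
by rewrite -!(permM sigma tau) in_relabel.
Qed.

Lemma relabel1 D : relabel 1%g D = D.
Proof. by apply/setP => -[j k]; rewrite -{1}(perm1 j) -{1}(perm1 k) in_relabel. Qed.

Lemma relabel_inj sigma : injective (@relabel n sigma).
Proof.
move=> D D' E; apply/setP => -[j k]; by rewrite -(in_relabel sigma D) E in_relabel.
Qed.

Lemma relabel_tpermK j l : involutive (@relabel n (tperm j l)).
Proof. by move=> D; rewrite relabelM tperm2 relabel1. Qed.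

Lemma outdeg_relabel sigma D j : outdeg (relabel sigma D) (sigma j) = outdeg D j.
Proof.
rewrite /outdeg -[RHS](card_imset _ (@perm_inj _ sigma)); apply: eq_card => k.
rewrite -(permKV sigma k) inE in_relabel (mem_imset _ _ (@perm_inj _ sigma)) inE; by [].
Qed.

Lemma indeg_relabel sigma D j : indeg (relabel sigma D) (sigma j) = indeg D j.
Proof.
rewrite /indeg -[RHS](card_imset _ (@perm_inj _ sigma)); apply: eq_card => k.
rewrite -(permKV sigma k) inE in_relabel (mem_imset _ _ (@perm_inj _ sigma)) inE; by [].
Qed.

End Relabel.

Section IsoAverage.
Variables (R : realType) (n : nat) (A : {set digraph n}) (x : nat).
Hypothesis Aclosed : forall j l D, D \in A -> relabel (tperm j l) D \in A.
Hypothesis Aout : forall D j, D \in A -> outdeg D j = x.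
Hypothesis Ain : forall D j, D \in A -> indeg D j = x.
Hypothesis Asimple : forall D j, D \in A -> (j, j) \notin D.

Lemma mean_relabel j l (f : digraph n -> R) : mean A (fun D => f (relabel (tperm j l) D)) = mean A f.
Proof.
rewrite /mean; congr (_ / _); rewrite [RHS](reindex_inj (@relabel_inj n (tperm j l))) /=.
apply: eq_bigl => D; apply/idP/idP => [|h]; first exact: Aclosed.
by rewrite -[D](relabel_tpermK j l); apply: Aclosed.
Qed.

Variables (u v : 'I_n -> R) (T : R).
Hypotheses (uT : forall j, `|u j| <= T) (vT : forall j, `|v j| <= T).
Hypothesis u0 : \sum_j u j = 0.

Definition bilinear (D : digraph n) : R := \sum_(p in D) u p.1 * v p.2.

Let Delta := 8 * x%:R * T ^+ 2.

Lemma bilinear_relabel sigma D : bilinear (relabel sigma D) = \sum_(p in D) u (sigma p.1) * v (sigma p.2).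
Proof.
rewrite /bilinear big_imset //= => -[a b] [c d] _ _ /= [/perm_inj -> /perm_inj ->]; by [].
Qed.

(** Only arcs with an endpoint [j] or [l] change their term, by at most [2 * T ^+ 2]; regularity
    bounds the number of these arcs by [4 * x]. *)
Lemma bilinear_swap j l D : D \in A -> `|bilinear (relabel (tperm j l) D) - bilinear D| <= Delta.
Proof.
move=> DA; rewrite bilinear_relabel /bilinear -sumrB.
have T0 : 0 <= T by apply: le_trans (uT j).
apply: le_trans (ler_norm_sum _ _ _) _.
pose c (i : 'I_n) : R := (i == j)%:R + (i == l)%:R.
apply: (@le_trans _ _ (\sum_(p in D) (2 * T ^+ 2 * c p.1 + 2 * T ^+ 2 * c p.2))).
  apply: ler_sum => -[a b] _ /=.
  have gen a' b' : `|u a' * v b' - u a * v b| <= 2 * T ^+ 2.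
    apply: le_trans (ler_normB _ _) _; rewrite !normrM.
    have := ler_pM (normr_ge0 _) (normr_ge0 _) (uT a) (vT b).
    have := ler_pM (normr_ge0 _) (normr_ge0 _) (uT a') (vT b').
    by rewrite -expr2; lra.
  have T20 : 0 <= 2 * T ^+ 2 by rewrite mulr_ge0 ?exprn_ge0.
  have c0 i : 0 <= c i by rewrite /c addr_ge0.
  have [ca|ca] := boolP ((a == j) || (a == l)).
    apply: le_trans (gen _ _) _; have : 1 <= c a.
      rewrite /c; case/orP: ca => ->; rewrite ?lerDl ?lerDr //.
    move=> h; have := ler_wpM2l T20 h; have := mulr_ge0 T20 (c0 b); lra.
  have [cb|cb] := boolP ((b == j) || (b == l)).
    apply: le_trans (gen _ _) _; have : 1 <= c b.
      rewrite /c; case/orP: cb => ->; rewrite ?lerDl ?lerDr //.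
    move=> h; have := ler_wpM2l T20 h; have := mulr_ge0 T20 (c0 a); lra.
  move: ca cb; rewrite !negb_or => /andP[aj al] /andP[bj bl].
  rewrite !tpermD 1?eq_sym // subrr normr0.
  by rewrite addr_ge0 ?mulr_ge0.
rewrite big_split (sum_arcs_tail D (fun i => 2 * T ^+ 2 * c i)) (sum_arcs_head D (fun i => 2 * T ^+ 2 * c i)) /=.
under eq_bigr do rewrite Aout //; under [X in _ + X <= _]eq_bigr do rewrite Ain //.
rewrite -!mulr_sumr.
have -> : \sum_i c i = 2.
  rewrite /c big_split /= (bigD1 j) //= eqxx big1 => [|i /negbTE -> //].
  rewrite (bigD1 l) //= eqxx big1 => [|i /negbTE -> //] /=; ring.
by rewrite /Delta le_eqVlt; apply/orP; left; apply/eqP; ring.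
Qed.

Hypothesis DeltaS : Delta <= 1 / 2.
Variable th : R.
Hypothesis th01 : 0 <= th <= 1.

(** The values used are [th = 0] and [th = 1]: the plain and the exponentially tilted average. *)
Let w D := expR (th * bilinear D).

Lemma Delta_ge0 : 0 <= Delta.
Proof. by rewrite /Delta mulr_ge0 ?sqr_ge0 // mulr_ge0. Qed.

Lemma expR_near1 (d : R) : `|d| <= Delta -> `|expR d - 1| <= 2 * Delta.
Proof.
move=> h; have D0 := Delta_ge0; have hs := DeltaS.
have h1 := expR_ge1Dx d; have h2 := expR_ge1Dx (- d).
have e0 := expR_gt0 d; move: h2; rewrite expRN => h2.
have : (1 - d) * expR d <= 1.
  have := ler_wpM2r (ltW e0) h2; rewrite mulVf ?gt_eqF //.
move: h; rewrite !ler_norml => /andP[h3 h4] h5.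
apply/andP; split; first by lra.
have : (1 - Delta) * expR d <= 1.
  by apply: le_trans h5; rewrite ler_wpM2r ?(ltW e0) //; lra.
have : 0 <= Delta * Delta by rewrite mulr_ge0.
nra.
Qed.

Definition arc_mean j k : R := mean A (fun D => ((j, k) \in D)%:R * w D).

(** The transposition of [j] and [l] fixes [k] and carries the arc [(l, k)] to [(j, k)], while it
    changes the weight by a factor within [2 * Delta] of [1]. *)
Lemma arc_mean_near j l k : j != k -> l != k -> `|arc_mean j k - arc_mean l k| <= 2 * Delta * arc_mean l k.
Proof.
move=> jk lk; rewrite {1}/arc_mean -(mean_relabel j l) /arc_mean -meanB -meanZ.
apply: norm_mean_le => D DA.
have -> : ((j, k) \in relabel (tperm j l) D) = ((l, k) \in D).
  by rewrite -{1}(tpermR j l) -{1}(tpermD jk lk) in_relabel.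
rewrite -mulrBr normrM ger0_norm // mulrCA ler_wpM2l //.
have -> : w (relabel (tperm j l) D) - w D = (expR (th * (bilinear (relabel (tperm j l) D) - bilinear D)) - 1) * w D.
  by rewrite /w mulrBl mul1r -expRD mulrBr subrK.
rewrite normrM (ger0_norm (expR_ge0 _)) ler_wpM2r ?expR_ge0 //.
apply: expR_near1; rewrite normrM ger0_norm; last by case/andP: th01.
apply: le_trans (bilinear_swap j l DA); rewrite ler_piMl //; by case/andP: th01.
Qed.

Lemma sum_arc_mean k : \sum_(l | l != k) arc_mean l k = x%:R * mean A w.
Proof.
rewrite /arc_mean -meanZ.
have -> : \sum_(l | l != k) mean A (fun D => ((l, k) \in D)%:R * w D) =
   \sum_(l in [set l | l != k]) mean A (fun D => ((l, k) \in D)%:R * w D) by apply: eq_bigl => l; rewrite inE.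
rewrite -mean_sum; apply: eq_mean => D DA; rewrite -mulr_suml; congr (_ * _).
rewrite -(Ain k DA) /indeg -sum_bool_card [RHS](bigD1 k) //= inE (negbTE (Asimple k DA)) add0r.
by apply: eq_big => [l|l _]; rewrite inE.
Qed.

(* [arc_mean j k] hardly depends on [j], and constants are killed by [\sum_j u j = 0]. *)
Lemma mean_bilinear : (1 < n)%N ->
  `|mean A (fun D => bilinear D * w D)| <= 2 * T ^+ 2 * (2 * n%:R * Delta + 1) * x%:R * mean A w.
Proof.
move=> n1; have D0 := Delta_ge0.
have T0 : 0 <= T by apply: le_trans (uT (Ordinal n1)).
have E0 : 0 <= mean A w by apply: mean_ge0 => D _; exact: expR_ge0.
have n1R : 0 < n%:R - 1 :> R by rewrite subr_gt0 ltr1n.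
have col k : `|(n%:R - 1) * \sum_(j | j != k) u j * arc_mean j k| <= T * (2 * n%:R * Delta + 1) * x%:R * mean A w.
  have cst (c : R) : (n%:R - 1) * c = \sum_(l < n | l != k) c.
    by rewrite mulrBl mul1r -sum_ord_cst (bigD1 k) //= addrAC subrr add0r.
  (* Comparing [arc_mean j k] with all [n - 1] values [arc_mean l k] leaves differences, plus the
     sum of these values times [\sum_(j | j != k) u j], which is [- u k]. *)
  have -> : (n%:R - 1) * \sum_(j | j != k) u j * arc_mean j k =
    \sum_(j | j != k) \sum_(l | l != k) u j * (arc_mean j k - arc_mean l k) - u k * (x%:R * mean A w).
    have -> : - (u k * (x%:R * mean A w)) = (\sum_(j | j != k) u j) * (x%:R * mean A w).
      have : u k + \sum_(j | j != k) u j = 0 by move: u0; rewrite (bigD1 k).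
      by move/eqP; rewrite addrC addr_eq0 => /eqP ->; rewrite mulNr.
    rewrite -(sum_arc_mean k) mulr_suml -big_split mulr_sumr; apply: eq_bigr => j _ /=.
    by rewrite cst mulr_sumr -big_split; apply: eq_bigr => l _ /=; ring.
  apply: le_trans (ler_normB _ _) _.
  have -> : T * (2 * n%:R * Delta + 1) * x%:R * mean A w =
     n%:R * (T * (2 * Delta * (x%:R * mean A w))) + T * (x%:R * mean A w) by ring.
  have xE0 : 0 <= x%:R * mean A w by rewrite mulr_ge0.
  apply: lerD; last by rewrite normrM (ger0_norm xE0) ler_wpM2r.
  apply: le_trans (ler_norm_sum _ _ _) _.
  apply: (@le_trans _ _ (\sum_(j < n | j != k) (T * (2 * Delta * (x%:R * mean A w))))); last first.
    have Y0 : 0 <= T * (2 * Delta * (x%:R * mean A w)).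
      by apply: mulr_ge0 => //; apply: mulr_ge0 => //; apply: mulr_ge0.
    by rewrite -cst ler_wpM2r // gerBl.
  apply: ler_sum => j jk; apply: le_trans (ler_norm_sum _ _ _) _.
  rewrite -(sum_arc_mean k) !mulr_sumr; apply: ler_sum => l lk.
  by rewrite normrM; apply: ler_pM => //; exact: arc_mean_near.
have -> : mean A (fun D => bilinear D * w D) = \sum_k v k * \sum_(j | j != k) u j * arc_mean j k.
  transitivity (\sum_(k in [set: 'I_n]) v k * \sum_(j in [set j | j != k]) u j * arc_mean j k); last first.
    apply: eq_big => [k|k _]; first by rewrite inE.
    by congr (_ * _); apply: eq_bigl => j; rewrite inE.
  under eq_bigr => k _ do under eq_bigr => j _ do rewrite /arc_mean -meanZ.
  under eq_bigr => k _ do rewrite -mean_sum -meanZ.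
  rewrite -mean_sum; apply: eq_mean => D DA.
  rewrite /bilinear (sum_arcs D (fun j k => u j * v k)) exchange_big mulr_suml.
  apply: eq_big => [k|k _]; first by rewrite inE.
  rewrite (bigD1 k) //= (negbTE (Asimple k DA)) mul0r add0r mulr_suml mulr_sumr.
  by apply: eq_big => [j|j _]; [rewrite inE | ring].
rewrite -(ler_pM2l n1R) -{1}(gtr0_norm n1R) -normrM mulr_sumr.
apply: le_trans (ler_norm_sum _ _ _) _.
apply: (@le_trans _ _ (\sum_(k < n) T * (T * (2 * n%:R * Delta + 1) * x%:R * mean A w))).
  by apply: ler_sum => k _; rewrite mulrCA normrM; apply: ler_pM.
rewrite sum_ord_cst.
have -> : (n%:R - 1) * (2 * T ^+ 2 * (2 * n%:R * Delta + 1) * x%:R * mean A w) =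
  (2 * (n%:R - 1)) * (T * (T * (2 * n%:R * Delta + 1) * x%:R * mean A w)) by ring.
have Q0 : 0 <= T * (T * (2 * n%:R * Delta + 1) * x%:R * mean A w).
  by do 4 (apply: mulr_ge0 => //); apply: addr_ge0 => //; do 2 (apply: mulr_ge0 => //).
rewrite ler_wpM2r //.
have : (2 : R) <= n%:R by rewrite ler_nat.
lra.
Qed.

End IsoAverage.

Section IsoExp.
Variables (R : realType) (n : nat) (A : {set digraph n}) (x : nat) (u v : 'I_n -> R) (q e : R).
Hypothesis A0 : A != set0.
Hypothesis Aclosed : forall j l D, D \in A -> relabel (tperm j l) D \in A.
Hypothesis Aout : forall D j, D \in A -> outdeg D j = x.
Hypothesis Ain : forall D j, D \in A -> indeg D j = x.
Hypothesis Asimple : forall D j, D \in A -> (j, j) \notin D.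
Hypotheses (q10 : 10 <= q) (e0 : 0 < e) (small : q ^+ 40 * e <= 1) (ne : n%:R * e ^+ 2 = 1).
Hypotheses (xq : x%:R <= q) (uT : forall j, `|u j| <= q ^+ 3 * e) (vT : forall j, `|v j| <= q ^+ 3 * e).
Hypothesis u0 : \sum_j u j = 0.

(* Writing [Y] for the bilinear form, [1 + Y <= exp Y <= 1 + Y exp Y]. *)
Lemma mean_exp_bilinear : bnd q e 18 1 (mean A (fun D => expR (bilinear u v D)) - 1).
Proof.
have hq := q10; have hx := xq.
have qge : 0 <= q by lra.
have n2 : (1 < n)%N.
  rewrite ltnNge; apply/negP => n1.
  have h1 : e <= 1 / 2 by have := @bnd_small _ q e q10 e0 small 0 e isT; rewrite /bnd expr0 mul1r ger0_norm ?(ltW e0) //; apply.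
  have h2 : e * e <= 1 / 2 * (1 / 2) by apply: ler_pM; rewrite ?(ltW e0).
  have h3 : n%:R * e ^+ 2 <= 1 * e ^+ 2 by rewrite ler_wpM2r ?sqr_ge0 // lern1.
  by move: h3; rewrite ne expr2; lra.
pose De := 8 * x%:R * (q ^+ 3 * e) ^+ 2.
have hDe : bnd q e 8 2 De.
  apply: bnd10 => //; rewrite ger0_norm; last by rewrite /De mulr_ge0 ?sqr_ge0 // mulr_ge0.
  have -> : De = 8 * (x%:R * (q ^+ 6 * e ^+ 2)) by rewrite /De; ring.
  have -> : q ^+ 7 * e ^+ 2 = q * (q ^+ 6 * e ^+ 2) by ring.
  have := ler_wpM2r (bnd_unit_ge0 q10 e0 6 2) xq; have := mulr_ge0 qge (bnd_unit_ge0 q10 e0 6 2); lra.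
have De12 : De <= 1 / 2.
  apply: le_trans (ler_norm _) _; apply: (bnd_small q10 e0 small (isT : (8 < 40)%N)).
  exact: bnd_weak hDe.
pose kap := 2 * (q ^+ 3 * e) ^+ 2 * (2 * n%:R * De + 1) * x%:R.
have main th : 0 <= th <= 1 -> `|mean A (fun D => bilinear u v D * expR (th * bilinear u v D))| <=
    kap * mean A (fun D => expR (th * bilinear u v D)).
  move=> hth; exact: (mean_bilinear Aclosed Aout Ain Asimple uT vT u0 De12 hth n2).
have kap0 : 0 <= kap.
  have D0 : 0 <= De by rewrite /De mulr_ge0 ?sqr_ge0 // mulr_ge0.
  rewrite /kap; apply: mulr_ge0 => //; apply: mulr_ge0; first by rewrite mulr_ge0 ?sqr_ge0.
  by apply: addr_ge0 => //; do 2 (apply: mulr_ge0 => //).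
have hkap : bnd q e 17 1 kap.
  have h1 : bnd q e 9 0 (2 * n%:R * De + 1).
    apply: bnd10 => //.
    have -> : 2 * n%:R * De + 1 = 16 * (n%:R * e ^+ 2) * x%:R * q ^+ 6 + 1 by rewrite /De; ring.
    rewrite ne mulr1 mulr1 ger0_norm; last by rewrite addr_ge0 ?mulr_ge0 ?exprn_ge0.
    have -> : q ^+ 8 = q * (q * q ^+ 6) by ring.
    have q61 : 1 <= q ^+ 6 by rewrite exprn_ege1 //; lra.
    have q60 : 0 <= q ^+ 6 by lra.
    have p1 := ler_wpM2r q60 xq.
    have p2 : 10 * (q * q ^+ 6) <= q * (q * q ^+ 6) by rewrite ler_wpM2r ?mulr_ge0 //; lra.
    have p3 : 1 * 1 <= q * q ^+ 6 by apply: ler_pM; lra.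
    lra.
  have h2 : bnd q e 7 2 (2 * (q ^+ 3 * e) ^+ 2).
    apply: bnd10 => //; rewrite ger0_norm; last by rewrite mulr_ge0 ?sqr_ge0.
    have -> : (q ^+ 3 * e) ^+ 2 = q ^+ 6 * e ^+ 2 by ring.
    by have := bnd_unit_ge0 q10 e0 6 2; lra.
  have h3 : bnd q e 1 0 x%:R by rewrite /bnd mulr1 ger0_norm.
  have := bndM (bndM h2 h1) h3; exact: (bnd_weak q10 e0 small).
have kap12 : kap <= 1 / 2.
  by apply: le_trans (ler_norm _) _; apply: (bnd_small q10 e0 small (isT : (17 < 40)%N)).
set E := mean A (fun D => expR (bilinear u v D)).
have E1 : E = mean A (fun D => expR (1 * bilinear u v D)) by apply: eq_mean => D _; rewrite mul1r.
have up : E <= 1 + kap * E.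
  have : E <= 1 + mean A (fun D => bilinear u v D * expR (1 * bilinear u v D)).
    rewrite -[X in X + _](mean_cst (1 : R) A0) -meanD; apply: le_mean => D _; rewrite mul1r.
    have h := expR_ge1Dx (- bilinear u v D); have p := expR_gt0 (bilinear u v D).
    have := ler_wpM2r (ltW p) h; rewrite expRN mulVf ?gt_eqF //; lra.
  have := main 1 (_ : 0 <= 1 <= 1); rewrite ler01 lexx -E1 => /(_ isT).
  rewrite ler_norml => /andP[_]; lra.
have lo : 1 - kap <= E.
  have h0 : mean A (fun D => 1 + bilinear u v D) <= E by apply: le_mean => D _; exact: expR_ge1Dx.
  move: h0; rewrite meanD mean_cst //.
  have := main 0 (_ : 0 <= 0 <= 1); rewrite ler01 lexx => /(_ isT).
  have -> : mean A (fun D => expR (0 * bilinear u v D)) = 1.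
    by rewrite -[RHS](mean_cst (1 : R) A0); apply: eq_mean => D _; rewrite mul0r expR0.
  have -> : mean A (fun D => bilinear u v D * expR (0 * bilinear u v D)) = mean A (bilinear u v).
    by apply: eq_mean => D _; rewrite mul0r expR0 mulr1.
  rewrite ler_norml mulr1 => /andP[]; lra.
apply: bnd10 => //.
move: hkap; rewrite /bnd (ger0_norm kap0) => hk; apply: (@le_trans _ _ (2 * kap)).
  rewrite ler_norml; apply/andP; split; first by lra.
  have E2 : E <= 2.
    by have : (1 / 2) * E <= 1; [have EE : 0 <= E; [apply: mean_ge0 => D _; exact: expR_ge0|];
      have := ler_wpM2r EE kap12; lra|lra].
  have := ler_wpM2l kap0 E2; lra.
have := bnd_unit_ge0 q10 e0 17 1; lra.
Qed.

End IsoExp.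

Section Core.
Variables (R : realType) (n : nat) (s t : 'I_n -> nat) (L e q : R) (b : bool).
Hypothesis rg0 : regime (diagonal n) set0 s t L e q.
Variables (H : digraph n) (x : nat).
Hypotheses (dH : [disjoint H & diagonal n]) (xq : x%:R + 1 <= q).
Hypotheses (xout : forall j, outdeg H j = x) (xin : forall k, indeg H k = x).
Local Notation mu := (dens_limit L b).
Local Notation dens := (dens_exact n L b).
Local Notation Om := (frozen_class (diagonal n) set0 s t).

Definition meets (Y G : digraph n) : bool := if b then Y \subset G else [disjoint Y & G].

Lemma disjoint_diagonal (Y : digraph n) : [disjoint Y & diagonal n] = simple_digraph Y.
Proof.
rewrite disjoint_subset; apply/subsetP/forallP => [h v|h [j k] jkY].
  by apply/negP => /h; rewrite !inE eqxx.
rewrite !inE; apply/negP => /eqP /= jk; subst k.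
by have := h j; rewrite jkY.
Qed.

Lemma in_pinned_class (Y G : digraph n) : [disjoint Y & diagonal n] ->
  (G \in pinned_class s t b Y) = (G \in Om) && meets Y G.
Proof.
move=> dY; rewrite !inE andbAC; congr (_ && _).
have YD p : p \in Y -> p \in diagonal n = false by move=> pY; apply: (disjointFr dY).
apply/eqP/andP => [h|[/eqP h hm]].
  have hG p : (p \in G) && (p \in diagonal n :|: Y) = (p \in pinned b Y) by rewrite -h in_setI.
  split.
    apply/eqP/setP => p; rewrite !inE; case pd: (p.1 == p.2); last by rewrite andbF.
    have pY : p \in Y = false by apply/negP => /YD; rewrite inE pd.
    have := hG p; rewrite !inE pd /= andbT => ->.
    by rewrite /pinned; case: b; rewrite ?inE ?pY.
  rewrite /meets; case: ifP => hb.
    by apply/subsetP => p pY; have := hG p; rewrite /pinned hb inE pY => /andP[].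
  rewrite disjoint_subset; apply/subsetP => p pY; rewrite inE /=.
  by have := hG p; rewrite /pinned hb !inE pY orbT andbT => ->.
apply/setP => p; rewrite in_setI in_setU /pinned.
have : p \in G :&: diagonal n = false by rewrite h inE.
rewrite in_setI; case pd: (p \in diagonal n); rewrite ?andbT /=.
  move=> ->; have pY : p \in Y = false by apply/negP => /YD; rewrite pd.
  by case: b; rewrite ?inE ?pY.
move=> _; move: hm; rewrite /meets; case: ifP => _.
  by move/subsetP => h1; case pY: (p \in Y); rewrite ?andbF // h1.
move=> h1; rewrite in_set0; apply/negP => /andP[pG pY].
by have := disjointFr h1 pY; rewrite pG.
Qed.

Lemma double_count : (\sum_(G in Om) #|[set H' in iso_copies H | meets H' G]|)%N =
  (\sum_(H' in iso_copies H) #|[set G in Om | meets H' G]|)%N.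
Proof.
under eq_bigr => G _ do rewrite -sum1_card.
under [RHS]eq_bigr => H' _ do rewrite -sum1_card.
rewrite (exchange_big_dep (fun H' => H' \in iso_copies H)) /=; last by move=> G H' _; rewrite inE => /andP[].
apply: eq_bigr => H' H'I; apply: eq_bigl => G.
have -> : (H' \in [set H' in iso_copies H | meets H' G]) = meets H' G by rewrite in_set H'I.
by rewrite [RHS]in_set.
Qed.

Lemma iso_copies_relabel tau H' : H' \in iso_copies H -> relabel tau H' \in iso_copies H.
Proof.
rewrite !inE => /existsP[sigma /eqP ->]; apply/existsP; exists (sigma * tau)%g.
by rewrite relabelM.
Qed.

Lemma iso_copies_neq0 : iso_copies H != set0.
Proof. by apply/set0Pn; exists H; rewrite inE; apply/existsP; exists 1%g; rewrite relabel1. Qed.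

Lemma iso_copies_outdeg H' j : H' \in iso_copies H -> outdeg H' j = x.
Proof.
by rewrite inE => /existsP[sigma /eqP ->]; rewrite -(permKV sigma j) outdeg_relabel.
Qed.

Lemma iso_copies_indeg H' j : H' \in iso_copies H -> indeg H' j = x.
Proof.
by rewrite inE => /existsP[sigma /eqP ->]; rewrite -(permKV sigma j) indeg_relabel.
Qed.

Lemma iso_copies_card H' : H' \in iso_copies H -> #|H'| = #|H|.
Proof.
rewrite inE => /existsP[sigma /eqP ->]; apply: card_imset => -[a c] [a' c'] /= [].
by move=> /perm_inj -> /perm_inj ->.
Qed.

Lemma iso_copies_simple H' j : H' \in iso_copies H -> (j, j) \notin H'.
Proof.
rewrite inE => /existsP[sigma /eqP ->]; rewrite -(permKV sigma j) in_relabel.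
by apply/negP => h; have := disjointFr dH h; rewrite inE eqxx.
Qed.

Lemma iso_copies_disjoint H' : H' \in iso_copies H -> [disjoint H' & diagonal n].
Proof. by move=> h; rewrite disjoint_diagonal; apply/forallP => j; apply: iso_copies_simple. Qed.

Local Notation delta j := (e ^+ 2 * ((s j)%:R - L * n%:R)).
Local Notation eta k := (e ^+ 2 * ((t k)%:R - L * n%:R)).

Definition main_exponent : R :=
  - ((1 - mu) * x%:R * (x%:R - 2)) / (2 * mu) - spread s t L e * x%:R / (2 * mu ^+ 2).

(** After exchanging the summations one sums over the copies. The number [f H'] is the count for one
    copy divided by the factor common to all; up to a factor between [expR (- rho)] and [expR rho]
    it is the exponential of the cross term, whose mean over the copies is close to [1]. *)
Lemma expected_copies : exists2 d, `|d| <= q ^+ 36 * e &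
  (\sum_(G in Om) #|[set H' in iso_copies H | meets H' G]|)%N%:R / #|Om|%:R =
  dens ^+ #|H| * #|iso_copies H|%:R * expR (main_exponent + d).
Proof.
have q10 := reg_q rg0; have e0 := reg_e rg0; have sm := reg_small rg0.
have q0 : 0 <= q by exact: le_trans (ler0n _ 10) q10.
have xleq : x%:R <= q by apply: le_trans xq; rewrite lerDl.
pose rho := q ^+ 34 * e.
have cnt H' : H' \in iso_copies H -> exists2 r, `|r| <= rho &
   #|[set G in Om | meets H' G]|%:R = #|Om|%:R * (dens ^+ #|H| * expR (main_exponent + (cross_term s t L e H' + r))).
  move=> hI.
  have ho j : (outdeg H' j)%:R + 1 <= q by rewrite iso_copies_outdeg.
  have hi j : (indeg H' j)%:R + 1 <= q by rewrite iso_copies_indeg.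
  have [r hr E] := count_regular b rg0 (iso_copies_disjoint hI) ho hi
    (fun j => iso_copies_outdeg j hI) (fun j => iso_copies_indeg j hI).
  exists r => //; move: E; rewrite pinned_class0 iso_copies_card // -!addrA => E.
  rewrite /main_exponent -?addrA -E; congr (_%:R); apply: eq_card => G.
  by rewrite in_pinned_class ?iso_copies_disjoint // inE.
have Om0 : #|Om|%:R != 0 :> R by rewrite pnatr_eq0 cards_eq0 (reg_ex rg0).
have I0 : #|iso_copies H|%:R != 0 :> R by rewrite pnatr_eq0 cards_eq0 iso_copies_neq0.
pose f H' : R := #|[set G in Om | meets H' G]|%:R / (#|Om|%:R * (dens ^+ #|H| * expR main_exponent)).
have d0 := dens_gt0 b rg0.
have D0 : dens ^+ #|H| * expR main_exponent != 0.
  by rewrite mulf_neq0 ?gt_eqF ?expR_gt0 ?exprn_gt0.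
have flo H' : H' \in iso_copies H -> expR (- rho) * expR (cross_term s t L e H') <= f H' <= expR rho * expR (cross_term s t L e H').
  move=> hI; have [r hr E] := cnt _ hI.
  have -> : f H' = expR r * expR (cross_term s t L e H').
    rewrite /f E (expRD main_exponent) (expRD (cross_term _ _ _ _ _)).
    have c0 : #|Om|%:R * (dens ^+ #|H| * expR main_exponent) != 0 by rewrite mulf_neq0.
    rewrite !mulrA in c0 *; rewrite -mulrA mulrC mulKf // mulrC //.
  move: hr; rewrite ler_norml => /andP[h1 h2].
  by rewrite !ler_wpM2r ?expR_ge0 ?ler_expR.
pose m := mean (iso_copies H) (fun H' => expR (cross_term s t L e H')).
have mE : bnd q e 18 1 (m - 1).
  pose u j := - (L * (1 - L))^-1 * delta j.
  pose v k := eta k.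
  have -> : m = mean (iso_copies H) (fun H' => expR (bilinear u v H')).
    apply: eq_mean => H' _; rewrite /cross_term /bilinear mulr_sumr; congr (expR _).
    by apply: eq_bigr => p _; exact: mulrA.
  have v1 k : `|v k| <= q ^+ 3 * e.
    have := bnd_weak q10 e0 sm (isT : (1 <= 3)%N) (leqnn 1) (dev_t_bnd rg0 k).
    by rewrite /bnd expr1.
  have u1 j : `|u j| <= q ^+ 3 * e.
    have hL : bnd q e 2 0 (- (L * (1 - L))^-1).
      apply: bndN; have /andP[L0 L1] := reg_L01 rg0.
      have -> : (L * (1 - L))^-1 = 2 * (2 * L * (1 - L))^-1.
        by field; rewrite !gt_eqF //; lra.
      apply: bnd10 => //; rewrite normrM ger0_norm //.
      have := vV_bnd rg0; have := bnd_unit_ge0 q10 e0 1 0; rewrite /bnd; lra.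
    by have := bndM hL (dev_s_bnd rg0 j); rewrite /bnd expr1.
  apply: (@mean_exp_bilinear R n (iso_copies H) x u v q e) => //.
  - exact: iso_copies_neq0.
  - by move=> j l D; exact: iso_copies_relabel.
  - by move=> D j; exact: iso_copies_outdeg.
  - by move=> D j; exact: iso_copies_indeg.
  - by move=> D j; exact: iso_copies_simple.
  - exact: (reg_n rg0).
  by rewrite /u -mulr_sumr (sum_delta rg0) mulr0.
have [r0 mr hr0] := ExpTaylor.exp_log_near (bnd_small q10 e0 sm (isT : (18 < 40)%N) mE).
have {}mr : m = expR r0 by rewrite -mr addrC subrK.
pose mf := mean (iso_copies H) f.
have mflo : expR (- rho) * m <= mf.
  by rewrite /m -meanZ; apply: le_mean => H' hI; case/andP: (flo _ hI).
have mfhi : mf <= expR rho * m.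
  by rewrite /m -meanZ; apply: le_mean => H' hI; case/andP: (flo _ hI).
have mf0 : 0 < mf by apply: lt_le_trans mflo; rewrite mr mulr_gt0 ?expR_gt0.
exists (ln mf).
  have l1 : - rho + r0 <= ln mf by rewrite -ler_expR lnK // expRD -mr.
  have l2 : ln mf <= rho + r0 by rewrite -ler_expR lnK // expRD -mr.
  have b1 : bnd q e 34 1 rho by rewrite /bnd expr1 ger0_norm // mulr_ge0 ?exprn_ge0 ?(ltW e0).
  have b2 : bnd q e 34 1 r0.
    apply: (bnd_weak q10 e0 sm (isT : (19 <= 34)%N) (leqnn 1)); apply: bnd10 => //.
    by apply: le_trans hr0 _; move: mE; rewrite /bnd; have := bnd_unit_ge0 q10 e0 18 1; lra.
  apply: (@le_trans _ _ (q ^+ 35 * e ^+ 1)); last first.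
    rewrite expr1 ler_wpM2r ?(ltW e0) // ler_weXn2l //; exact: le_trans (ler1n _ 10) q10.
  move: b1 b2; rewrite -/(bnd q e 35 1 (ln mf)) => b1 b2; apply: bnd10 => //.
  move: b1 b2 l1 l2; rewrite /bnd; have := bnd_unit_ge0 q10 e0 34 1.
  move: (q ^+ 34 * e ^+ 1) (rho) (r0) (ln mf) => B a c d B0; rewrite !ler_norml; lra.
rewrite double_count natr_sum expRD lnK //.
have -> : \sum_(H' in iso_copies H) #|[set G in Om | meets H' G]|%:R =
    \sum_(H' in iso_copies H) f H' * (#|Om|%:R * (dens ^+ #|H| * expR main_exponent)).
  by apply: eq_bigr => H' _; rewrite /f divfK // mulf_neq0.
rewrite -mulr_suml /mf /mean.
move: (\sum_(H' in _) f H') (expR main_exponent) (dens ^+ #|H|) => S a c.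
by field; rewrite Om0 I0.
Qed.

End Core.

(** * Asymptotics *)

Section Asymptotics.
Variables (R : realType).

Lemma Dst_frozen_class n (s t : 'I_n -> nat) : Dst s t = frozen_class (diagonal n) set0 s t.
Proof.
apply/setP => M; rewrite in_set [RHS]in_set; congr (_ && _).
by rewrite setI_eq0 disjoint_diagonal.
Qed.

Lemma outdeg_diagonal n (j : 'I_n) : outdeg (diagonal n) j = 1%N.
Proof. by rewrite /outdeg -(cards1 j); apply: eq_card => k; rewrite !inE eq_sym. Qed.

Lemma indeg_diagonal n (j : 'I_n) : indeg (diagonal n) j = 1%N.
Proof. by rewrite /indeg -(cards1 j); apply: eq_card => k; rewrite !inE. Qed.

Lemma outdeg_simple n (G : digraph n) j : simple_digraph G -> (outdeg G j < n)%N.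
Proof.
move=> /forallP /(_ j) jG; rewrite -[X in (_ < X)%N]card_ord /outdeg -cardsT.
by apply: proper_card; rewrite properE subsetT /=; apply/subsetPn; exists j; rewrite // inE.
Qed.

Lemma eventually_large (eps C : R) : 0 < eps -> 0 < C ->
  exists N : nat, forall n, (N <= n)%N -> (0 < n)%N /\ C <= expR (eps * ln n%:R).
Proof.
move=> eps0 C0; exists (Num.bound (expR (ln C / eps))).+1 => n Nn.
have n0 : (0 < n)%N by apply: leq_trans Nn.
split=> //; have nR : 0 < n%:R :> R by rewrite ltr0n.
have h : expR (ln C / eps) <= n%:R.
  apply: le_trans (ltW (archi_boundP (expR_ge0 _))) _; rewrite ler_nat.
  by apply: leq_trans Nn.
rewrite -[leLHS](lnK C0) ler_expR.
have : ln C / eps <= ln n%:R by rewrite -ler_expR lnK.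
by rewrite ler_pdivrMr // mulrC.
Qed.

Lemma cube_growth (y : R) : 10 <= y ->
  [/\ 10 * 10 <= y * y, 10 * y <= y * y, 10 * (y * y) <= y ^+ 3 & 10 <= y ^+ 3].
Proof.
move=> y10; have y0 : 0 <= y by lra.
have h1 : 10 * y <= y * y by rewrite ler_wpM2r.
have h2 : 10 * 10 <= y * y by apply: ler_pM; lra.
have h3 : 10 * (y * y) <= y ^+ 3 by have -> : y ^+ 3 = y * (y * y) by [ring]; rewrite ler_wpM2r ?mulr_ge0.
by split=> //; lra.
Qed.

(** A density above [1 / 4] is no problem. Otherwise [(1 - 2 * L) ^+ 2] is at least [1 / 4], and the
    logarithmic hypothesis bounds [L * (1 - L)], hence [mu], below by [y ^- 2]. *)
Lemma density_lower (L mu q y al : R) : 0 < mu -> mu < 1 -> mu = L \/ mu = 1 - L ->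
  10 <= y -> q = y ^+ 3 -> al <= y ^+ 2 / 6 ->
  (1 - 2 * L) ^+ 2 / (3 * (L * (1 - L) / 2)) <= al -> 1 <= q * mu.
Proof.
move=> mu0 mu1 hmu y10 -> hal h.
have W0 : 0 < L * (1 - L) by case: hmu => hm; rewrite hm in mu0 mu1; rewrite mulr_gt0 //; lra.
have Wmu : L * (1 - L) <= mu.
  by case: hmu => hm; rewrite hm; rewrite hm in mu0 mu1; [rewrite ler_piMr | rewrite ler_piMl]; lra.
have [y2 _ y3 _] := cube_growth y10.
have [m4|m4] := leP mu (1 / 4); last first.
  have : 1000 * (1 / 4) <= y ^+ 3 * mu by apply: ler_pM; lra.
  lra.
have hs : 1 / 4 <= (1 - 2 * L) ^+ 2.
  have : 1 / 2 * (1 / 2) <= (1 - 2 * mu) * (1 - 2 * mu) by apply: ler_pM; lra.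
  by case: hmu => hm; rewrite hm expr2; lra.
have {}h : (1 - 2 * L) ^+ 2 <= y ^+ 2 / 6 * (3 * (L * (1 - L) / 2)).
  rewrite -ler_pdivrMr; first exact: le_trans h hal.
  by rewrite mulr_gt0 // divr_gt0.
have h1 : 1 <= y ^+ 2 * (L * (1 - L)) by lra.
apply: le_trans h1 _; apply: ler_pM; rewrite ?sqr_ge0 ?(ltW W0) //.
by rewrite expr2; lra.
Qed.

(** Used with [l = ln n]; logarithms are absorbed through [l <= y / eps]. In the last bound [7] is
    [1 + 6], and with [4 <= expR 4] it yields [4 * n%:R * expR (- y ^+ 3) <= n^(-6)], the condition
    [reg_tail]. *)
Lemma scale_bounds (a eps Cb l y : R) : 0 < a -> 0 < eps -> 0 <= l -> y = expR (eps * l) ->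
  10 + 2 * `|Cb| + 6 * (a / eps) + 9 * (1 / eps) <= y ->
  [/\ 10 <= y, Cb * y <= y ^+ 3, Cb * y ^+ 2 + 1 <= y ^+ 3, a * l <= y ^+ 2 / 6 & 4 + 7 * l <= y ^+ 3].
Proof.
move=> a0 eps0 l0 yE h.
have ly : l <= 1 / eps * y.
  by rewrite div1r ler_pdivlMl // yE; apply: le_trans (expR_ge1Dx _); rewrite lerDr.
have aeps : 0 < a / eps by rewrite divr_gt0.
have ieps : 0 < 1 / eps by rewrite divr_gt0.
have hCb := ler_norm Cb; have hCb0 := normr_ge0 Cb.
have [y10 yCb ya ye] : [/\ 10 <= y, 2 * Cb <= y, 6 * (a / eps) <= y & 9 * (1 / eps) <= y].
  by move: h {yE ly}; split; lra.
have y0 : 0 <= y by exact: le_trans y10.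
have [y2 y2y y3 q10] := cube_growth y10.
have q3 : y ^+ 3 = y * (y * y) by ring.
have c1 := ler_wpM2r y0 yCb; have c2 := ler_wpM2r (mulr_ge0 y0 y0) yCb.
have c3 : 6 * (a * l) <= y * y.
  apply: (@le_trans _ _ (6 * (a * (1 / eps * y)))); first by rewrite !ler_pM2l.
  by have -> : 6 * (a * (1 / eps * y)) = 6 * (a / eps) * y by [ring]; rewrite ler_wpM2r.
have c4 : 9 * l <= y * y.
  apply: (@le_trans _ _ (9 * (1 / eps * y))); first by rewrite ler_pM2l.
  by rewrite mulrA ler_wpM2r.
move: c1 c2 c3 c4 y2 y2y y3; rewrite !expr2 => {h yE ly aeps ieps hCb hCb0 yCb ya ye q10 eps0 a0}.
by split; lra.
Qed.

Lemma expR4_ge4 : 4 <= expR 4 :> R.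
Proof. by apply: le_trans (expR_ge1Dx _); lra. Qed.

Lemma main_exponentE n (s t : 'I_n -> nat) (L e : R) bb x : n%:R * e ^+ 2 = 1 -> 0 < dens_limit L bb ->
  main_exponent s t L e bb x =
  - ((1 - dens_limit L bb) * x%:R * (x%:R - 2)) / (2 * dens_limit L bb)
  - (\sum_j ((s j)%:R - L * n%:R) ^+ 2 + \sum_j ((t j)%:R - L * n%:R) ^+ 2) * x%:R /
    (2 * dens_limit L bb ^+ 2 * n%:R ^+ 2).
Proof.
move=> ne m0; rewrite /main_exponent /spread; congr (_ - _).
have sq (f : 'I_n -> nat) : \sum_j (e ^+ 2 * ((f j)%:R - L * n%:R)) ^+ 2 =
    (n%:R ^+ 2)^-1 * \sum_j ((f j)%:R - L * n%:R) ^+ 2.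
  have n0 : n%:R != 0 :> R by apply: contra_eq_neq ne => ->; rewrite mul0r eq_sym oner_neq0.
  have e2 : e ^+ 2 = n%:R^-1 by apply: (mulfI n0); rewrite ne divff.
  by rewrite mulr_sumr; apply: eq_bigr => j _; rewrite e2 exprMn exprVn.
have n0 : n%:R != 0 :> R by apply: contra_eq_neq ne => ->; rewrite mul0r eq_sym oner_neq0.
rewrite !sq; set A := bigop _ _ _; set B := bigop _ _ _; move: (dens_limit L bb) m0 => m m0.
by field; rewrite n0 gt_eqF.
Qed.

Theorem expected_copies_asymptotic (a b : R) : 0 < a -> 0 < b -> a + b < 1 / 2 ->
  exists2 eps0 : R, 0 < eps0 & forall eps : R, 0 < eps -> eps < eps0 -> forall Cb : R,
  exists N : nat, forall (n : nat) (s t : 'I_n -> nat) (H : digraph n) (x : nat) (L : R),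
  let pow p := expR (p * ln n%:R) in
  (N <= n)%N -> (forall j, 0 < s j)%N ->
  (\sum_(j < n) s j = \sum_(j < n) t j)%N ->
  L = (\sum_(j < n) s j)%N%:R / n%:R / n%:R ->
  simple_digraph H -> (forall j, outdeg H j = x) -> (forall j, indeg H j = x) ->
  (forall j, `|(s j)%:R - L * n%:R| <= Cb * pow (1 / 2 + eps)) ->
  (forall j, `|(t j)%:R - L * n%:R| <= Cb * pow (1 / 2 + eps)) ->
  #|H|%:R <= Cb * pow (1 + 2 * eps) ->
  (1 - 2 * L) ^+ 2 / (3 * (L * (1 - L) / 2)) <= a * ln n%:R ->
  Dst s t != set0 ->
  forall bb : bool, exists2 d : R, `|d| <= pow (- b) &
    (\sum_(G in Dst s t) #|[set H' in iso_copies H | meets bb H' G]|)%N%:R / #|Dst s t|%:R =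
    dens_exact n L bb ^+ #|H| * #|iso_copies H|%:R *
    expR (- ((1 - dens_limit L bb) * x%:R * (x%:R - 2)) / (2 * dens_limit L bb)
      - (\sum_j ((s j)%:R - L * n%:R) ^+ 2 + \sum_j ((t j)%:R - L * n%:R) ^+ 2) * x%:R /
        (2 * dens_limit L bb ^+ 2 * n%:R ^+ 2) + d).
Proof.
(* The factor [120] is [3 * 40]: with [q = n^(3 eps)] it ensures [q ^+ 40 * e <= 1], and the final
   error [q ^+ 36 * e = n^(108 eps - 1/2)] is at most [n^(-b)]. *)
move=> a0 b0 ab; exists ((1 / 2 - b) / 120) => [|eps eps0 epsb Cb]; first by rewrite divr_gt0 //; lra.
have {}epsb : 120 * eps < 1 / 2 - b by rewrite -(ltr_pdivlMl _ _ (_ : 0 < 120)) // mulrC.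
have eps120 : 120 * eps - 1 / 2 <= 0 by lra.
have eps108 : 108 * eps - 1 / 2 <= - b by lra.
have C0 : 0 < 10 + 2 * `|Cb| + 6 * (a / eps) + 9 * (1 / eps).
  have := normr_ge0 Cb; have := divr_gt0 a0 eps0; have := divr_gt0 ltr01 eps0.
  by lra.
have [N hN] := eventually_large eps0 C0; exists N.
move=> n s t H x L pow Nn s0 st LE simH xout xin hs ht hH hA D0 bb.
have [n0 yC] := hN n Nn; pose l : R := ln n%:R; rewrite -/l in hA yC.
have powlE p : pow p = expR (p * l) by [].
have nR : 0 < n%:R :> R by rewrite ltr0n.
have nE : n%:R = expR l by rewrite lnK.
have l0 : 0 <= l by apply: ln_ge0; rewrite ler1n.
pose y := expR (eps * l); pose q := y ^+ 3; pose e := expR (- (1 / 2) * l).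
have e0 : 0 < e by exact: expR_gt0.
have [y10 Cby Cby2 hal yl] := scale_bounds a0 eps0 l0 erefl yC; rewrite -/y -/q in y10 Cby Cby2 hal yl.
have [_ _ _ q10] := cube_growth y10; rewrite -/q in q10.
have qE m : q ^+ m = expR ((3 * m)%:R * (eps * l)) by rewrite /q -exprM -expRM_natl.
have eE m : e ^+ m = expR (m%:R * (- (1 / 2) * l)) by rewrite -expRM_natl.
have ne : n%:R * e ^+ 2 = 1 by rewrite nE eE -expRD (_ : l + _ = 0) ?expR0 //; field.
have small : q ^+ 40 * e <= 1.
  rewrite qE -expRD -[leRHS]expR0 ler_expR.
  have -> : (3 * 40)%:R * (eps * l) + - (1 / 2) * l = (120 * eps - 1 / 2) * l by ring.
  by rewrite mulr_le0_ge0.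
have tail : 4 * n%:R * expR (- q) <= e ^+ 12.
  apply: (@le_trans _ _ (expR 4 * n%:R * expR (- q))).
    by rewrite !ler_wpM2r ?expR_ge0 ?expR4_ge4.
  rewrite nE eE -!expRD ler_expR lerBlDr -lerBlDl; apply: le_trans yl.
  by rewrite le_eqVlt; apply/orP; left; apply/eqP; field.
have [G] : exists G, G \in Dst s t by apply/set0Pn.
rewrite in_set => /andP[simG /forallP degG].
have L0 : 0 < L.
  rewrite LE !divr_gt0 // ltr0n; apply: leq_trans (s0 (Ordinal n0)) _.
  by rewrite (bigD1 (Ordinal n0)) //= leq_addr.
have LnE : L * n%:R ^+ 2 = (\sum_(j < n) s j)%N%:R by rewrite LE; field; rewrite gt_eqF.
have L1 : L < 1.
  rewrite -(ltr_pM2r (exprn_gt0 2 nR)) LnE mul1r.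
  apply: (@le_lt_trans _ _ (\sum_(j < n) (n%:R - 1))); last first.
    by rewrite sum_ord_cst expr2 ltr_pM2l // ltrBlDr ltrDl ltr01.
  rewrite natr_sum; apply: ler_sum => j _.
  have := degG j => /andP[/eqP <- _]; rewrite lerBrDr natr1 ler_nat.
  exact: outdeg_simple.
have hL : 1 <= q * L by apply: (density_lower (L := L) L0 L1 _ y10 erefl hal hA); left.
have h1L : 1 <= q * (1 - L).
  by apply: (density_lower (L := L) _ _ _ y10 erefl hal hA); [rewrite subr_gt0 | rewrite gtrBl | right].
have powE : pow (1 / 2 + eps) * e = y by rewrite powlE -expRD; congr expR; ring.
have dev z : `|z| <= Cb * pow (1 / 2 + eps) -> `|z| * e <= q.
  move=> /(ler_wpM2r (ltW e0)) h; apply: le_trans h _; rewrite -mulrA powE; exact: Cby.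
have cH : #|H|%:R = n%:R * x%:R :> R.
  by rewrite -(sum_outdeg R H) -sum_ord_cst; apply: eq_bigr => j _; rewrite xout.
(* By regularity [H] has [n x] arcs, so the bound on their number gives [x%:R <= Cb * y ^+ 2], which
   the cube in [q] absorbs. *)
have xq : x%:R + 1 <= q.
  have powE2 : pow (1 + 2 * eps) = n%:R * y ^+ 2.
    by rewrite powlE nE /y -expRM_natl -expRD; congr expR; ring.
  move: hH; rewrite cH powE2 mulrCA ler_pM2l // => h.
  by apply: le_trans Cby2; rewrite lerD2r.
have rg0 : regime (diagonal n) set0 s t L e q.
  split => //.
  - by move=> j; rewrite outdeg_diagonal; apply: le_trans q10; rewrite ler1n.
  - by move=> j; rewrite indeg_diagonal; apply: le_trans q10; rewrite ler1n.
  - by move=> j; apply: dev.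
  - by move=> j; apply: dev.
  - by rewrite LnE natr_sum.
  - by rewrite LnE st natr_sum.
  by rewrite -Dst_frozen_class.
have dH : [disjoint H & diagonal n] by rewrite disjoint_diagonal.
have [d hd E] := expected_copies bb rg0 dH xq xout xin.
exists d.
  apply: le_trans hd _; rewrite powlE qE -expRD ler_expR.
  have -> : (3 * 36)%:R * (eps * l) + - (1 / 2) * l = (108 * eps - 1 / 2) * l by ring.
  by rewrite ler_wpM2r.
by rewrite Dst_frozen_class E (main_exponentE _ _ _ ne (dens_limit_gt0 bb rg0)).
Qed.

End Asymptotics.

(* Transfer to the real numbers of the statement *)
From mathcomp Require Import Rstruct Rstruct_topology.
From Stdlib Require Import Reals.
Local Close Scope R_scope.
Local Delimit Scope ring_scope with ring.

Lemma RpowerE (x y : R) : Rpower x y = expR (y * exp.ln x).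
Proof. by rewrite /Rpower RexpE RlnE. Qed.

Lemma lamE n (s : 'I_n -> nat) : lam s = (\sum_(j < n) s j)%N%:R / n%:R / n%:R.
Proof. by rewrite /lam /savg !INRE. Qed.

Lemma savgE n (s : 'I_n -> nat) : savg s = lam s * n%:R.
Proof.
(* For [n = 0] both sides are [0], by the default value of division. *)
have [n0|n0] := eqVneq (n%:R : R) 0; last by rewrite lamE /savg !INRE mulfVK.
by rewrite /lam /savg !INRE n0 !RdivE invr0 !mulr0.
Qed.

Lemma RdevE n (s : 'I_n -> nat) : Rdev s = \sum_j ((s j)%:R - lam s * n%:R) ^+ 2.
Proof. by apply: eq_bigr => j _; rewrite RpowE INRE savgE. Qed.

Lemma CdevE n (s t : 'I_n -> nat) : Cdev s t = \sum_j ((t j)%:R - lam s * n%:R) ^+ 2.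
Proof. by apply: eq_bigr => j _; rewrite RpowE INRE savgE. Qed.

Lemma Rabs_savgE n (s : 'I_n -> nat) (m : nat) (z : R) :
  Rle (Rabs (Rminus (INR m) (savg s))) z -> `|m%:R - lam s * n%:R| <= z.
Proof. by move/RleP; rewrite RabsE savgE INRE. Qed.

Open Scope R_scope.

Theorem theorem3p4 :
  forall a b : R, 0 < a -> 0 < b -> a + b < 1 / 2 ->
  exists eps0 : R, 0 < eps0 /\
  forall eps : R, 0 < eps -> eps < eps0 ->
  (* Cb: the implicit constant in the O(.) hypotheses on the data *)
  forall Cb : R,
  exists (K : R) (N : nat),
  forall (n : nat) (s t : 'I_n -> nat) (H : digraph n) (x : nat),
    (N <= n)%nat ->
    (forall j, (0 < s j)%nat) -> (forall j, (0 < t j)%nat) ->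
    (\sum_(j < n) s j = \sum_(j < n) t j)%nat ->
    simple_digraph H ->
    (forall j, outdeg H j = x) -> (forall j, indeg H j = x) ->
    (forall j, Rabs (INR (s j) - savg s) <= Cb * Rpower (INR n) (1 / 2 + eps)) ->
    (forall j, Rabs (INR (t j) - savg s) <= Cb * Rpower (INR n) (1 / 2 + eps)) ->
    INR x <= Cb * Rpower (INR n) (1 / 2 + eps) ->
    INR #|H| <= Cb * Rpower (INR n) (1 + 2 * eps) ->
    (1 - 2 * lam s) ^ 2 / (3 * Acoef s) <= a * ln (INR n) ->
    Dst s t != set0 ->
    (exists d : R, Rabs d <= K * Rpower (INR n) (- b) /\
       expect_unif s t (n_contained H) =
       pdens s ^ #|H| * INR #|iso_copies H| *
        exp (- ((1 - lam s) * INR x * (INR x - 2)) / (2 * lam s)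
             - (Rdev s + Cdev s t) * INR x / (2 * lam s ^ 2 * INR n ^ 2) + d))
    /\
    (exists d : R, Rabs d <= K * Rpower (INR n) (- b) /\
       expect_unif s t (n_disjoint H) =
       (1 - pdens s) ^ #|H| * INR #|iso_copies H| *
        exp (- (lam s * INR x * (INR x - 2)) / (2 * (1 - lam s))
             - (Rdev s + Cdev s t) * INR x / (2 * (1 - lam s) ^ 2 * INR n ^ 2) + d)).
Proof.
move=> a b /RltP a0 /RltP b0 /RltP ab.
have [eps0 eps0_gt0 core] := expected_copies_asymptotic (R := Rdefinitions.R) a0 b0 ab.
exists eps0; split; first exact/RltP.
move=> eps /RltP h0 /RltP h1 Cb.
have [N {}core] := core eps h0 h1 Cb.
(* The slack in the exponent of [n] has absorbed all constants, so the implicit constant of the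
   error term can be [1]. *)
exists 1, N => n s t H x nN s0 _ st simH xout xin sdev tdev _ sizeH denseL D0.
have {}sdev j := Rabs_savgE (sdev j); have {}tdev j := Rabs_savgE (tdev j).
move: sizeH denseL => /RleP sizeH /RleP denseL.
rewrite INRE RpowerE INRE in sizeH.
rewrite RpowE INRE RlnE in denseL.
rewrite RpowerE INRE in sdev, tdev.
have {core} main := core n s t H x (lam s) nN s0 st (lamE s) simH xout xin
  sdev tdev sizeH denseL D0.
have bound d : (`|d| <= expR (- b * exp.ln n%:R))%ring -> Rabs d <= 1 * Rpower (INR n) (- b).
  by move=> h; apply/RleP; rewrite RabsE RpowerE INRE RmultE mul1r.
split.
  have [d hd E] := main true; exists d; split; first exact: bound.
  move: E; rewrite /expect_unif /n_contained RdevE CdevE !RpowE RexpE.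
  by rewrite !INRE /pdens savgE INRE; exact.
have [d hd E] := main false; exists d; split; first exact: bound.
move: E; rewrite /expect_unif /n_disjoint RdevE CdevE !RpowE RexpE.
by rewrite /dens_exact /dens_limit subKr !INRE /pdens savgE INRE; exact.
Qed.
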